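(* Let $B^2$ be the closed Euclidean unit disk centered at the origin in $\mathbb{R}^2$. For any integer $n \geq 4$ and any spindle convex disk $K$ (that is, any $B^2$-convex disk $K$), we have $$\hat{a}_{n-1}^{B^2}(K) + \hat{a}_{n+1}^{B^2}(K) \leq 2\, \hat{a}_n^{B^2}(K).$$
   Context: A convex disk is a compact, convex set with nonempty interior in $\mathbb{R}^2$. For $p,q\in\mathbb{R}^2$, the spindle $[p,q]_{B^2}$ is the intersection of all translates of $B^2$ (closed unit disks) containing both $p$ and $q$; if no translate of $B^2$ contains both $p$ and $q$, we set $[p,q]_{B^2}=\mathbb{R}^2$. A convex disk $K$ is called spindle convex ($B^2$-convex) if $[p,q]_{B^2}\subseteq K$ for all $p,q\in K$; equivalently, $K$ is an intersection of translates of $B^2$. For $m\ge 3$, a $B^2$-$m$-gon (disk-$m$-gon) is the intersection of $m$ (not necessarily distinct) translates of $B^2$; equivalently, it is the $B^2$-convex hull (the intersection of all translates of $B^2$ containing the set) of at most $m$ points. For a spindle convex disk $K$, $$\hat{a}_m^{B^2}(K)=\sup\{\operatorname{area}(Q): Q \text{ is a } B^2\text{-}m\text{-gon inscribed in } K\},$$ where inscribed in $K$ means contained in $K$. *)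

(* Defs.v *)
From HB Require Import structures.
From mathcomp Require Import all_boot all_order all_algebra.
From mathcomp Require Import all_classical all_reals all_analysis.
Import Order.TTheory GRing.Theory Num.Theory.
Import numFieldNormedType.Exports.

Set Implicit Arguments.
Unset Strict Implicit.
Unset Printing Implicit Defensive.

Local Open Scope classical_set_scope.
Local Open Scope ring_scope.

(* The norm that the library puts on [R * R] is the maximum norm, hence the
   explicit Euclidean formula; both norms induce the product topology. *)
Definition unit_disk (R : realType) : set (R * R) :=
  [set x | x.1 ^+ 2 + x.2 ^+ 2 <= 1].

Definition disk_at (R : realType) (c : R * R) : set (R * R) :=
  [set c + x | x in @unit_disk R].

Definition convex_disk (R : realType) (K : set (R * R)) : Prop :=
  [/\ compact K, convex_set (K : set (R^o * R^o)%type) & K° !=set0].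

(* When no unit disk contains both points, the intersection is over an empty
   family, so that the spindle is the whole plane. *)
Definition spindle (R : realType) (p q : R * R) : set (R * R) :=
  \bigcap_(c in [set c | disk_at c p /\ disk_at c q]) disk_at c.

Definition spindle_convex_disk (R : realType) (K : set (R * R)) : Prop :=
  convex_disk K /\ (forall p q, K p -> K q -> spindle p q `<=` K).

(* The disks may coincide, and their intersection may degenerate to a point or
   to the empty set; such sets have area zero. *)
Definition disk_polygon (R : realType) (m : nat) (Q : set (R * R)) : Prop :=
  exists c : 'I_m -> R * R, Q = \bigcap_i disk_at (c i).

Definition area (R : realType) (A : set (R * R)) : \bar R :=
  (lebesgue_measure \x lebesgue_measure)%E A.

Definition max_inscribed_area (R : realType) (m : nat) (K : set (R * R)) :
  \bar R :=
  ereal_sup [set area Q | Q in [set Q | disk_polygon m Q /\ Q `<=` K]].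

(* Main.v *)
Require Import Defs.
From mathcomp Require Import all_boot all_order all_algebra.
From mathcomp Require Import all_classical all_reals all_analysis.
From mathcomp Require Import measurable_realfun.
From mathcomp Require Import ring lra zify.
Import Order.TTheory GRing.Theory Num.Theory.
Import numFieldNormedType.Exports.

(** If K contains two points at distance 2, then K is a unit disk and all three
    quantities equal its area.  Otherwise let x(s) be the boundary point of K
    with outer normal of angle s.  Two such points x(s), x(t) determine a unit
    disk having both on its boundary; let F(s, t) be the area of the cap of K
    outside that disk.  A disk polygon in K with m sides yields m directions in
    cyclic order whose caps are disjoint from it and from each other, and
    conversely m directions in cyclic order cut out a disk polygon in K.  So
    area K - a_m(K) is the infimum of the sums of the F(s_i, s_(i+1)) over
    cyclic sequences of m directions.  As in Dowker's theorem, its convexity in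
    m follows from F(a, c) + F(b, d) <= F(a, d) + F(b, c) for
    a <= b <= c <= d <= a + pi.

    F(s, t) + wt(x(s), x(t)) is additive in (s, t), where wt(p, q) is the area
    between the origin, the chord from p to q and the unit arc over it.  So the
    inequality says that wt(a, d) + wt(b, c) <= wt(a, c) + wt(b, d); it follows
    from the sign of the mixed second derivative of wt when p and q move along
    the arcs from x(a) to x(b) and from x(c) to x(d). *)

(** Directions, not points, are the variables because a boundary point may have many outer normals
    while a direction has only one point. The price is large gaps: the exchange inequality needs
    four directions within a half turn, but consecutive directions may lie further apart. In the
    crossing argument every exchange takes place inside one gap of the shorter sequence, so only
    that sequence must be repaired. A gap above pi is traded for two opposite directions inside it
    whose points are at least as far apart as the ends of the gap; a longer chord spans a lens of
    larger area and so leaves less area outside.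

    A polygon is given by disks, whereas its vertices are needed to find directions. The centers of
    its disks form a cyclic configuration of the same kind as points on the boundary of K, and the
    edge centers of that configuration are the vertices.

    That F + wt is additive is seen by realizing it, up to a telescoping term, as the area of a
    region below the boundary. This needs upward normals, that is angles in [0, pi]; a rotation
    brings any half turn there. *)

Set Implicit Arguments.
Unset Strict Implicit.
Unset Printing Implicit Defensive.
Local Open Scope classical_set_scope.
Local Open Scope ring_scope.

(** * Unit disks and their support directions *)

Section angles.
Context {R : realType}.
Implicit Types s t x a b c : R.

Lemma sin_pi_le0 x : pi <= x <= pi *+ 2 -> sin x <= 0 :> R.
Proof.
move=> /andP[h1 h2]; have -> : x = (x - pi) + pi by ring.
rewrite sinDpi oppr_le0; apply: sin_ge0_pi.
by move: h2; rewrite mulr2n => h2; apply/andP; split; lra.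
Qed.

Lemma sin_pi_lt0 x : pi < x < pi *+ 2 -> sin x < 0 :> R.
Proof.
move=> /andP[h1 h2]; have -> : x = (x - pi) + pi by ring.
rewrite sinDpi oppr_lt0; apply: sin_gt0_pi.
by move: h2; rewrite mulr2n => h2; apply/andP; split; lra.
Qed.

Lemma cosDn2pi (n : int) x : cos (x + n%:~R * (pi *+ 2)) = cos x.
Proof.
case: n => n.
  by rewrite -pmulrn mulr_natl (periodicn (@cosD2pi R)).
rewrite NegzE mulrNz mulNr -[in RHS](subrK (n.+1%:R * (pi *+ 2)) x).
rewrite [in RHS]mulr_natl (periodicn (@cosD2pi R)).
by rewrite -pmulrn mulr_natl.
Qed.

Lemma sinDn2pi (n : int) x : sin (x + n%:~R * (pi *+ 2)) = sin x.
Proof.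
by rewrite -!cosBpihalf -addrAC cosDn2pi.
Qed.

Lemma argument b (x y : R) : x ^+ 2 + y ^+ 2 = 1 ->
  exists s, [/\ b <= s < b + pi *+ 2, cos s = x & sin s = y].
Proof.
move=> e.
have [s0 [c0 s0E]] : exists s, cos s = x /\ sin s = y.
  have hx : -1 <= x <= 1 by apply/andP; split; nra.
  have hc : cos (acos x) = x by apply: acosK; rewrite in_itv.
  have hs : sin (acos x) = `|y|.
    rewrite sin_acos // -sqrtr_sqr; congr Num.sqrt; lra.
  have [y0|y0] := leP 0 y.
    by exists (acos x); rewrite hc hs ger0_norm.
  by exists (- acos x); rewrite cosN sinN hc hs ltr0_norm// opprK.
have p0 : 0 < pi *+ 2 :> R by rewrite mulrn_wgt0 // pi_gt0.
pose n := Num.floor ((s0 - b) / (pi *+ 2)).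
exists (s0 + (- n)%:~R * (pi *+ 2)); rewrite cosDn2pi sinDn2pi; split=> //.
have := floor_itv ((s0 - b) / (pi *+ 2)); rewrite -/n => /andP[].
rewrite ler_pdivlMr// ltr_pdivrMr// intrD mulrNz /= => h1 h2.
by apply/andP; split; lra.
Qed.

End angles.

Section plane.
Context {R : realType}.
Implicit Types (p q o y z : R * R) (s t v a b c : R).

Definition d2 p q := (p.1 - q.1) ^+ 2 + (p.2 - q.2) ^+ 2.
Definition hd s p q := (p.1 - q.1) * cos s + (p.2 - q.2) * sin s.
Definition pt o s := (o.1 + cos s, o.2 + sin s).
(* [ctr p s] is the center of the unit disk touched at p by the line with outer
   normal of angle s, and [supp p s y] says that y lies in that disk. *)
Definition ctr p s := (p.1 - cos s, p.2 - sin s).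
Definition supp p s y := d2 y (ctr p s) <= 1.

Lemma d2_ge0 p q : 0 <= d2 p q.
Proof. by rewrite addr_ge0 ?sqr_ge0. Qed.

Lemma d2C p q : d2 p q = d2 q p.
Proof. by rewrite /d2; ring. Qed.

Lemma d2_eq0 p q : (d2 p q == 0) = (p == q).
Proof.
rewrite paddr_eq0 ?sqr_ge0// !expf_eq0/= !subr_eq0.
by case: p q => [a b] [c d].
Qed.

Lemma d2pp p : d2 p p = 0. Proof. by apply/eqP; rewrite d2_eq0. Qed.

Lemma d2_gt0 p q : (0 < d2 p q) = (p != q).
Proof. by rewrite lt_neqAle d2_ge0 andbT eq_sym d2_eq0. Qed.

Lemma pt_ctr p s : pt (ctr p s) s = p.
Proof. by case: p => a b; rewrite /pt /ctr /= !subrK. Qed.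

Lemma ctr_pt o s : ctr (pt o s) s = o.
Proof. by case: o => a b; rewrite /pt /ctr /= !addrK. Qed.

Lemma d2_pt o s : d2 (pt o s) o = 1.
Proof. by rewrite /d2/= -(cos2Dsin2 s); ring. Qed.

(** Expanding |y - p + u|^2 <= 1 for the unit normal u gives the supporting half-plane inequality,
    strengthened by a quadratic term. *)
Lemma suppE p s y : supp p s y <-> d2 y p <= 2 * hd s p y.
Proof.
rewrite /supp /d2 /hd /=; have e := cos2Dsin2 s.
by split => h; nra.
Qed.

Lemma supp_pt o s y : supp (pt o s) s y = (d2 y o <= 1).
Proof. by rewrite /supp ctr_pt. Qed.

Lemma supp_self p s : supp p s p.
Proof. by rewrite /supp d2C -[X in d2 _ X](pt_ctr p s) d2C d2_pt. Qed.

Lemma supp_ge0 p s y : supp p s y -> 0 <= hd s p y.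
Proof. by move=> /suppE; have := d2_ge0 y p; lra. Qed.

Lemma supp_gt0 p s y : supp p s y -> y != p -> 0 < hd s p y.
Proof. by rewrite -d2_gt0 => /suppE; lra. Qed.

Lemma hdC s p q : hd s p q = - hd s q p.
Proof. by rewrite /hd; ring. Qed.

Lemma hdDpi s p q : hd (s + pi) p q = - hd s p q.
Proof. by rewrite /hd sinDpi cosDpi; ring. Qed.

Lemma hdD2pi s p q : hd (s + pi *+ 2) p q = hd s p q.
Proof. by rewrite /hd sinD2pi cosD2pi. Qed.

Lemma suppD2pi p s y : supp p (s + pi *+ 2) y = supp p s y.
Proof. by rewrite /supp /ctr sinD2pi cosD2pi. Qed.

(** The unit vector of angle b is a combination of those of angles a and c; the sine weights are
    nonnegative when a <= b <= c <= a + pi. *)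
Lemma hd_between a b c p q :
  sin (c - a) * hd b p q = sin (c - b) * hd a p q + sin (b - a) * hd c p q.
Proof. by rewrite !sinB /hd; ring. Qed.

Lemma between_ge0 a b c p q : a <= b -> b <= c -> c < a + pi ->
  0 <= hd a p q -> 0 <= hd c p q -> 0 <= hd b p q.
Proof.
move=> ab bc ca ha hc; have [e|ne] := eqVneq a c.
  by have -> : b = a by lra.
have s1 : 0 < sin (c - a) by apply: sin_gt0_pi; apply/andP; split; lra.
have s2 : 0 <= sin (c - b) by apply: sin_ge0_pi; apply/andP; split; lra.
have s3 : 0 <= sin (b - a) by apply: sin_ge0_pi; apply/andP; split; lra.
by rewrite -(pmulr_rge0 _ s1) hd_between addr_ge0 // mulr_ge0.
Qed.

(** A strict hypothesis admits the case c = a + pi: the two normals are then opposite and the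
    hypotheses contradict each other. *)
Lemma betweenl a b c p q : a <= b -> b <= c -> c <= a + pi ->
  0 < hd a p q -> 0 <= hd c p q -> 0 <= hd b p q.
Proof.
move=> ab bc; rewrite le_eqVlt => /orP[/eqP ->|ca ha hc].
  by rewrite hdDpi; lra.
by apply: between_ge0 ab bc ca _ hc; apply: ltW.
Qed.

Lemma betweenr a b c p q : a <= b -> b <= c -> c <= a + pi ->
  0 <= hd a p q -> 0 < hd c p q -> 0 <= hd b p q.
Proof.
move=> ab bc; rewrite le_eqVlt => /orP[/eqP ->|ca ha hc].
  by rewrite hdDpi; lra.
by apply: between_ge0 ab bc ca ha _; apply: ltW.
Qed.

Lemma polar b p q : p != q -> exists l s, [/\ 0 < l, l ^+ 2 = d2 p q,
  b <= s < b + pi *+ 2, p.1 - q.1 = l * cos s & p.2 - q.2 = l * sin s].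
Proof.
rewrite -d2_gt0 => h; pose l := Num.sqrt (d2 p q).
have l0 : 0 < l by rewrite sqrtr_gt0.
have l2 : l ^+ 2 = d2 p q by rewrite sqr_sqrtr // d2_ge0.
have ln : l != 0 by rewrite gt_eqF.
have e : ((p.1 - q.1) / l) ^+ 2 + ((p.2 - q.2) / l) ^+ 2 = 1.
  rewrite !expr_div_n -mulrDl l2 -/(d2 p q) divff // gt_eqF //.
have [s [hs c1 s1]] := argument b e; exists l, s; split=> //.
  by rewrite c1 mulrC divfK.
by rewrite s1 mulrC divfK.
Qed.

(** The angle A + f runs over [f, 2 pi + f), where the sine is at least sin f only on
    [f, pi - f]. *)
Lemma sin_halfD (f A : R) : 0 < f < pi / 2 -> 0 <= A < pi *+ 2 ->
  sin f <= sin (A + f) -> A <= pi - f *+ 2.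
Proof.
move=> /andP[f0 f1] /andP[A0 A1] h; rewrite leNgt; apply/negP => hA.
rewrite mulr2n in hA A1.
have sf0 : 0 < sin f by apply: sin_gt0_pi; apply/andP; split; lra.
have [h2|h2] := leP (A + f) pi.
  suff : sin (A + f) < sin f by rewrite ltNge h.
  have -> : sin (A + f) = sin (pi - (A + f)).
    by rewrite sinB sinpi cospi; ring.
  by rewrite ltr_sin ?in_itv/=; try (apply/andP; split); lra.
have [h3|h3] := leP (A + f) (pi *+ 2).
  have := @sin_pi_le0 R (A + f); rewrite h3 (ltW h2) => /(_ isT); lra.
suff : sin (A + f) < sin f by rewrite ltNge h.
have -> : sin (A + f) = sin (A + f - pi *+ 2).
  by rewrite -[LHS](sinD2pi) -[in RHS]sinD2pi subrK sinD2pi.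
move: h3; rewrite mulr2n => h3.
by rewrite ltr_sin ?in_itv/=; try (apply/andP; split); lra.
Qed.

End plane.

(** * Unit arcs between two supported points *)

Section edges.
Context {R : realType}.
Implicit Types (p q o y z : R * R) (s t v a b c : R).

(** The chord has length 2 sin f, so the short arc from p to q has normals from s1 to s1 + 2 f. By
    [suppE] the two hypotheses say that sin (s1 + f - s) and sin (t - s1 - f) are at least sin f,
    which puts the arc between s and t. *)
Lemma edge_exists p q s t : p != q -> d2 p q < 4 -> supp p s q -> supp q t p ->
  s <= t <= s + pi *+ 2 ->
  exists s1 s2 o, [/\ s <= s1, s1 < s2, s2 <= t, s2 < s1 + pi &
    p = pt o s1 /\ q = pt o s2].
Proof.
move=> pq d4 hp hq /andP[st ts].
have pi0 : 0 < pi :> R := pi_gt0 R.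
pose f := asin (Num.sqrt (d2 q p) / 2).
have qp : q != p by rewrite eq_sym.
have d0 : 0 < d2 q p by rewrite d2_gt0.
have hl0 : 0 < Num.sqrt (d2 q p) by rewrite sqrtr_gt0.
have hl2 : Num.sqrt (d2 q p) < 2.
  rewrite -(@ltr_pXn2r _ 2) ?nnegrE ?sqrtr_ge0 ?ler0n//.
  by rewrite sqr_sqrtr ?d2_ge0// d2C; lra.
have sf : sin f = Num.sqrt (d2 q p) / 2 by apply: asinK; rewrite in_itv/=; lra.
have f0 : 0 < f.
  have h1 : 0 <= f + pi / 2.
    by have := @asin_geNpi2 R (Num.sqrt (d2 q p) / 2); rewrite -/f => h; lra.
  rewrite ltNge; apply/negP => f0.
  have : sin (- f) = - (Num.sqrt (d2 q p) / 2) by rewrite sinN sf.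
  have : 0 <= sin (- f) by apply: sin_ge0_pi; lra.
  lra.
have f1 : f < pi / 2 by apply: asin_ltpi2; lra.
(* The chord has direction psi = s1 + f + pi / 2, so this window for psi puts s1 in [s, s + 2
   pi). *)
have [l [psi [l0 l2 /andP[psi1 psi2] e1 e2]]] :=
  polar (s + pi / 2 + f) qp.
have le : l = 2 * sin f.
  rewrite sf -l2 sqrtr_sqr gtr0_norm//; lra.
pose s1 := psi - pi / 2 - f.
have psiE : psi = s1 + f + pi / 2 by rewrite /s1; ring.
move: e1 e2; rewrite psiE cosDpihalf sinDpihalf => e1 e2.
have hA : s1 - s <= pi - f *+ 2.
  apply: sin_halfD; try lra.
  move: hp => /suppE.
  have -> : hd s p q = l * sin (s1 + f - s) by rewrite sinB /hd; nra.
  rewrite -l2 le => h.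
  have -> : s1 - s + f = s1 + f - s by ring.
  have : 0 < sin f by lra.
  by nra.
exists s1, (s1 + f *+ 2), (ctr p s1); rewrite pt_ctr.
have sf0 : 0 < sin f by lra.
split; [lra|lra| |lra|split=> //].
  rewrite leNgt; apply/negP => hB.
  move: hq => /suppE.
  have -> : hd t q p = l * sin (t - (s1 + f)) by rewrite sinB /hd; nra.
  rewrite d2C -l2 le => h.
  have {}h : sin f <= sin (t - (s1 + f)) by nra.
  have [h1|h1] := leP (t - (s1 + f)) 0.
    have : 0 <= sin (- (t - (s1 + f))) by apply: sin_ge0_pi; lra.
    rewrite sinN; lra.
  suff : sin (t - (s1 + f)) < sin f by rewrite ltNge h.
  by rewrite ltr_sin ?in_itv/=; try (apply/andP; split); lra.
have E (x1 x2 y1 y2 : R) : x1 = x2 -> y1 = y2 -> (x1, y1) = (x2, y2) :> R * R by move=> -> ->.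
have -> : s1 + f *+ 2 = (s1 + f) + f by ring.
rewrite [LHS]surjective_pairing; apply: E => /=.
  have -> : q.1 = p.1 + l * - sin (s1 + f) by lra.
  have -> : cos s1 = cos (s1 + f - f) by rewrite addrK.
  by rewrite le (cosB _ f) (cosD (s1 + f) f); ring.
have -> : q.2 = p.2 + l * cos (s1 + f) by lra.
have -> : sin s1 = sin (s1 + f - f) by rewrite addrK.
by rewrite le (sinB _ f) (sinD (s1 + f) f); ring.
Qed.

(** With v = o - e, the point of normal t is in the disk iff |v|^2 + 2 v.u(t) <= 0. Here u(b) is a
    combination of u(a) and u(c) with nonnegative weights of sum at least 1, by subadditivity of the
    sine, so the inequality passes to b. *)
Lemma arc_in o e a b c : a <= b -> b <= c -> c < a + pi ->
  d2 (pt o a) e <= 1 -> d2 (pt o c) e <= 1 -> d2 (pt o b) e <= 1.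
Proof.
move=> ab bc ca.
have E t : d2 (pt o t) e = d2 o e + 2 * hd t o e + 1.
  by rewrite /d2 /hd /= -[X in _ = _ + X](cos2Dsin2 t); ring.
have [e1|ne] := eqVneq a c; first by have -> : b = a by lra.
rewrite !E => ha hc.
have s1 : 0 < sin (c - a) by apply: sin_gt0_pi; lra.
have s2 : 0 <= sin (c - b) by apply: sin_ge0_pi; lra.
have s3 : 0 <= sin (b - a) by apply: sin_ge0_pi; lra.
have h := hd_between a b c o e.
have h2 : sin (c - a) <= sin (c - b) + sin (b - a).
  have -> : c - a = (c - b) + (b - a) by ring.
  rewrite sinD; have := cos_le1 (c - b); have := cos_le1 (b - a); nra.
suff : sin (c - a) * (d2 o e + 2 * hd b o e) <= 0 by rewrite pmulr_rle0//; lra.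
rewrite mulrDr mulrCA h; have d0 := d2_ge0 o e.
have h3 : d2 o e * sin (c - a) <= d2 o e * (sin (c - b) + sin (b - a)).
  by rewrite ler_wpM2l.
nra.
Qed.

(** The direction phi of y from o is compared with the mean of s and s1 and with the mean of s2 and
    t: [key] and [prod] fix the signs of two sines, which leave only s < phi < t. As y is beyond the
    edge disk in direction phi, it is strictly higher than all of that disk. *)
Lemma outside_edge p q o s t s1 s2 y :
  p = pt o s1 -> q = pt o s2 -> s <= s1 -> s1 <= s2 -> s2 <= t ->
  t <= s + pi *+ 2 -> supp p s y -> supp q t y -> 1 < d2 y o ->
  exists phi k, [/\ s < phi < t, 1 < k, y.1 - o.1 = k * cos phi,
    y.2 - o.2 = k * sin phi & forall z, d2 z o <= 1 -> 0 < hd phi y z].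
Proof.
move=> pE qE ss1 s12 s2t ts hp hq hy.
have pi0 : 0 < pi :> R := pi_gt0 R.
have yo : y != o by apply/eqP => e; move: hy; rewrite e d2pp; lra.
have [k [phi [k0 k2 /andP[f1 f2] e1 e2]]] := polar s yo.
have k1 : 1 < k by nra.
(* Among the unit disks through [r], y lies in the one with normal [w] but not in the one with
   normal [x], whose center is o. *)
have key x r : r = pt o x -> forall w, supp r w y -> cos (phi - w) < cos (phi - x).
  move=> -> w; rewrite /supp /d2 /=.
  have -> : y.1 - (o.1 + cos x - cos w) = k * cos phi - cos x + cos w by lra.
  have -> : y.2 - (o.2 + sin x - sin w) = k * sin phi - sin x + sin w by lra.
  rewrite !cosB.
  have := cos2Dsin2 phi; have := cos2Dsin2 x; have := cos2Dsin2 w.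
  set cf := cos phi; set sf := sin phi; set cx := cos x; set sx := sin x.
  set cw := cos w; set sw := sin w => h1 h2 h3 h.
  have : k ^+ 2 + 2 * k * (cf * cw + sf * sw - (cf * cx + sf * sx)) + 0 <= 1.
    have -> : k ^+ 2 = k ^+ 2 * (cf ^+ 2 + sf ^+ 2) by rewrite h3 mulr1.
    have : 0 <= (cw - cx) ^+ 2 + (sw - sx) ^+ 2 by rewrite addr_ge0 ?sqr_ge0.
    by nra.
  nra.
have prod x w : cos (phi - x) - cos (phi - w) =
    2 * (sin (phi - (w + x) / 2) * sin ((x - w) / 2)).
  have -> : phi - x = (phi - (w + x) / 2) - (x - w) / 2 by field.
  have -> : phi - w = (phi - (w + x) / 2) + (x - w) / 2 by field.
  by rewrite (cosB _ ((x - w) / 2)) (cosD _ ((x - w) / 2)); ring.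
have c1 : 0 < sin (phi - (s + s1) / 2).
  have := key _ _ pE _ hp; rewrite -subr_gt0 prod.
  have : 0 <= sin ((s1 - s) / 2) by apply: sin_ge0_pi; lra.
  nra.
have c2 : sin (phi - (t + s2) / 2) < 0.
  have := key _ _ qE _ hq; rewrite -subr_gt0 prod.
  have : 0 <= sin (- ((s2 - t) / 2)) by apply: sin_ge0_pi; lra.
  rewrite sinN; nra.
exists phi, k; split=> //.
  apply/andP; split.
    rewrite lt_neqAle f1 andbT; apply/eqP => e.
    have : 0 <= sin (- (phi - (s + s1) / 2)) by apply: sin_ge0_pi; lra.
    rewrite sinN; lra.
  rewrite ltNge; apply/negP => tf.
  have : pi < phi - (t + s2) / 2.
    rewrite ltNge; apply/negP => h.
    have : 0 <= sin (phi - (t + s2) / 2) by apply: sin_ge0_pi; lra.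
    lra.
  move=> h; have : sin (phi - (s + s1) / 2) <= 0.
    by apply: sin_pi_le0; lra.
  lra.
move=> z hz.
have -> : hd phi y z = k * (cos phi ^+ 2 + sin phi ^+ 2) - hd phi z o.
  rewrite /hd; have -> : y.1 - z.1 = k * cos phi - (z.1 - o.1) by lra.
  by have -> : y.2 - z.2 = k * sin phi - (z.2 - o.2); [lra|ring].
rewrite cos2Dsin2.
suff : hd phi z o <= 1 by lra.
move: hz; rewrite /hd /d2; have := cos2Dsin2 phi.
set X := z.1 - o.1; set Y := z.2 - o.2 => h1 h2.
have : 0 <= (X - cos phi) ^+ 2 + (Y - sin phi) ^+ 2 by rewrite addr_ge0 ?sqr_ge0.
nra.
Qed.

(** Otherwise r is strictly higher than p and q in some direction phi between s and t, and at least
    as high in its own normal direction v. If v <= phi + pi, then t lies between them and r rises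
    above the support line at q; if not, s + 2 pi lies between v and phi + 2 pi, with the same
    conflict at p. *)
Lemma edge_disk_in p q r o s t v s1 s2 :
  p = pt o s1 -> q = pt o s2 -> s <= s1 -> s1 <= s2 -> s2 <= t ->
  t <= v -> v <= s + pi *+ 2 ->
  supp p s r -> supp q t r -> supp r v p -> supp r v q -> d2 r o <= 1.
Proof.
move=> pE qE ss1 s12 s2t tv vs hp hq hrp hrq; rewrite leNgt; apply/negP => hr.
have rp : r != p by apply/eqP => e; move: hr; rewrite e pE d2_pt ltxx.
have rq : r != q by apply/eqP => e; move: hr; rewrite e qE d2_pt ltxx.
have ts : t <= s + pi *+ 2 by lra.
have [phi [k [/andP[f1 f2] _ _ _ hz]]] := outside_edge pE qE ss1 s12 s2t ts hp hq hr.
have hzp : 0 < hd phi r p by apply: hz; rewrite pE d2_pt.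
have hzq : 0 < hd phi r q by apply: hz; rewrite qE d2_pt.
have [h|h] := leP v (phi + pi).
  have : 0 <= hd t r q.
    by apply: (@betweenl _ phi t v) => //; [lra|exact: supp_ge0].
  by rewrite hdC; have := supp_gt0 hq rq; lra.
have : 0 <= hd (s + pi *+ 2) r p.
  apply: (@betweenr _ v (s + pi *+ 2) (phi + pi *+ 2)); try lra.
    exact: supp_ge0.
  by rewrite hdD2pi.
by rewrite hdD2pi hdC; have := supp_gt0 hp rp; lra.
Qed.

(** The argument of [edge_disk_in], with the direction f' in which y exceeds the second edge disk in
    place of v. That disk contains p and q, so y is higher than both in direction f'. *)
Lemma caps_disjoint p q p' q' o o' s t s' t' s1 s2 s1' s2' y :
  p = pt o s1 -> q = pt o s2 -> s <= s1 -> s1 <= s2 -> s2 <= t ->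
  p' = pt o' s1' -> q' = pt o' s2' -> s' <= s1' -> s1' <= s2' -> s2' <= t' ->
  t <= s' -> t' <= s + pi *+ 2 ->
  supp p s y -> supp q t y -> supp p' s' y -> supp q' t' y ->
  d2 p o' <= 1 -> d2 q o' <= 1 -> 1 < d2 y o -> 1 < d2 y o' -> False.
Proof.
move=> pE qE ss1 s12 s2t pE' qE' ss1' s12' s2t' ts' ts hp hq hp' hq' po qo hy hy'.
have ts0 : t <= s + pi *+ 2 by lra.
have ts1 : t' <= s' + pi *+ 2 by lra.
have [f [k [/andP[f1 f2] _ _ _ hz]]] := outside_edge pE qE ss1 s12 s2t ts0 hp hq hy.
have [f' [k' [/andP[f1' f2'] _ _ _ hz']]] :=
  outside_edge pE' qE' ss1' s12' s2t' ts1 hp' hq' hy'.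
have yq : y != q by apply/eqP => e; move: hy; rewrite e qE d2_pt ltxx.
have yp : y != p by apply/eqP => e; move: hy; rewrite e pE d2_pt ltxx.
have [h|h] := leP f' (f + pi).
  have : 0 <= hd t y q.
    apply: (@betweenl _ f t f') => //; try lra.
      by apply: hz; rewrite qE d2_pt.
    by apply: ltW; exact: hz'.
  by rewrite hdC; have := supp_gt0 hq yq; lra.
have : 0 <= hd (s + pi *+ 2) y p.
  apply: (@betweenl _ f' (s + pi *+ 2) (f + pi *+ 2)); try lra.
    exact: hz'.
  by rewrite hdD2pi; apply: ltW; apply: hz; rewrite pE d2_pt.
by rewrite hdD2pi hdC; have := supp_gt0 hp yp; lra.
Qed.

(* The center of the unit circle on which the arc shorter than pi from p to q is
   traversed counterclockwise. *)
Definition ectr p q : R * R :=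
  let k := Num.sqrt ((d2 p q)^-1 - 4^-1) in
  ((p.1 + q.1) / 2 - k * (q.2 - p.2), (p.2 + q.2) / 2 + k * (q.1 - p.1)).

Lemma ectrE o s1 s2 : s1 < s2 -> s2 < s1 + pi -> ectr (pt o s1) (pt o s2) = o.
Proof.
move=> s12 s21.
pose h := (s2 - s1) / 2; pose m := (s1 + s2) / 2.
have -> : s1 = m - h by rewrite /m /h; field.
have -> : s2 = m + h by rewrite /m /h; field.
have hh : 0 < h < pi / 2 by rewrite /h; lra.
move: m h hh => m h hh {s12 s21}.
have pi0 := pi_gt0 R.
have sh : 0 < sin h by apply: sin_gt0_pi; lra.
have ch : 0 < cos h by apply: cos_gt0_pihalf; lra.
have dE : d2 (pt o (m - h)) (pt o (m + h)) = 4 * sin h ^+ 2.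
  rewrite /d2/= (cosB m h) (cosD m h) (sinB m h) (sinD m h).
  transitivity (4 * sin h ^+ 2 * (cos m ^+ 2 + sin m ^+ 2)); first by ring.
  by rewrite cos2Dsin2 mulr1.
rewrite /ectr dE.
have -> : (4 * sin h ^+ 2)^-1 - 4^-1 = (cos h / (2 * sin h)) ^+ 2.
  rewrite expr_div_n cos2sin2; field; rewrite gt_eqF//.
rewrite sqrtr_sqr gtr0_norm; last by rewrite divr_gt0// mulr_gt0.
rewrite /pt /= (cosB m h) (cosD m h) (sinB m h) (sinD m h) [RHS]surjective_pairing.
by congr (_, _); field; rewrite gt_eqF.
Qed.

End edges.

(** * Cyclic configurations of points and directions *)

Section cyclic_sequences.
Context {R : realType}.

(** Unrolling the cyclic sequence over all natural numbers makes rotating it a shift of the index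
    and removes modular indices. *)
Definition cyc k (s : nat -> R) : Prop :=
  [/\ (0 < k)%N, forall i, s i <= s i.+1 & forall i, s (i + k)%N = s i + pi *+ 2].

Lemma cyc_le k s : cyc k s -> {homo s : i j / (i <= j)%N >-> i <= j}.
Proof. by case=> _ h _; apply: homo_leq; [exact: lexx|exact: le_trans|]. Qed.

(** The window starts at [s 1] so that the edge found has a predecessor, which [cfg_support] may
    need. *)
Lemma cyc_find k s phi : cyc k s -> s 1%N <= phi < s 1%N + pi *+ 2 ->
  exists i, [/\ (0 < i <= k)%N, s i <= phi & phi <= s i.+1].
Proof.
move=> hc; have [k0 _ hp] := hc; move=> /andP[h1]; rewrite -hp => h2.
have ex : exists j, phi < s j by exists (1 + k)%N.
case: (ex_minnP ex) => -[|[|i]] h3 h4.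
- by have := cyc_le hc (leq0n 1); lra.
- by lra.
exists i.+1; split.
- by have := h4 _ h2; lia.
- by rewrite leNgt; apply/negP => /h4; rewrite ltnn.
- exact: ltW.
Qed.

End cyclic_sequences.

Section configurations.
Context {R : realType}.
(** Two instances occur: the points x(s_i) of K, and the centers of the disks of a polygon, each
    with a direction in which its circle touches the polygon. *)
Variables (k : nat) (s : nat -> R) (X : nat -> R * R).
Hypotheses (hc : cyc k s) (Xk : forall i, X (i + k)%N = X i).
Hypothesis hX : forall i j, supp (X j) (s j) (X i).
Hypothesis hd4 : forall i j, d2 (X i) (X j) < 4.

Let k0 : (0 < k)%N. Proof. by case: hc. Qed.
Let sk i : s (i + k)%N = s i + pi *+ 2. Proof. by case: hc. Qed.

Lemma cfg_mulk i m : X (i + m * k)%N = X i.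
Proof. by elim: m => [|m IH]; rewrite ?mul0n ?addn0// mulSn addnCA addnC Xk. Qed.

Lemma cfg_shift i j : exists j', [/\ (i < j')%N, (j' <= i + k)%N & X j' = X j].
Proof.
have Xm m : X m = X (m %% k)%N by rewrite [in LHS](divn_eq m k) addnC cfg_mulk.
exists (i.+1 + (j + k * i.+1 - i.+1) %% k)%N.
have h : (i.+1 <= k * i.+1)%N by rewrite leq_pmull.
have := ltn_pmod (j + k * i.+1 - i.+1) k0 => hm.
split; try lia.
rewrite Xm modnDmr addnC subnK; last by lia.
by rewrite addnC mulnC modnMDl -Xm.
Qed.

(** Coinciding consecutive points have no chord; the disk supporting at that point stands in. It
    contains whatever is supported there, so it cuts nothing off. *)
Definition ecenter i : R * R :=
  if X i == X i.+1 then ctr (X i) (s i) else ectr (X i) (X i.+1).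

Lemma edge_data i : exists a b, [/\ s i <= a, a <= b, b <= s i.+1, b < a + pi &
  X i = pt (ecenter i) a /\ X i.+1 = pt (ecenter i) b].
Proof.
have h := cyc_le hc (leqnSn i).
rewrite /ecenter; have [e|ne] := eqVneq (X i) (X i.+1).
  exists (s i), (s i); rewrite -e pt_ctr; split=> //.
  by have := pi_gt0 R; lra.
have h2 : s i <= s i.+1 <= s i + pi *+ 2.
  by rewrite h -sk (cyc_le hc)//; lia.
have [a [b [ o [h3 h4 h5 h6 [h7 h8]]]]] :=
  edge_exists ne (hd4 _ _) (hX _ _) (hX _ _) h2.
exists a, b; have -> : ectr (X i) (X i.+1) = o by rewrite h7 h8 ectrE.
by split=> //; exact: ltW.
Qed.

Lemma cfg_in_edge_disks i j : d2 (X j) (ecenter i) <= 1.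
Proof.
have [j' [h1 h2 <-]] := cfg_shift i j.
have [a [b [h3 h4 h5 h6 [h7 h8]]]] := edge_data i.
apply: (edge_disk_in h7 h8 h3 h4 h5 _ _ (hX j' i) (hX j' i.+1) (hX i j') (hX i.+1 j')).
  exact: (cyc_le hc).
by rewrite -sk; exact: (cyc_le hc).
Qed.

Lemma cfg_caps_disjoint i j y : (forall m, supp (X m) (s m) y) ->
  (i < j < i + k)%N -> 1 < d2 y (ecenter i) -> 1 < d2 y (ecenter j) -> False.
Proof.
move=> hy /andP[ij ji].
have [a [b [h3 h4 h5 h6 [h7 h8]]]] := edge_data i.
have [a' [b' [h3' h4' h5' h6' [h7' h8']]]] := edge_data j.
apply: (caps_disjoint h7 h8 h3 h4 h5 h7' h8' h3' h4' h5') => //;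
  try exact: cfg_in_edge_disks.
  exact: (cyc_le hc).
by rewrite -sk; exact: (cyc_le hc).
Qed.

(** If the gap exceeded pi, the normal of any other point X m would lie between [s i.+1] and
    [s i + pi *+ 2], less than a half turn apart. Then X i would be at least as high as X m in the
    normal direction of X m, which is impossible. *)
Lemma cfg_nonfull i : (exists m, X m != X i) -> X i = X i.+1 -> s i.+1 <= s i + pi.
Proof.
move=> [m0 hm0] e; rewrite leNgt; apply/negP => h.
have [m [h1 h2 h3]] := cfg_shift i m0.
have ne : X m != X i by rewrite h3.
have v1 : s i.+1 <= s m by exact: (cyc_le hc).
have v2 : s m <= s i + pi *+ 2 by rewrite -sk; exact: (cyc_le hc).
have : 0 <= hd (s m) (X i) (X m).
  apply: (@betweenl _ (s i.+1) (s m) (s i + pi *+ 2)); try lra.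
    by rewrite e; apply: (supp_gt0 (hX _ _)); rewrite -e.
  by rewrite hdD2pi; apply: supp_ge0.
by rewrite hdC; have := @supp_gt0 _ _ (s m) _ (hX i m); rewrite eq_sym ne => /(_ isT); lra.
Qed.

(** If all points coincided, the gaps of at most pi would put y no higher than this point in every
    direction, even in the direction pointing to y. *)
Lemma cfg_nonconst y : (forall i, X i = X i.+1 -> s i.+1 <= s i + pi) ->
  (forall m, supp (X m) (s m) y) -> y != X 0%N -> exists m, X m != X 0%N.
Proof.
move=> nf hy y0; apply: contrapT => /forallNP hall.
have {}hall m : X m = X 0%N by apply/eqP; rewrite -[_ == _]negbK; apply/negP; exact: hall.
have [l [phi [l0 _ hphi e1 e2]]] := polar (s 1%N) y0.
have [i [_ h1 h2]] := cyc_find hc hphi.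
have hgt m : 0 < hd (s m) (X 0%N) y by apply: supp_gt0 => //; rewrite -(hall m).
have : 0 <= hd phi (X 0%N) y.
  apply: (@betweenl _ (s i) phi (s i.+1)) => //.
  - by apply: nf; rewrite (hall i) (hall i.+1).
  - exact: ltW.
rewrite hdC /hd e1 e2.
by have := cos2Dsin2 phi; nra.
Qed.

(** The reason is that of [cfg_nonfull], with the last normal b of the incoming arc and the first
    normal a' of the outgoing arc as ends of the gap. *)
Lemma cfg_turn i a b a' b' : (exists m, X m != X i.+1) ->
  s i <= a -> b <= s i.+1 -> s i.+1 <= a' -> a <= b ->
  a' <= b' -> b' <= s i.+2 ->
  X i.+1 = pt (ecenter i) b -> X i.+1 = pt (ecenter i.+1) a' -> a' < b + pi.
Proof.
move=> [m0 hm0] sa bs sa' ab ab' bs' e1 e2; rewrite ltNge; apply/negP => h.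
have [m [h1 h2 h3]] := cfg_shift i.+1 m0.
have ne : X m != X i.+1 by rewrite h3.
have m2 : (m <= i + k)%N.
  rewrite -ltnS -addSn ltn_neqAle h2 andbT.
  by apply/eqP => em; move: ne; rewrite em Xk eqxx.
have v1 : s i.+2 <= s m by exact: (cyc_le hc).
have v2 : s m <= s i + pi *+ 2 by rewrite -sk; exact: (cyc_le hc).
have s1 : supp (X i.+1) a' (X m) by rewrite {1}e2 supp_pt cfg_in_edge_disks.
have s2 : supp (X i.+1) b (X m) by rewrite {1}e1 supp_pt cfg_in_edge_disks.
have : 0 <= hd (s m) (X i.+1) (X m).
  apply: (@betweenl _ a' (s m) (b + pi *+ 2)); try lra.
    exact: supp_gt0.
  by rewrite hdD2pi; apply: supp_ge0.
by rewrite hdC; have := @supp_gt0 _ _ (s m) _ (hX i.+1 m); rewrite eq_sym ne => /(_ isT); lra.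
Qed.

(** The direction phi is a normal either on the arc of edge i or in the normal cone at one of its
    ends; that arc point or vertex is the support point z. The predicate [C] stands for any set
    containing the vertices and closed under the arcs. *)
Lemma cfg_support x (C : R * R -> Prop) phi i :
  (exists m m', X m != X m') ->
  (forall i, C (X i)) ->
  (forall i a b, a <= phi -> phi <= b -> b < a + pi ->
     C (pt (ecenter i) a) -> C (pt (ecenter i) b) -> C (pt (ecenter i) phi)) ->
  (forall i, d2 x (ecenter i) <= 1) ->
  (0 < i)%N -> s i <= phi -> phi <= s i.+1 ->
  exists2 z, C z & 0 <= hd phi z x.
Proof.
move=> [m [m' hm]] CX Carc hx i0 h1 h2.
have nc j : exists m, X m != X j.
  have [e|] := eqVneq (X m) (X j); last by exists m.
  by exists m'; rewrite -e eq_sym.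
have vertex j a b a' b' : s j <= a -> a <= b -> b <= s j.+1 -> s j.+1 <= a' ->
    a' <= b' -> b' <= s j.+2 -> X j.+1 = pt (ecenter j) b ->
    X j.+1 = pt (ecenter j.+1) a' -> b <= phi -> phi <= a' ->
    exists2 z, C z & 0 <= hd phi z x.
  move=> ja ab bj ja' ab' bj' e1 e2 bp pa; exists (X j.+1) => //.
  apply: (@between_ge0 _ b phi a') => //.
  - exact: (@cfg_turn j a b a' b').
  - by apply: supp_ge0; rewrite e1 supp_pt.
  - by apply: supp_ge0; rewrite e2 supp_pt.
have [a [b [h3 h4 h5 h6 [h7 h8]]]] := edge_data i.
have [pa|ap] := leP phi a.
  case: i i0 h1 h2 h3 h4 h5 h6 h7 h8 => // i _ h1 h2 h3 h4 h5 h6 h7 h8.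
  have [a' [b' [h3' h4' h5' h6' [h7' h8']]]] := edge_data i.
  by apply: (vertex i a' b' a b) => //; lra.
have [bp|pb] := leP b phi.
  have [a' [b' [h3' h4' h5' h6' [h7' h8']]]] := edge_data i.+1.
  by apply: (vertex i a b a' b') => //; lra.
exists (pt (ecenter i) phi).
  by apply: (Carc i a b); rewrite -?h7 -?h8 //; exact: ltW.
by apply: supp_ge0; rewrite supp_pt.
Qed.

(** In the direction from e to x, some point of the disk about e is at least as high as x, so x is
    at distance at most 1. Thus the intersection of the edge disks is contained in the spindle hull
    of the points. *)
Lemma cfg_hull x e : (exists m m', X m != X m') ->
  (forall i, d2 x (ecenter i) <= 1) -> (forall i, d2 (X i) e <= 1) -> d2 x e <= 1.
Proof.
move=> nc hx he; have [->|xe] := eqVneq x e; first by rewrite d2pp ler01.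
have [l [phi [l0 l2 hphi e1 e2]]] := polar (s 1%N) xe.
have [i [/andP[i0 _] h1 h2]] := cyc_find hc hphi.
have harc (j : nat) (a b : R) : a <= phi -> phi <= b -> b < a + pi ->
    d2 (pt (ecenter j) a) e <= 1 -> d2 (pt (ecenter j) b) e <= 1 ->
    d2 (pt (ecenter j) phi) e <= 1.
  by move=> ab bp ba ha hb; apply: (arc_in _ _ _ ha hb).
have [z hz hzx] := @cfg_support x (fun z => d2 z e <= 1) phi i nc he harc hx i0 h1 h2.
suff : l <= 1 by rewrite -l2; nra.
move: hz hzx; rewrite /d2 /hd.
have -> : z.1 - x.1 = (z.1 - e.1) - l * cos phi by lra.
have -> : z.2 - x.2 = (z.2 - e.2) - l * sin phi by lra.
set u := z.1 - e.1; set v := z.2 - e.2 => hz hzx.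
have c2 := cos2Dsin2 phi.
have : l <= u * cos phi + v * sin phi by nra.
have : 0 <= (u - cos phi) ^+ 2 + (v - sin phi) ^+ 2 by rewrite addr_ge0 ?sqr_ge0.
nra.
Qed.

End configurations.

(** * The unit disk supporting a spindle convex set *)

Section supporting_disk.
Context {R : realType}.

Lemma chord_pt (p : R * R) f m : pt (ctr p (m - f)) (m + f) =
  (p.1 - 2 * sin f * sin m, p.2 + 2 * sin f * cos m).
Proof.
by rewrite /pt /ctr /= (cosB m f) (cosD m f) (sinB m f) (sinD m f); congr (_, _); ring.
Qed.

(** A point y outside the disk would give a short unit arc between X and y whose normals contain s
    in the interior. This arc rises above X in direction s although it lies in K. *)
Lemma support_disk (K : R * R -> Prop) X y s :
  (forall o a b c, a <= b -> b <= c -> c < a + pi ->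
    K (pt o a) -> K (pt o c) -> K (pt o b)) ->
  K X -> K y -> d2 y X < 4 -> (forall z, K z -> 0 <= hd s X z) -> supp X s y.
Proof.
move=> harc hX hy d4 hmax; apply: contrapT => nh.
have h : 2 * hd s X y < d2 y X by rewrite ltNge; apply/negP => /suppE.
have yX : y != X.
  by apply/eqP => e; apply: nh; rewrite e; exact: supp_self.
have [l [psi [l0 l2 /andP[ps1 ps2] e1 e2]]] := polar (s + pi / 2) yX.
have pi0 := pi_gt0 R.
have hy0 := hmax _ hy.
have hE : hd s X y = - (l * cos (psi - s)).
  by rewrite /hd cosB; nra.
have l2' : l < 2 by nra.
pose f := asin (l / 2).
have sf : sin f = l / 2 by apply: asinK; rewrite in_itv/=; lra.
have f1 : f < pi / 2 by apply: asin_ltpi2; lra.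
have f0 : 0 < f.
  have h1 : - (pi / 2) <= f by apply: asin_geNpi2; lra.
  rewrite ltNge; apply/negP => f0.
  have : 0 <= sin (- f) by apply: sin_ge0_pi; lra.
  by rewrite sinN; lra.
pose w := psi - s - pi / 2.
have cw : cos (psi - s) = - sin w.
  by rewrite -cosDpihalf /w subrK.
have sw0 : 0 <= sin w by rewrite hE cw in hy0; nra.
have sw1 : sin w < sin f by rewrite hE cw -l2 in h; rewrite sf; nra.
have w0 : 0 <= w by rewrite /w; lra.
have wpi : w <= pi.
  rewrite leNgt; apply/negP => hw.
  suff : sin w < 0 by lra.
  by apply: sin_pi_lt0; rewrite hw /= /w; lra.
have top o c : X = pt o c -> K (pt o s) -> 0 < `|c - s| < pi -> False.
  move=> Xo hs hcs; have := hmax _ hs.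
  have -> : hd s X (pt o s) = cos (c - s) - 1.
    by rewrite Xo /hd /= cosB -(cos2Dsin2 s); ring.
  have : cos `|c - s| < cos 0 by rewrite ltr_cos ?in_itv/=; lra.
  by rewrite cos_norm cos0; lra.
(* The angle from the tangent at X to the chord is w, and y is outside the disk, so sin w < sin f.
   Either w < f and the arc from X to y passes normal s, or w > pi - f and the arc from y to X
   does. *)
have [hw|hw] := ltP w f.
  pose m := s + w.
  have yE : y = pt (ctr X (m - f)) (m + f).
    rewrite chord_pt sf [LHS]surjective_pairing.
    have -> : m = psi - pi / 2 by rewrite /m /w; ring.
    by rewrite sinBpihalf cosBpihalf; congr (_, _); lra.
  apply: (top (ctr X (m - f)) (m - f)); first by rewrite pt_ctr.
    apply: (harc _ (m - f) s (m + f)); [rewrite /m; lra|rewrite /m; lra|lra| |].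
      by rewrite pt_ctr.
    by rewrite -yE.
  have -> : m - f - s = - (f - w) by rewrite /m; ring.
  by rewrite normrN gtr0_norm; lra.
have hw2 : pi - f < w.
  rewrite ltNge; apply/negP => hw2.
  have [h3|h3] := leP w (pi / 2).
    have : sin f <= sin w; last by lra.
    have [->//|ne] := eqVneq w f; apply: ltW; rewrite ltr_sin ?in_itv/=; [|lra|lra].
    by rewrite lt_neqAle eq_sym ne hw.
  have : sin f <= sin (pi - w).
    have [->//|ne] := eqVneq (pi - w) f; apply: ltW; rewrite ltr_sin ?in_itv/=; [|lra|lra].
    by rewrite lt_neqAle eq_sym ne; lra.
  by rewrite sinB sinpi cospi; lra.
pose m := s + w - pi.
have XE : X = pt (ctr y (m - f)) (m + f).
  rewrite chord_pt sf [LHS]surjective_pairing.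
  have -> : m = psi - pi / 2 - pi by rewrite /m /w; ring.
  have -> : sin (psi - pi / 2 - pi) = cos psi by rewrite sinB sinpi cospi sinBpihalf; ring.
  have -> : cos (psi - pi / 2 - pi) = - sin psi by rewrite cosB sinpi cospi cosBpihalf; ring.
  by congr (_, _); lra.
apply: (top (ctr y (m - f)) (m + f)) => //.
  apply: (harc _ (m - f) s (m + f)); [rewrite /m; lra|rewrite /m; lra|lra| |].
    by rewrite pt_ctr.
  by rewrite -XE.
have -> : m + f - s = w + f - pi by rewrite /m; ring.
by rewrite gtr0_norm; lra.
Qed.

End supporting_disk.

(** * Dowker's exchange argument for cyclic sequences *)

Section dowker.
Context {R : realType}.
Variable F : R -> R -> R.
Hypothesis Fper : forall s t, F (s + pi *+ 2) (t + pi *+ 2) = F s t.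
Hypothesis Fex : forall a b c d, a <= b -> b <= c -> c <= d -> d <= a + pi ->
  F a c + F b d <= F a d + F b c.
(** This handles gaps above pi, which [Fex] cannot reach: such a gap and its complement cost at
    least as much as some two half turns. *)
Hypothesis Ffix : forall a d, a + pi < d -> d <= a + pi *+ 2 ->
  exists x, [/\ a <= x, x + pi <= d &
    F x (x + pi) + F (x + pi) (x + pi *+ 2) <= F a d + F d (a + pi *+ 2)].
Implicit Types (s t u v f : nat -> R) (k i j m : nat).

Definition cost k s : R := \sum_(0 <= i < k) F (s i) (s i.+1).

(** Extends the values f 0, ..., f k, where f k = f 0 + 2 pi, to an unrolled cyclic sequence. *)
Definition pext k f i : R := f (i %% k)%N + (i %/ k)%:R * (pi *+ 2).

Lemma pext_le k f i : (0 < k)%N -> f k = f 0%N + pi *+ 2 -> (i <= k)%N -> pext k f i = f i.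
Proof.
move=> k0 fk; rewrite leq_eqVlt => /orP[/eqP ->|ik].
  by rewrite /pext modnn divnn k0 mul1r fk.
by rewrite /pext modn_small// divn_small// mul0r addr0.
Qed.

Lemma pext_step k f i : (0 < k)%N -> f k = f 0%N + pi *+ 2 ->
  pext k f i.+1 - pext k f i = f (i %% k).+1 - f (i %% k)%N.
Proof.
move=> k0 fk; rewrite /pext.
have hm := ltn_pmod i k0.
have e2 : i.+1 = (i %/ k * k + (i %% k).+1)%N by rewrite addnS -divn_eq.
have [h|h] := ltnP (i %% k).+1 k.
  have -> : (i.+1 %% k = (i %% k).+1)%N by rewrite -addn1 -modnDml addn1 modn_small.
  have -> : (i.+1 %/ k = i %/ k)%N by rewrite [in LHS]e2 divnMDl// (divn_small h) addn0.
  by ring.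
have e : (i %% k).+1 = k by apply/eqP; rewrite eqn_leq hm h.
have -> : (i.+1 %% k = 0)%N by rewrite -addn1 -modnDml addn1 e modnn.
have -> : (i.+1 %/ k = (i %/ k).+1)%N by rewrite [in LHS]e2 divnMDl// e divnn k0 addn1.
by rewrite e fk -natr1; ring.
Qed.

Lemma pext_cyc k f : (0 < k)%N -> f k = f 0%N + pi *+ 2 ->
  (forall i, (i < k)%N -> f i <= f i.+1) -> cyc k (pext k f).
Proof.
move=> k0 fk fle; split=> // i.
  by rewrite -subr_ge0 pext_step// subr_ge0 fle// ltn_pmod.
by rewrite /pext modnDr divnDr // divnn k0 addn1 -natr1 mulrDl mul1r; ring.
Qed.

Lemma cost_pext k f : (0 < k)%N -> f k = f 0%N + pi *+ 2 -> cost k (pext k f) = cost k f.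
Proof.
move=> k0 fk; apply: eq_big_nat => i /andP[_ ik].
by rewrite !pext_le// ltnW.
Qed.

Lemma cyc_shift k s m : cyc k s -> cyc k (fun i => s (m + i)%N).
Proof.
move=> [k0 sle sk]; split=> // i; first by rewrite addnS.
by rewrite addnA sk.
Qed.

Lemma cost_shift k s m : cyc k s -> cost k (fun i => s (m + i)%N) = cost k s.
Proof.
move=> hc; elim: m => [|m IH]; first by apply: eq_bigr => i _; rewrite !add0n.
rewrite -IH /cost; have [k0 _ sk] := hc.
case: k k0 sk {hc IH} => // k _ sk.
rewrite big_nat_recr//= [RHS]big_nat_recl//= addrC addn0; congr (_ + _).
  rewrite (_ : F _ _ = F (s (m + k.+1)%N) (s (m + 1 + k.+1)%N)).
    by rewrite !sk Fper addn1.
  by congr (F (s _) (s _)); lia.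
by apply: eq_bigr => i _; congr (F (s _) (s _)); lia.
Qed.

Lemma cyc_unbounded k s b : cyc k s -> exists n, b < s n.
Proof.
move=> [k0 sle sk].
have h n : s (n * k)%N = s 0%N + n%:R * (pi *+ 2).
  elim: n => [|n IH]; first by rewrite mul0n mul0r addr0.
  by rewrite mulSnr sk IH -natr1; ring.
have p0 : 0 < pi *+ 2 :> R by rewrite mulrn_wgt0// pi_gt0.
exists ((Num.bound `|(b - s 0%N) / (pi *+ 2)|) * k)%N; rewrite h.
have := archi_boundP (normr_ge0 ((b - s 0%N) / (pi *+ 2))).
have := ler_norm ((b - s 0%N) / (pi *+ 2)) => h1 h2.
have : (b - s 0%N) / (pi *+ 2) < (Num.bound `|(b - s 0%N) / (pi *+ 2)|)%:R by lra.
by rewrite ltr_pdivrMr//; lra.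
Qed.

Definition good s := forall i, s i.+1 <= s i + pi.

Lemma pext_good k f : (0 < k)%N -> f k = f 0%N + pi *+ 2 ->
  (forall i, (i < k)%N -> f i.+1 <= f i + pi) -> good (pext k f).
Proof.
move=> k0 fk fle i; have := pext_step i k0 fk.
have := fle _ (ltn_pmod i k0); lra.
Qed.

(** The first two directions are moved to x and x + pi, given by [Ffix]. All other directions then
    lie in one half turn, which bounds the gaps, and two uses of [Fex] there ([ex1], [ex2]) carry
    the estimate from two gaps over to the whole sequence. *)
Lemma fix_gap k s : (2 < k)%N -> cyc k s -> s 0%N + pi < s 1%N ->
  exists s', [/\ cyc k s', good s' & cost k s' <= cost k s].
Proof.
move=> k3 hc h; have [k0 sle sk] := hc.
have skE : s k = s 0%N + pi *+ 2 by rewrite -sk.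
have le := cyc_le hc.
have s1k : s 1%N <= s 0%N + pi *+ 2 by rewrite -skE le// ltnW.
have [x [h1 h2 h3]] := Ffix h s1k.
have pi0 := pi_gt0 R.
pose f i := if i == 0%N then x else if i == 1%N then x + pi else
  if i == k then x + pi *+ 2 else s i.
have f0 : f 0%N = x by [].
have f1 : f 1%N = x + pi by [].
have fk : f k = f 0%N + pi *+ 2 by rewrite /f eqxx; do 2 (case: eqP => [?|_]; first lia).
have fi i : (1 < i < k)%N -> f i = s i.
  by move=> hi; rewrite /f; do 3 (case: eqP => [?|_]; first lia).
have fle i : (i < k)%N -> f i <= f i.+1.
  move=> ik; have [->|i0] := eqVneq i 0%N; first by rewrite f0 f1; lra.
  have [->|i1] := eqVneq i 1%N.
    by rewrite f1 fi//; have := sle 1%N; lra.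
  rewrite fi; last by lia.
  have [->|ik1] := eqVneq i.+1 k; last by rewrite fi//; lia.
  by rewrite fk f0; have := le i k (ltnW ik); rewrite skE; lra.
have fle' : forall i j, (i <= j <= k)%N -> f i <= f j.
  move=> i j /andP[ij jk]; elim: j ij jk => [|j IH]; first by rewrite leqn0 => /eqP ->.
  rewrite leq_eqVlt => /orP[/eqP -> //|ij] jk.
  by apply: (le_trans (IH _ _)) (fle _ _) => //; exact: ltnW.
exists (pext k f); split; first exact: pext_cyc.
  apply: pext_good => // i ik; have [->|i0] := eqVneq i 0%N; first by rewrite f0 f1.
  have : f 1%N <= f i by apply: fle'; lia.
  have : f i.+1 <= f k by apply: fle'; lia.
  by rewrite fk f0 f1; lra.
rewrite cost_pext//.
have fs2 : f 2 = s 2 by rewrite fi.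
have fsk : f k.-1 = s k.-1 by rewrite fi//; lia.
have ex1 : F (s 1%N) (s k) + F (s k.-1) (x + pi *+ 2) <= F (s 1%N) (x + pi *+ 2) + F (s k.-1) (s k).
  apply: Fex; [apply: le; lia|apply: le; lia|rewrite skE; lra|lra].
have ex2 : F (x + pi) (s 2) + F (s 1%N) (x + pi *+ 2) <= F (x + pi) (x + pi *+ 2) + F (s 1%N) (s 2).
  apply: Fex; [lra|apply: le; lia| |lra].
  by apply: (@le_trans _ _ (s k)); [apply: le; lia|rewrite skE; lra].
have cE g : cost k g = F (g 0%N) (g 1%N) + F (g 1%N) (g 2) + \sum_(2 <= i < k.-1) F (g i) (g i.+1) + F (g k.-1) (g k).
  rewrite /cost; case: k k3 {hc k0 sk skE s1k le f f0 f1 fk fi fle fle' fs2 fsk ex1 ex2} => // k k3.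
  rewrite big_nat_recr//= (@big_cat_nat _ _ _ 2)//=.
  by rewrite big_nat_recr//= big_nat1.
rewrite !cE f0 f1 fs2 fsk fk f0.
have -> : \sum_(2 <= i < k.-1) F (f i) (f i.+1) = \sum_(2 <= i < k.-1) F (s i) (s i.+1).
  by apply: eq_big_nat => i hi; rewrite !fi//; lia.
rewrite -skE in h3; lra.
Qed.

Lemma make_good k s : (2 < k)%N -> cyc k s ->
  exists s', [/\ cyc k s', good s' & cost k s' <= cost k s].
Proof.
move=> k3 hc; have [hg|/existsNP[i hi]] := pselect (good s).
  by exists s; split.
have [|s' [h1 h2 h3]] := @fix_gap k (fun j => s (i + j)%N) k3 (cyc_shift i hc).
  by rewrite addn0 addn1 ltNge; apply/negP.
by exists s'; split=> //; rewrite -(cost_shift i hc).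
Qed.

Lemma good_shift s m : good s -> good (fun i => s (m + i)%N).
Proof. by move=> h i; rewrite addnS. Qed.

(** Over one turn the index of t gains two on that of s, so some side of t lies inside a side of s.
    The sequence s is restarted at the end of that side of s, and t at its last direction not beyond
    this point. *)
Lemma nested_sides k s t : cyc k s -> cyc k.+2 t -> good s ->
  exists s' t', [/\ cyc k s', cyc k.+2 t', good s',
    cost k s' = cost k s /\ cost k.+2 t' = cost k.+2 t &
    [/\ t' 0%N <= s' 0%N, s' 0%N < t' 1%N & s' k.-1 <= t' k.+1]].
Proof.
move=> hs ht hg.
have [N hN] := cyc_unbounded (t 0%N) hs.
have ex1 : exists j, s N <= t j by have [j hj] := cyc_unbounded (s N) ht; exists j; exact: ltW.
case: (ex_minnP ex1) => -[|j] hj hmin; first by lra.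
have tj : t j < s N by rewrite ltNge; apply/negP => /hmin; rewrite ltnn.
have [k0 sle sk] := hs; have [_ tle tk] := ht.
have ex2 : exists a, t (j.+1 + a.+1)%N <= s (N + a.+1)%N.
  exists k.-1; rewrite prednK// sk.
  apply: (@le_trans _ _ (t (j + k.+2)%N)); last by rewrite tk; lra.
  by apply: (cyc_le ht); lia.
case: (ex_minnP ex2) => a ha amin.
have sa : s (N + a)%N <= t (j.+1 + a)%N.
  case: a ha amin => [|a] ha amin; first by rewrite !addn0.
  by rewrite leNgt; apply/negP => /ltW /amin; rewrite ltnn.
pose b := (N + a.+1)%N; pose e := (j.+1 + a.+1)%N.
have ex3 : exists m, s b < t (e + m)%N.
  have [m hm] := cyc_unbounded (s b) ht; exists m.
  by apply: (lt_le_trans hm); apply: (cyc_le ht); lia.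
case: (ex_minnP ex3) => -[|m] hm mmin; first by move: hm; rewrite addn0 ltNge ha.
exists (fun i => s (b + i)%N), (fun i => t (e + m + i)%N); split.
- exact: cyc_shift.
- exact: cyc_shift.
- exact: good_shift.
- by rewrite !cost_shift.
split.
- by rewrite !addn0 leNgt; apply/negP => /mmin; rewrite ltnn.
- by rewrite addn0 -addnA addn1.
have -> : (b + k.-1 = (N + a) + k)%N by rewrite /b; lia.
apply: (@le_trans _ _ (t (j.+1 + a + k.+2)%N)); first by rewrite sk tk; lra.
by apply: (cyc_le ht); rewrite /e; lia.
Qed.

(** After [nested_sides] the last side of T lies in the last side of S; minimality of a gives
    another nested pair, the side of T from a + 1 in the side of S from a. Exchanging tails at the
    two places turns k and k + 2 sides into k + 1 and k + 1. Each exchange stays inside a side of S,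
    so only s has to be [good]. *)
Lemma swap_sides k s t : (0 < k)%N -> cyc k s -> cyc k.+2 t -> good s ->
  exists u v, [/\ cyc k.+1 u, cyc k.+1 v &
    cost k.+1 u + cost k.+1 v <= cost k s + cost k.+2 t].
Proof.
move=> k0 hs0 ht0 hg0.
have [s' [t' [hs ht hg [<- <-] [h0 h1 hk]]]] := nested_sides hs0 ht0 hg0.
move: s' t' hs ht hg h0 h1 hk => S T hs ht hg h0 h1 hk {s t hs0 ht0 hg0}.
have [_ sle sk] := hs; have [_ tle tk] := ht.
have Sk : S k = S 0%N + pi *+ 2 by rewrite -sk.
have Tk : T k.+2 = T 0%N + pi *+ 2 by rewrite -tk.
have sh := cyc_le hs; have th := cyc_le ht.
have ex : exists a, T a.+2 <= S a.+1.
  by exists k.-1; rewrite prednK//; apply: (@le_trans _ _ (T k.+2)); [apply: th; lia|lra].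
case: (ex_minnP ex) => a ha amin.
have ak : (a < k)%N.
  have : (a <= k.-1)%N by apply: amin; rewrite prednK//; apply: (@le_trans _ _ (T k.+2)); [apply: th; lia|lra].
  by lia.
have Sa : S a < T a.+1.
  case: a ha amin ak => [//|a] ha amin ak.
  by rewrite ltNge; apply/negP => /amin; rewrite ltnn.
pose u i := if (i <= a)%N then S i else if (i <= k)%N then T i.+1 else S k.
pose v i := if (i <= a.+1)%N then T i else if (i <= k)%N then S i.-1 else T k.+2.
have u0 : u k.+1 = u 0%N + pi *+ 2 by rewrite /u ltnn leqNgt (ltn_trans ak)//= Sk.
have v0 : v k.+1 = v 0%N + pi *+ 2.
  by rewrite /v ltnn (_ : (k.+1 <= a.+1)%N = false)//=; lia.
have ula i : (i <= a)%N -> u i = S i by rewrite /u => ->.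
have uga i : (a < i <= k)%N -> u i = T i.+1.
  by move=> /andP[h2 h3]; rewrite /u h3 leqNgt h2.
have uk : u k.+1 = S k by rewrite u0 ula// Sk.
have vla i : (i <= a.+1)%N -> v i = T i by rewrite /v => ->.
have vga i : (a.+1 < i <= k)%N -> v i = S i.-1.
  by move=> /andP[h2 h3]; rewrite /v h3 leqNgt h2.
have vk : v k.+1 = T k.+2 by rewrite v0 vla// Tk.
have TS : T k.+2 <= S k by lra.
have skk : S k <= S k.-1 + pi by have := hg k.-1; rewrite prednK.
exists (pext k.+1 u), (pext k.+1 v); split.
- apply: pext_cyc => // i ik.
  have [h2|h2] := ltnP i a; first by rewrite !ula//; exact: ltnW.
  have [<-|h3] := eqVneq a i.
    have [e|e] := eqVneq a k; first by lia.
    by rewrite ula// uga; [have := tle a.+1; lra|lia].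
  rewrite uga; last by lia.
  have [->|h4] := eqVneq i k; first by rewrite uk; apply: le_trans TS; exact: tle.
  by rewrite uga//; lia.
- apply: pext_cyc => // i ik.
  have [h2|h2] := ltnP i a.+1; first by rewrite !vla//; exact: ltnW.
  have [<-|h3] := eqVneq a.+1 i.
    rewrite vla//; have [e|e] := eqVneq a.+1 k; first by rewrite e vk; apply: th; lia.
    by rewrite vga; [have := tle a.+1; rewrite /=; lra|lia].
  rewrite vga; last by lia.
  have [->|h4] := eqVneq i k; first by rewrite vk; apply: (le_trans hk); exact: tle.
  by rewrite vga; [apply: sh; lia|lia].
rewrite !cost_pext//.
have split2 (g : nat -> R) m n : (m < n)%N -> \sum_(0 <= i < n) g i =
    \sum_(0 <= i < m) g i + g m + \sum_(m.+1 <= i < n) g i.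
  by move=> mn; rewrite (@big_cat_nat _ _ _ m)//= ?(ltnW mn)// [X in _ + X]big_ltn// addrA.
have cu : cost k.+1 u = \sum_(0 <= i < a) F (S i) (S i.+1) + F (S a) (T a.+2) +
    \sum_(a.+2 <= i < k.+1) F (T i) (T i.+1) + F (T k.+1) (S k).
  rewrite /cost (@split2 _ a); last by lia.
  rewrite [X in _ + X]big_nat_recr/= -?addrA; last by lia.
  congr (_ + (_ + (_ + _))).
  - by apply: eq_big_nat => i hi; rewrite !ula//; lia.
  - by rewrite ula// uga//; lia.
  - rewrite [RHS]big_add1/=; apply: eq_big_nat => i hi; rewrite !uga//; lia.
  - by rewrite uk uga//; lia.
have cT : cost k.+2 T = \sum_(0 <= i < a.+1) F (T i) (T i.+1) + F (T a.+1) (T a.+2) +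
    \sum_(a.+2 <= i < k.+1) F (T i) (T i.+1) + F (T k.+1) (T k.+2).
  rewrite /cost (@split2 _ a.+1); last by lia.
  by rewrite [X in _ + X]big_nat_recr/= ?addrA//; lia.
have e1 : F (S a) (T a.+2) + F (T a.+1) (S a.+1) <= F (S a) (S a.+1) + F (T a.+1) (T a.+2).
  by apply: Fex => //; exact: ltW.
(* If a + 1 = k, both nested sides lie in the same side of S, and the exchanges are chained through
   the intermediate term F (T k) (S k). *)
have [ak1|ak1] := ltnP a.+1 k; last first.
  have ek : a.+1 = k by lia.
  have cv : cost k.+1 v = \sum_(0 <= i < a.+1) F (T i) (T i.+1) + F (T k) (T k.+2).
    rewrite /cost -{1}ek big_nat_recr//=; congr (_ + _).
      by apply: eq_big_nat => i hi; rewrite !vla//; lia.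
    by rewrite ek vk vla// ek.
  have cS : cost k S = \sum_(0 <= i < a) F (S i) (S i.+1) + F (S a) (S a.+1).
    by rewrite /cost -{1}ek big_nat_recr.
  have e2 : F (T k) (T k.+2) + F (T k.+1) (S k) <= F (T k) (S k) + F (T k.+1) (T k.+2).
    apply: Fex => //; have := hg a; rewrite ek; have := Sa; rewrite ek; lra.
  rewrite cu cv cT cS; rewrite -> ek in *.
  by lra.
have cv : cost k.+1 v = \sum_(0 <= i < a.+1) F (T i) (T i.+1) + F (T a.+1) (S a.+1) +
    \sum_(a.+1 <= i < k.-1) F (S i) (S i.+1) + F (S k.-1) (T k.+2).
  rewrite /cost (@split2 _ a.+1); last by lia.
  rewrite [X in _ + X](@big_cat_nat _ _ _ k)/=; [|lia|lia].
  rewrite [X in _ + (_ + X)]big_nat1 -!addrA; congr (_ + (_ + (_ + _))).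
  - by apply: eq_big_nat => i hi; rewrite !vla//; lia.
  - by rewrite vla// vga//; lia.
  - rewrite big_add1/=; apply: eq_big_nat => i hi; rewrite !vga//; lia.
  - by rewrite vk vga//; lia.
have cS : cost k S = \sum_(0 <= i < a) F (S i) (S i.+1) + F (S a) (S a.+1) +
    \sum_(a.+1 <= i < k.-1) F (S i) (S i.+1) + F (S k.-1) (S k).
  rewrite /cost (@split2 _ a); last by lia.
  rewrite -[in LHS](prednK k0) big_nat_recr/=; last by lia.
  by rewrite addrA prednK.
have e2 : F (S k.-1) (T k.+2) + F (T k.+1) (S k) <= F (S k.-1) (S k) + F (T k.+1) (T k.+2).
  by apply: Fex.
by rewrite cu cv cT cS; lra.
Qed.

Theorem dowker_cost k s t : (2 < k)%N -> cyc k s -> cyc k.+2 t ->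
  exists u v, [/\ cyc k.+1 u, cyc k.+1 v &
    cost k.+1 u + cost k.+1 v <= cost k s + cost k.+2 t].
Proof.
move=> k3 hs ht; have [s' [hs' hg le]] := make_good k3 hs.
have [|u [v [hu hv h]]] := swap_sides _ hs' ht hg; first by lia.
by exists u, v; split=> //; lra.
Qed.

End dowker.

(** * Spindle convex bodies and their disk polygons *)

Section disks.
Context {R : realType}.
Implicit Types (p q y z c : R * R) (K : set (R * R)).

Lemma disk_atE c y : disk_at c y <-> d2 y c <= 1.
Proof.
split=> [[x hx <-]|h]; first by move: hx; rewrite /unit_disk/= /d2/= !(addrC c.1) !(addrC c.2) !addrK.
exists (y - c); first by [].
by rewrite addrC subrK.
Qed.

Lemma continuous_affine (a b e : R) : continuous (fun p : R * R => p.1 * a + p.2 * b + e).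
Proof.
move=> p; apply: cvgD; last exact: cvg_cst.
by apply: cvgD; apply: cvgMl; [exact: cvg_fst|exact: cvg_snd].
Qed.

Lemma continuous_d2 c : continuous (fun p : R * R => d2 p c).
Proof.
move=> p; apply: cvgD.
  by apply: cvgM; (apply: cvgB; [exact: cvg_fst|exact: cvg_cst]).
by apply: cvgM; (apply: cvgB; [exact: cvg_snd|exact: cvg_cst]).
Qed.

Lemma disk_at_closed c : closed (disk_at c).
Proof.
have -> : disk_at c = (fun p : R * R => d2 p c) @^-1` [set x | x <= 1].
  by apply/seteqP; split => y /disk_atE.
exact: (continuous_closedP _).1 (@continuous_d2 c) _ (@closed_le R 1).
Qed.

End disks.

Section bodies.
Context {R : realType}.

(** What is used of a spindle convex disk of diameter below 2, collected so that it can be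
    transported by rotations. By [bodyS], K lies in the unit disk touching it at [x s]. *)
Record body (K : set (R * R)) (x : R -> R * R) : Prop := Body {
  bodyP : forall s, K (x s);
  bodyS : forall s y, K y -> supp (x s) s y;
  body2pi : forall s, x (s + pi *+ 2) = x s;
  bodyarc : forall o a b c, a <= b -> b <= c -> c < a + pi ->
    K (pt o a) -> K (pt o c) -> K (pt o b);
  bodyconv : forall (y z : R * R) (t : R), 0 <= t <= 1 -> K y -> K z ->
    K (t * y.1 + (1 - t) * z.1, t * y.2 + (1 - t) * z.2);
  body4 : forall y z, K y -> K z -> d2 y z < 4;
  bodycompact : compact K;
  body2 : exists y z, [/\ K y, K z & y != z] }.

Lemma convex_setE (K : set (R * R)) (p q : R * R) (t : R) : convex_set (K : set (R^o * R^o)%type) ->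
  0 <= t <= 1 -> K p -> K q ->
  K (t * p.1 + (1 - t) * q.1, t * p.2 + (1 - t) * q.2).
Proof.
move=> hK /andP[t0 t1] hp hq.
have := set_mem (hK p q (Itv01 t0 t1) (mem_set hp) (mem_set hq)).
by [].
Qed.

Lemma spindle_arc (K : set (R * R)) o a b c :
  (forall p q, K p -> K q -> spindle p q `<=` K) ->
  a <= b -> b <= c -> c < a + pi -> K (pt o a) -> K (pt o c) -> K (pt o b).
Proof.
move=> hK ab bc ca ha hc; apply: (hK _ _ ha hc) => e [/= /disk_atE h1 /disk_atE h2].
by apply/disk_atE; apply: (arc_in _ _ _ h1 h2).
Qed.

Lemma interior_two (K : set (R * R)) : K° !=set0 -> exists y z, [/\ K y, K z & y != z].
Proof.
move=> [p hp]; have Kp : K p by exact: nbhs_singleton.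
have /nbhs_ballP[e /= e0 he] : nbhs p K := hp.
exists p, (p.1 + e / 2, p.2); split=> //.
- apply: he; split; rewrite /ball/=; last by rewrite subrr normr0.
  by rewrite opprD addrA subrr sub0r normrN gtr0_norm; lra.
- by apply/eqP => /(congr1 fst)/= h; lra.
Qed.

Lemma body_exists (K : set (R * R)) : spindle_convex_disk K ->
  (forall y z, K y -> K z -> d2 y z < 4) -> exists x, body K x.
Proof.
move=> [[Kc Kconv Kint] Ksp] K4.
have [y0 [z0 [Ky0 _ _]]] := interior_two Kint.
(* The choice depends on s only through the predicate, so directions that differ by a full turn get
   the same point. *)
pose x s := xget y0 [set p | K p /\ forall z, K z -> 0 <= hd s p z].
have xP s : K (x s) /\ forall z, K z -> 0 <= hd s (x s) z.
  apply: (@xgetPex _ y0 [set p | K p /\ forall z, K z -> 0 <= hd s p z]).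
  have [||p /set_mem Kp hp] := @compact_EVT_max _ R
     (fun p : R * R => p.1 * cos s + p.2 * sin s + 0) K _ Kc.
  - by exists y0.
  - by apply: continuous_subspaceT; exact: continuous_affine.
  exists p; split=> // z /mem_set /hp; rewrite /hd; lra.
have harc o a b c : a <= b -> b <= c -> c < a + pi ->
    K (pt o a) -> K (pt o c) -> K (pt o b) by exact: spindle_arc.
exists x; split=> //.
- by move=> s; have [] := xP s.
- move=> s y Ky; have [Kx hx] := xP s.
  by apply: (@support_disk _ K) => //; exact: K4.
- move=> s; rewrite /x; congr xget; apply/seteqP; split => p /= [Kp hp]; split=> // z Kz;
  by have := hp _ Kz; rewrite hdD2pi.
- by move=> y z t; exact: convex_setE.
- exact: interior_two.
Qed.

(** Points at distance above 2 have the whole plane as spindle, against compactness. At distance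
    exactly 2 a single unit disk contains both, so it lies in K; any further point would be at
    distance above 2 from a point of this disk. *)
Lemma large_diameter (K : set (R * R)) : spindle_convex_disk K ->
  (exists y z, [/\ K y, K z & 4 <= d2 y z]) ->
  exists c, disk_at c = K.
Proof.
move=> [[Kc _ _] Ksp] [y [z [Ky Kz]]].
have le4 p q : K p -> K q -> d2 p q <= 4.
  move=> Kp Kq; rewrite leNgt; apply/negP => h4.
  have KT : K = setT.
    apply/seteqP; split=> // w _; apply: (Ksp _ _ Kp Kq) => e [/= /disk_atE h1 /disk_atE h2].
    exfalso; move: h1 h2 h4; rewrite /d2 => h1 h2.
    have : 0 <= (p.1 + q.1 - 2 * e.1) ^+ 2 by exact: sqr_ge0.
    have : 0 <= (p.2 + q.2 - 2 * e.2) ^+ 2 by exact: sqr_ge0.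
    nra.
  have [||m _ hm] := @compact_EVT_max _ R (fun p : R * R => p.1 * 1 + p.2 * 0 + 0) K _ Kc.
  - by exists p.
  - by apply: continuous_subspaceT; exact: continuous_affine.
  have := hm (m.1 + 1, m.2); rewrite KT => /(_ (mem_set I))/=; lra.
move=> d4; have {}d4 : d2 y z = 4 by apply/eqP; rewrite eq_le d4 le4.
pose c : R * R := ((y.1 + z.1) / 2, (y.2 + z.2) / 2).
have cK : disk_at c `<=` K.
  move=> w hw; apply: (Ksp _ _ Ky Kz) => e [/= /disk_atE h1 /disk_atE h2].
  suff -> : e = c by [].
  apply/eqP; rewrite -d2_eq0 eq_le d2_ge0 andbT.
  by move: h1 h2 d4; rewrite /d2/=; nra.
exists c; apply/seteqP; split=> // w Kw; apply/disk_atE; rewrite leNgt; apply/negP => hw.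
have wc : w != c by apply/eqP => e; move: hw; rewrite e d2pp; lra.
have [l [s [l0 l2 _ e1 e2]]] := polar 0 wc.
have : d2 w (pt c (s + pi)) <= 4.
  by apply: le4 => //; apply: cK; apply/disk_atE; rewrite d2_pt.
rewrite /d2 /= cosDpi sinDpi.
have -> : w.1 - (c.1 + - cos s) = (l + 1) * cos s by rewrite mulrDl -e1 mul1r; ring.
have -> : w.2 - (c.2 + - sin s) = (l + 1) * sin s by rewrite mulrDl -e2 mul1r; ring.
rewrite !exprMn -mulrDr cos2Dsin2; nra.
Qed.

Lemma body_separation (K : set (R * R)) x y b : body K x -> ~ K y ->
  exists2 s, b <= s < b + pi *+ 2 & 0 < hd s y (x s).
Proof.
move=> hK nKy.
have [||X /set_mem KX hX] := @compact_EVT_min _ R (fun p : R * R => d2 p y) K _ (bodycompact hK).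
- by exists (x 0); exact: (bodyP hK).
- by apply: continuous_subspaceT; exact: continuous_d2.
have yX : y != X by apply/eqP => e; apply: nKy; rewrite e.
have [l [s [l0 l2 hs e1 e2]]] := polar b yX; exists s => //.
have Kxs := bodyP hK s.
suff h : 0 <= hd s X (x s).
  have -> : hd s y (x s) = l * (cos s ^+ 2 + sin s ^+ 2) + hd s X (x s).
    rewrite /hd; have -> : y.1 - (x s).1 = l * cos s + (X.1 - (x s).1) by lra.
    by have -> : y.2 - (x s).2 = l * sin s + (X.2 - (x s).2); [lra|ring].
  by rewrite cos2Dsin2; lra.
rewrite leNgt; apply/negP => h.
pose a := - hd s X (x s) * l; pose B := d2 (x s) X.
have a0 : 0 < a by rewrite /a mulr_gt0// oppr_gt0.
have B0 : 0 <= B by exact: d2_ge0.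
(* A step of size t from the nearest point X towards [x s] changes the squared distance to y by - 2
   t a + t^2 B, and t B <= a. *)
pose t := a / (a + B).
have t1 : 0 <= t <= 1.
  by apply/andP; split; [apply: divr_ge0; lra|rewrite ler_pdivrMr; lra].
have tE : t * (a + B) = a by rewrite /t divfK// gt_eqF; lra.
have := hX _ (mem_set (bodyconv hK t1 Kxs KX)).
rewrite leNgt => /negP; apply.
suff -> : d2 (t * (x s).1 + (1 - t) * X.1, t * (x s).2 + (1 - t) * X.2) y =
  d2 X y - 2 * t * a + t ^+ 2 * B by have t0 : 0 < t by [rewrite divr_gt0//; lra]; nra.
rewrite /a /B /d2 /hd /=.
have -> : t * (x s).1 + (1 - t) * X.1 - y.1 = t * ((x s).1 - X.1) - l * cos s by lra.
have -> : t * (x s).2 + (1 - t) * X.2 - y.2 = t * ((x s).2 - X.2) - l * sin s by lra.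
have -> : X.1 - y.1 = - (l * cos s) by lra.
have -> : X.2 - y.2 = - (l * sin s) by lra.
ring.
Qed.

Lemma body_inj (K : set (R * R)) x p s : body K x -> K p ->
  (forall y, K y -> 0 <= hd s p y) -> x s = p.
Proof.
move=> hK Kp hp; apply/eqP; rewrite -d2_eq0 d2C eq_le d2_ge0 andbT.
have /suppE := bodyS hK s Kp.
by have := hp _ (bodyP hK s); rewrite hdC; lra.
Qed.

End bodies.

Section list_to_cyc.
Context {R : realType}.

Definition lcyc (l : seq R) (i : nat) : R :=
  nth 0 l (i %% size l) + (i %/ size l)%:R * (pi *+ 2).

Lemma lcyc_cyc (l : seq R) b : (0 < size l)%N -> sorted <=%R l ->
  {in l, forall x, b <= x < b + pi *+ 2} -> cyc (size l) (lcyc l).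
Proof.
move=> l0 ls lb; split=> // i.
  rewrite /lcyc; set k := size l.
  have hm := ltn_pmod i l0; rewrite -/k in hm.
  have e2 : i.+1 = (i %/ k * k + (i %% k).+1)%N by rewrite addnS -divn_eq.
  have [h|h] := ltnP (i %% k).+1 k.
    have -> : (i.+1 %% k = (i %% k).+1)%N.
      by rewrite -addn1 -modnDml addn1 modn_small.
    have -> : (i.+1 %/ k = i %/ k)%N.
      by rewrite [in LHS]e2 divnMDl// (divn_small h) addn0.
    by rewrite lerD2r; apply: (sortedP 0 ls).
  have e : (i %% k).+1 = k by apply/eqP; rewrite eqn_leq hm h.
  have -> : (i.+1 %% k = 0)%N by rewrite -addn1 -modnDml addn1 e modnn.
  have -> : (i.+1 %/ k = (i %/ k).+1)%N.
    by rewrite [in LHS]e2 divnMDl// e divnn l0 addn1.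
  rewrite -natr1 mulrDl mul1r.
  have /andP[h1 _] := lb _ (mem_nth 0 l0).
  have /andP[_ h2] := lb _ (mem_nth 0 hm).
  by lra.
rewrite /lcyc modnDr divnDr // divnn l0 addn1 -natr1 mulrDl mul1r; ring.
Qed.

End list_to_cyc.

(** * Disk polygons as hulls of their vertices *)

Section hull_points.
Context {R : realType}.
Implicit Types (y z c e : R * R) (C : seq (R * R)).

Definition in_disks C y := forall c, c \in C -> d2 y c <= 1.

Lemma d2_conv y z e (t : R) : 0 <= t <= 1 -> d2 y e <= 1 -> d2 z e <= 1 ->
  d2 (t * y.1 + (1 - t) * z.1, t * y.2 + (1 - t) * z.2) e <= 1.
Proof.
move=> /andP[t0 t1] h1 h2.
have -> : d2 (t * y.1 + (1 - t) * z.1, t * y.2 + (1 - t) * z.2) e =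
  t * d2 y e + (1 - t) * d2 z e - t * (1 - t) * d2 y z by rewrite /d2/=; ring.
have h3 : 0 <= t * (1 - t) * d2 y z.
  by rewrite mulr_ge0 ?d2_ge0// mulr_ge0// subr_ge0.
nra.
Qed.

(** A point x outside only the disk about c would let the segment from a point y of the polygon to x
    cross the circle about c inside the polygon, by the intermediate value theorem. *)
Lemma in_disks_drop C c : (exists y, in_disks C y) -> c \in C ->
  (forall y, in_disks C y -> d2 y c != 1) ->
  forall x, in_disks [seq c' <- C | c' != c] x -> in_disks C x.
Proof.
move=> [y hy] cC nt x hx c' c'C.
have [->{c' c'C}|ne] := eqVneq c' c; last by apply: hx; rewrite mem_filter ne.
rewrite leNgt; apply/negP => hxc.
have yc : d2 y c < 1 by rewrite lt_neqAle nt// hy.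
pose w t : R * R := (t * x.1 + (1 - t) * y.1, t * x.2 + (1 - t) * y.2).
have [||t] := @IVT R (fun t => d2 (w t) c) 0 1 1 ler01.
- apply: continuous_subspaceT => t; rewrite /d2/=.
  have h (a b e : R) : {for t, continuous (fun t : R => t * a + (1 - t) * b - e)}.
    apply: cvgB; last exact: cvg_cst.
    apply: cvgD; apply: cvgMl; first exact: cvg_id.
    by apply: cvgB; [exact: cvg_cst|exact: cvg_id].
  by apply: cvgD; apply: cvgM; exact: h.
- rewrite /w !mul0r !mul1r !subr0 !subrr !mul0r !mul1r !add0r !addr0 -!surjective_pairing.
  by rewrite ge_min le_max (ltW yc) (ltW hxc) orbT.
rewrite in_itv/= => ht tE; suff : d2 (w t) c != 1 by rewrite tE eqxx.
apply: nt => c' c'C; have [->|ne] := eqVneq c' c; first by rewrite tE.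
by apply: d2_conv => //; [apply: hx; rewrite mem_filter ne|exact: hy].
Qed.

Lemma touching_disks C : (exists y, in_disks C y) -> C != [::] ->
  exists C', [/\ C' != [::], (size C' <= size C)%N,
    forall y, in_disks C' y <-> in_disks C y &
    forall c, c \in C' -> exists2 y, in_disks C' y & d2 y c = 1].
Proof.
elim: {C}_.+1 {-2}C (ltnSn (size C)) => // n IH C sC Cne C0.
have [hall|/existsNP[c /not_implyP[cC hc]]] :=
  pselect (forall c, c \in C -> exists2 y, in_disks C y & d2 y c = 1).
  by exists C; split.
have nt y : in_disks C y -> d2 y c != 1.
  by move=> hy; apply/eqP => e; apply: hc; exists y.
have drop := in_disks_drop Cne cC nt.
have sub y : in_disks C y -> in_disks [seq c' <- C | c' != c] y.
  by move=> hy c'; rewrite mem_filter => /andP[_ /hy].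
have s1 : (size [seq c' <- C | c' != c] < size C)%N.
  by rewrite size_filter -(count_predC (fun c' => c' != c)) -[X in (X < _)%N]addn0 ltn_add2l -has_count; apply/hasP; exists c => //=; rewrite negbK.
have [||| C' [h1 h2 h3 h4]] := IH [seq c' <- C | c' != c].
- by rewrite (leq_trans s1).
- by have [y /sub hy] := Cne; exists y.
(* Were c the only center, dropping its disk would change nothing, so even the point c + (2, 0)
   would lie in it. *)
- apply/eqP => e.
  have /(_ c cC) : in_disks C (c.1 + 2, c.2) by apply: drop; rewrite e.
  by rewrite /d2/=; lra.
exists C'; split=> //; first by rewrite (leq_trans h2)// ltnW.
by move=> y; split => [/h3/drop//|/sub/h3].
Qed.

Lemma ctrDn2pi (p : R * R) (v : R) (n : nat) : ctr p (v + n%:R * (pi *+ 2)) = ctr p v.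
Proof. by rewrite /ctr -[n%:R]/(n%:Z%:~R) cosDn2pi sinDn2pi. Qed.

(** Distance is symmetric: y is in the polygon iff all centers are in the unit disk about y. So the
    centers, ordered by the direction in which they touch the polygon, form a configuration whose
    edge centers are the vertices, and [cfg_hull] applied to the centers says that the vertices span
    the polygon. *)
Lemma hull_points C : C != [::] -> (exists y z, [/\ in_disks C y, in_disks C z & y != z]) ->
  (forall y z, in_disks C y -> in_disks C z -> d2 y z < 4) ->
  exists Q : seq (R * R), [/\ (size Q <= size C)%N, forall q, q \in Q -> in_disks C q &
    forall e, (forall q, q \in Q -> d2 q e <= 1) -> forall y, in_disks C y -> d2 y e <= 1].
Proof.
move=> C0 [y0 [z0 [hy0 hz0 yz0]]] C4.
have [C' [C'0 sC' C'E C't]] := touching_disks (ex_intro _ y0 hy0) C0.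
have hV c : exists v, c \in C' -> 0 <= v < 0 + pi *+ 2 /\ in_disks C' (ctr c v).
  have [cC|] := boolP (c \in C'); last by exists 0.
  have [y hy yc] := C't _ cC.
  have [v [hv h1 h2]] : exists v : R, [/\ 0 <= v < 0 + pi *+ 2, cos v = c.1 - y.1 & sin v = c.2 - y.2].
    by apply: argument; rewrite -[LHS]/(d2 c y) d2C.
  exists v => _; split=> //; have -> : ctr c v = y by rewrite /ctr h1 h2 !subKr -surjective_pairing.
  by [].
pose V c := xget 0 [set v | c \in C' -> 0 <= v < 0 + pi *+ 2 /\ in_disks C' (ctr c v)].
have {hV}VP c : c \in C' -> 0 <= V c < 0 + pi *+ 2 /\ in_disks C' (ctr c (V c)).
  exact: (@xgetPex _ 0 [set v | c \in C' -> 0 <= v < 0 + pi *+ 2 /\ in_disks C' (ctr c v)] (hV c)).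
pose E := sort (relpre V <=%R) (undup C').
have EC c : (c \in E) = (c \in C') by rewrite mem_sort mem_undup.
have sE : (size E <= size C)%N by rewrite size_sort (leq_trans (size_undup _)).
have Eu : uniq E by rewrite sort_uniq undup_uniq.
(* A single disk would contain two antipodal points at distance 2. *)
have E1 : (1 < size E)%N.
  rewrite ltnNge; apply/negP => E1.
  have [c cC] : exists c, c \in C' by case: (C') C'0 => // c l _; exists c; rewrite mem_head.
  have allc c' : c' \in C' -> c' = c.
    move: cC E1; rewrite -!EC; case: (E) => [//|a [|//]].
    by rewrite !inE => /eqP -> _ /eqP.
  have hpt v : in_disks C (pt c v).
    by apply/C'E => c' /allc ->; rewrite d2_pt.
  have := C4 _ _ (hpt 0) (hpt pi); rewrite /d2/= cos0 cospi sin0 sinpi.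
  by lra.
pose k := size E; have k0 : (0 < k)%N by exact: ltnW.
pose s := lcyc (map V E).
have hc : cyc k s.
  rewrite /k -(size_map V); apply: (@lcyc_cyc _ _ 0); first by rewrite size_map.
    by rewrite sorted_map; apply: sort_sorted => a b; exact: le_total.
  by move=> v /mapP[c]; rewrite EC => /VP[? _] ->.
pose X i := nth 0 E (i %% k).
have XE i : X i \in C' by rewrite -EC mem_nth// ltn_mod.
have sX i c : supp (X i) (s i) c = (d2 c (ctr (X i) (V (X i))) <= 1).
  by rewrite /supp /s /lcyc size_map -/k ctrDn2pi (nth_map 0)// ltn_mod.
have hX i j : supp (X j) (s j) (X i).
  by rewrite sX d2C; have [_] := VP _ (XE j); apply.
have Xk i : X (i + k)%N = X i by rewrite /X modnDr.
(* Disks whose centers are at distance at least 2 share at most the midpoint of the centers, but the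
   polygon has two points. *)
have hd4 i j : d2 (X i) (X j) < 4.
  rewrite ltNge; apply/negP => h; move/eqP: yz0; apply.
  have mid y : in_disks C y -> y = (((X i).1 + (X j).1) / 2, ((X i).2 + (X j).2) / 2).
    move=> /C'E hy; apply/eqP; rewrite -d2_eq0 eq_le d2_ge0 andbT.
    have := hy _ (XE i); have := hy _ (XE j); move: h; rewrite /d2/=; lra.
  by rewrite (mid _ hy0) (mid _ hz0).
have X01 : X 0%N != X 1%N.
  by rewrite /X !modn_small// nth_uniq.
have eper i : ecenter s X (i + k) = ecenter s X i.
  rewrite /ecenter -addSn !Xk; case: ifP => // _.
  by have [_ _ ->] := hc; rewrite /ctr cosD2pi sinD2pi.
exists [seq ecenter s X i | i <- iota 0 k]; split.
- by rewrite size_map size_iota.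
- move=> _ /mapP[i _ ->]; apply/C'E => c.
  rewrite -EC => /(nthP 0)[j jk <-]; rewrite d2C.
  have -> : nth 0 E j = X j by rewrite /X modn_small.
  exact: (cfg_in_edge_disks hc Xk hX hd4).
- move=> e he y hy; rewrite d2C.
  apply: (cfg_hull hc Xk hX hd4).
  + by exists 0%N, 1%N.
  + move=> i; rewrite d2C.
    have -> : ecenter s X i = ecenter s X (i %% k).
      rewrite {1}(divn_eq i k) addnC; elim: (i %/ k)%N => [|m IH]; first by rewrite mul0n addn0.
      by rewrite mulSn addnCA addnC eper.
    by apply: he; apply: map_f; rewrite mem_iota add0n ltn_mod.
  + by move=> i; rewrite d2C; move/C'E: hy; apply.
Qed.

End hull_points.

(** * Pushing vertices to the boundary of the body *)

Section push.
Context {R : realType}.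
Variables (K : set (R * R)) (x : R -> R * R).
Hypothesis hK : body K x.
Implicit Types (y z c e p q w : R * R).

Lemma body_mem_disks y : (forall c, (forall z, K z -> d2 z c <= 1) -> d2 y c <= 1) -> K y.
Proof.
move=> h; apply: contrapT => /(body_separation 0 hK)[s _ hs].
have /supp_ge0 : supp (x s) s y by apply: h => z; exact: bodyS.
by rewrite hdC; lra.
Qed.

Lemma compact_centers : compact [set c | forall z, K z -> d2 z c <= 1].
Proof.
pose p := x 0; have Kp : K p := bodyP hK 0.
apply: (@subclosed_compact _ _ (`[p.1 - 1, p.1 + 1]%classic `*` `[p.2 - 1, p.2 + 1]%classic)).
- have -> : [set c | forall z, K z -> d2 z c <= 1] = \bigcap_(z in K) disk_at z.
    apply/seteqP; split=> [c hc z Kz|c hc z Kz].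
      by apply/disk_atE; rewrite d2C; exact: hc.
    by rewrite d2C; apply/disk_atE; exact: hc.
  by apply: closed_bigI => z _; exact: disk_at_closed.
- by apply: compact_setX; exact: segment_compact.
- move=> c /(_ _ Kp); rewrite /d2 => hc; split; rewrite /= in_itv/=.
    have : (p.1 - c.1) ^+ 2 <= 1 by have := sqr_ge0 (p.2 - c.2); lra.
    by move=> h; apply/andP; split; nra.
  have : (p.2 - c.2) ^+ 2 <= 1 by have := sqr_ge0 (p.1 - c.1); lra.
  by move=> h; apply/andP; split; nra.
Qed.

(** The last point W of K on the ray from p through q has to be an [x s], that is, to lie on the
    circle of a unit disk containing K. *)
Lemma exit_point p q : K p -> K q -> p != q -> exists s t,
  [/\ 0 <= s < 0 + pi *+ 2, 1 <= t &
   x s = (p.1 + t * (q.1 - p.1), p.2 + t * (q.2 - p.2))].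
Proof.
move=> Kp Kq pq; pose v1 := q.1 - p.1; pose v2 := q.2 - p.2.
pose L := (fun w : R * R => w.1 * v2 + w.2 * - v1 + (p.2 * v1 - p.1 * v2)) @^-1` [set 0].
have Lc : closed L.
  exact: (continuous_closedP _).1 (@continuous_affine _ _ _ _) _ (@closed_eq R 0).
have KLc : compact (K `&` L) by apply: compact_closedI => //; exact: bodycompact hK.
have Lq : L q by rewrite /L /v1 /v2/=; ring.
have B0 : 0 < v1 ^+ 2 + v2 ^+ 2 by rewrite -/(d2 q p) d2_gt0 eq_sym.
have [||W /set_mem[KW LW] hW] := @compact_EVT_max _ R
     (fun w : R * R => w.1 * v1 + w.2 * v2 + 0) (K `&` L) _ KLc.
- by exists q.
- by apply: continuous_subspaceT; exact: continuous_affine.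
pose t := ((W.1 - p.1) * v1 + (W.2 - p.2) * v2) / (v1 ^+ 2 + v2 ^+ 2).
have tE : t * (v1 ^+ 2 + v2 ^+ 2) = (W.1 - p.1) * v1 + (W.2 - p.2) * v2.
  by rewrite divfK// gt_eqF.
have LW' : (W.1 - p.1) * v2 = (W.2 - p.2) * v1 by move: LW; rewrite /L/=; lra.
have W1 : W.1 = p.1 + t * v1.
  apply: (@mulfI _ (v1 ^+ 2 + v2 ^+ 2)); first by rewrite gt_eqF.
  have /= h1 := congr1 (fun r : R => r * v1) tE; have /= h2 := congr1 (fun r : R => r * v2) LW'.
  by lra.
have W2 : W.2 = p.2 + t * v2.
  apply: (@mulfI _ (v1 ^+ 2 + v2 ^+ 2)); first by rewrite gt_eqF.
  have /= h1 := congr1 (fun r : R => r * v2) tE; have /= h2 := congr1 (fun r : R => r * v1) LW'.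
  by lra.
have t1 : 1 <= t.
  have := hW q (mem_set (conj Kq Lq)) => /= h.
  rewrite -(@ler_pM2r _ (v1 ^+ 2 + v2 ^+ 2))// mul1r tE /v1 /v2; rewrite /v1 /v2 in h; lra.
(* Among the unit disks containing K, take one whose center is farthest from W. If that distance
   were below 1, a slightly later point of the ray would lie in all these disks, hence in K. *)
have [||c /set_mem hc hmax] := @compact_EVT_max _ R
     (fun c : R * R => d2 c W) [set c | forall z, K z -> d2 z c <= 1] _ compact_centers.
- by exists (ctr (x 0) 0) => z; exact: bodyS.
- by apply: continuous_subspaceT; exact: continuous_d2.
have cW : d2 W c = 1.
  apply/eqP; rewrite eq_le hc//= leNgt; apply/negP => hlt.
  pose B := v1 ^+ 2 + v2 ^+ 2; pose m := d2 W c; rewrite -/m in hlt.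
  (* Moving by ep (v1, v2) increases the squared distance to a center by at most ep (1 + B) + ep B,
     which is below 1 - m. *)
  pose ep := (1 - m) / (2 * (1 + B)).
  have B1 : 0 < 2 * (1 + B) by rewrite /B; lra.
  have epE : ep * (2 * (1 + B)) = 1 - m by rewrite divfK// gt_eqF.
  have m0 : 0 <= m by exact: d2_ge0.
  have ep0 : 0 < ep by rewrite divr_gt0//; lra.
  have ep1 : ep <= 1 by rewrite /ep ler_pdivrMr// /B; lra.
  pose W' : R * R := (W.1 + ep * v1, W.2 + ep * v2).
  have KW' : K W'.
    apply: body_mem_disks => e he.
    have h1 : d2 W e <= m by rewrite /m (d2C W e) (d2C W c); apply: hmax; exact: mem_set.
    have -> : d2 W' e = d2 W e + 2 * ep * ((W.1 - e.1) * v1 + (W.2 - e.2) * v2) + ep ^+ 2 * B.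
      by rewrite /d2 /W' /B/=; ring.
    have h2 : 2 * ((W.1 - e.1) * v1 + (W.2 - e.2) * v2) <= d2 W e + B.
      have := sqr_ge0 (W.1 - e.1 - v1); have := sqr_ge0 (W.2 - e.2 - v2).
      by rewrite /d2 /B; nra.
    have B0' : 0 < B by [].
    have h3 : ep ^+ 2 * B <= ep * B by rewrite expr2 -mulrA ler_piMl// mulr_ge0// ltW.
    have h4 : ep * (2 * ((W.1 - e.1) * v1 + (W.2 - e.2) * v2)) <= ep * (1 + B).
      by rewrite ler_wpM2l// ?(ltW ep0)//; lra.
    nra.
  have LW'' : L W' by rewrite /L /W'/=; lra.
  have := hW W' (mem_set (conj KW' LW'')); rewrite /W'/= -/B.
  have : 0 < ep * B by rewrite mulr_gt0.
  by rewrite /B; nra.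
have [s [hs h1 h2]] : exists s : R, [/\ 0 <= s < 0 + pi *+ 2, cos s = W.1 - c.1 & sin s = W.2 - c.2].
  by apply: argument; rewrite -/(d2 W c).
exists s, t; split=> //; rewrite -/v1 -/v2 -W1 -W2 -surjective_pairing.
apply: body_inj hK KW _ => y Ky; apply: supp_ge0; rewrite /supp.
have -> : ctr W s = c by rewrite /ctr h1 h2 !subKr -surjective_pairing.
exact: hc.
Qed.

Lemma disks_separate w y : (forall e, d2 w e <= 1 -> d2 y e <= 1) -> y = w.
Proof.
move=> h; apply/eqP/negPn/negP => yw.
have [l [s [l0 l2 _ e1 e2]]] := polar 0 yw.
have := h (ctr w s); rewrite -[d2 w _ <= 1]/(supp w s w) => /(_ (supp_self _ _)).
rewrite /d2/=.
have -> : y.1 - (w.1 - cos s) = (l + 1) * cos s by lra.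
have -> : y.2 - (w.2 - sin s) = (l + 1) * sin s by lra.
by rewrite !exprMn -mulrDr cos2Dsin2; nra.
Qed.

Section cfg.
Variables (k : nat) (s : nat -> R).
Hypothesis hc : cyc k s.
Lemma body_cfgk i : x (s (i + k)%N) = x (s i).
Proof. by have [_ _ ->] := hc; rewrite (body2pi hK). Qed.
Lemma body_cfgS i j : supp (x (s j)) (s j) (x (s i)).
Proof. by apply: (bodyS hK); exact: bodyP hK _. Qed.
Lemma body_cfg4 i j : d2 (x (s i)) (x (s j)) < 4.
Proof. by apply: (body4 hK); exact: bodyP hK _. Qed.
End cfg.

(* The vertices of the polygon are pushed radially to the boundary of K: all but
   one away from that one, which is then pushed away from one of the others. *)
Lemma polygon_outer (C : seq (R * R)) : (0 < size C)%N ->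
  (forall y, in_disks C y -> K y) -> (exists y z, [/\ in_disks C y, in_disks C z & y != z]) ->
  exists s, [/\ cyc (size C) s, exists i j, x (s i) != x (s j) &
    forall i y, in_disks C y -> d2 y (ecenter s (x \o s) i) <= 1].
Proof.
move=> C0 CK [y0 [z0 [hy0 hz0 yz0]]].
have C0' : C != [::] by rewrite -size_eq0 -lt0n.
have C4 y z : in_disks C y -> in_disks C z -> d2 y z < 4.
  by move=> hy hz; apply: (body4 hK); exact: CK.
have [Q [sQ QC Qhull]] := hull_points C0' (ex_intro _ y0 (ex_intro _ z0 (And3 hy0 hz0 yz0))) C4.
have Qne w : exists2 q, q \in Q & q != w.
  apply: contrapT => nh.
  have allw q : q \in Q -> q = w.
    by move=> qQ; apply/eqP/negPn/negP => h; apply: nh; exists q.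
  have hw y : in_disks C y -> y = w.
    move=> hy; apply: disks_separate => e he; apply: Qhull hy => q /allw ->//.
  by move: yz0; rewrite (hw _ hy0) (hw _ hz0) eqxx.
have [q1 q1Q _] := Qne 0.
have [q2 q2Q q21] := Qne q1.
have KQ q : q \in Q -> K q by move=> /QC/CK.
have hpush p q : exists s, K p -> K q -> p != q -> 0 <= s < 0 + pi *+ 2 /\
    (forall e, d2 p e <= 1 -> d2 (x s) e <= 1 -> d2 q e <= 1).
  have [[Kp Kq pq]|nh] := pselect [/\ K p, K q & p != q]; last first.
    by exists 0 => Kp Kq pq; exfalso; apply: nh.
  have [s [t [hs t1 hx]]] := exit_point Kp Kq pq; exists s => _ _ _; split=> // e he hxe.
  have t0 : t != 0 by rewrite gt_eqF//; lra.
  have := @d2_conv _ (x s) p e t^-1 _ hxe he; rewrite hx/=.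
  have -> : t^-1 * (p.1 + t * (q.1 - p.1)) + (1 - t^-1) * p.1 = q.1 by field.
  have -> : t^-1 * (p.2 + t * (q.2 - p.2)) + (1 - t^-1) * p.2 = q.2 by field.
  by rewrite -surjective_pairing; apply; rewrite invr_ge0 invf_le1; lra.
pose push_spec (pq : (R * R) * (R * R)) := [set s : R | K pq.1 -> K pq.2 ->
    pq.1 != pq.2 -> 0 <= s < 0 + pi *+ 2 /\
    (forall e, d2 pq.1 e <= 1 -> d2 (x s) e <= 1 -> d2 pq.2 e <= 1)].
pose push pq := xget 0 (push_spec pq).
have hp pq : push_spec pq (push pq).
  by apply: xgetPex; exact: hpush.
(* This is q2 pushed away from q1. Then q1 is pushed away from q2', so q1 lies between two boundary
   points. *)
pose q2' := x (push (q1, q2)).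
have q2'1 : q2' != q1.
  apply/eqP => e; move/eqP: (q21); apply; apply: disks_separate => e' he'.
  have q12 : q1 != q2 by rewrite eq_sym.
  have [_ h] := hp (q1, q2) (KQ _ q1Q) (KQ _ q2Q) q12.
  by apply: h => //=; rewrite -/q2' e.
pose sg q := if q == q1 then push (q2', q1) else push (q1, q).
have hsg q : q \in Q -> 0 <= sg q < 0 + pi *+ 2.
  move=> qQ; rewrite /sg; have [e|ne] := eqVneq q q1.
    by have [] := hp (q2', q1) (bodyP hK _) (KQ _ q1Q) q2'1.
  have nq : q1 != q by rewrite eq_sym.
  by have [] := hp (q1, q) (KQ _ q1Q) (KQ _ qQ) nq.
(* There may be fewer vertices than disks; repeating a direction pads the list to the required
   length. *)
pose l := sort <=%R (map sg Q ++ nseq (size C - size Q) (sg q1)).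
have sl : size l = size C by rewrite size_sort size_cat size_map size_nseq subnKC.
have lb : {in l, forall v, 0 <= v < 0 + pi *+ 2}.
  move=> v; rewrite mem_sort mem_cat => /orP[/mapP[q qQ ->]|/nseqP[-> _]]; exact: hsg.
have hc : cyc (size C) (lcyc l).
  rewrite -sl; apply: (@lcyc_cyc _ _ 0); rewrite ?sl//.
  by apply: sort_sorted => a b; exact: le_total.
(* A disk containing the pushed points contains q1, which lies between two of them, and then every
   other vertex, which lies between q1 and its own pushed point. *)
have Qx e : (forall i, d2 (x (lcyc l i)) e <= 1) -> forall q, q \in Q -> d2 q e <= 1.
  move=> he.
  have hsq q : q \in Q -> d2 (x (sg q)) e <= 1.
    move=> qQ; have : sg q \in l by rewrite mem_sort mem_cat map_f.
    move=> /(nthP 0)[i il <-].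
    by have := he i; rewrite /lcyc modn_small// divn_small// mul0r addr0.
  have h1 : d2 q1 e <= 1.
    have [_ h] := hp (q2', q1) (bodyP hK _) (KQ _ q1Q) q2'1; apply: h => /=.
      by have := hsq _ q2Q; rewrite /sg (negbTE q21).
    by have := hsq _ q1Q; rewrite /sg eqxx.
  move=> q qQ; have [->//|ne] := eqVneq q q1.
  have nq : q1 != q by rewrite eq_sym.
  have [_ h] := hp (q1, q) (KQ _ q1Q) (KQ _ qQ) nq.
  by apply: h => //=; have := hsq _ qQ; rewrite /sg (negbTE ne).
exists (lcyc l); split=> //.
  apply: contrapT => nh.
  have all0 i : x (lcyc l i) = x (lcyc l 0).
    by apply/eqP/negPn/negP => h; apply: nh; exists i, 0%N.
  have hw y : in_disks C y -> y = x (lcyc l 0).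
    move=> hy; apply: disks_separate => e he; apply: Qhull hy.
    by apply: Qx => i; rewrite all0.
  by move: yz0; rewrite (hw _ hy0) (hw _ hz0) eqxx.
move=> i y hy; apply: Qhull hy; apply: Qx => j.
exact: (cfg_in_edge_disks hc (body_cfgk hc) (body_cfgS _) (body_cfg4 _) i j).
Qed.

End push.

(** * The exchange inequality for arcs *)

Section chord_segment.
Context {R : realType}.
Implicit Types (r : R).

(* [seg r] is the area between a unit arc and its chord of squared length r. *)
Definition chs r : R := Num.sqrt (r * (4 - r)).
Definition seg r : R := asin (Num.sqrt r / 2) - chs r / 4.

Lemma chs_gt0 r : 0 < r < 4 -> 0 < chs r.
Proof. by move=> h; rewrite sqrtr_gt0 mulr_gt0; lra. Qed.

Lemma chs_sqr r : 0 <= r < 4 -> chs r ^+ 2 = r * (4 - r).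
Proof. by move=> h; rewrite sqr_sqrtr// mulr_ge0; lra. Qed.

Lemma is_derive_chs r : 0 < r < 4 -> is_derive r 1 chs ((2 - r) / chs r).
Proof.
move=> h; have S0 := chs_gt0 h.
have h1 : 0 < r * (4 - r) by rewrite mulr_gt0; lra.
have d1 : is_derive r 1 (fun r => r * (4 - r)) (4 - 2 * r).
  apply: is_derive_eq; rewrite /GRing.scale/=; ring.
have := @is_derive1_comp R Num.sqrt (fun r => r * (4 - r)) r _ _ (is_derive1_sqrt h1) d1.
move=> d2; apply: (is_derive_eq d2).
rewrite -/(chs r); field; rewrite gt_eqF//.
Qed.

Lemma is_derive_seg r : 0 < r < 4 -> is_derive r 1 seg (r / (4 * chs r)).
Proof.
move=> h; have S0 := chs_gt0 h; have h0 : 0 < r by lra.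
have s0 : 0 < Num.sqrt r by rewrite sqrtr_gt0.
have s2 : Num.sqrt r ^+ 2 = r by rewrite sqr_sqrtr// ltW.
have h1 : -1 < Num.sqrt r / 2 < 1 by apply/andP; split; nra.
have d1 : is_derive r 1 (fun r => Num.sqrt r / 2) (4 * Num.sqrt r)^-1.
  have d0 := is_derive1_sqrt h0.
  apply: is_derive_eq; rewrite /GRing.scale/=; field; rewrite gt_eqF//.
have d2 := @is_derive1_comp R asin (fun r => Num.sqrt r / 2) r _ _ (is_derive1_asin h1) d1.
have d3 := is_derive_chs h.
have d4 : is_derive r 1 (fun r => chs r / 4) ((2 - r) / (4 * chs r)).
  apply: is_derive_eq; rewrite /GRing.scale/=; field; rewrite gt_eqF//.
have e : Num.sqrt (1 - (Num.sqrt r / 2) ^+ 2) = chs r / (2 * Num.sqrt r).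
  apply/eqP; rewrite -(@eqrXn2 _ 2)// ?sqrtr_ge0 ?divr_ge0 ?mulr_ge0 ?sqrtr_ge0//.
  rewrite sqr_sqrtr; last by rewrite expr_div_n s2; lra.
  by rewrite !expr_div_n exprMn s2 chs_sqr ?(ltW h0)//; [apply/eqP; field; rewrite gt_eqF|lra].
apply: (is_derive_eq (is_deriveB d2 d4)).
by rewrite /= e; field; rewrite !gt_eqF.
Qed.

Lemma continuous_seg r : r < 4 -> {for r, continuous seg}.
Proof.
move=> h; apply: cvgB.
  have h1 : -1 < Num.sqrt r / 2 < 1.
    have s0 := sqrtr_ge0 r; apply/andP; split; first by lra.
    have [r0|r0] := leP r 0; first by rewrite ler0_sqrtr//; lra.
    by have : Num.sqrt r ^+ 2 = r by [rewrite sqr_sqrtr// ltW]; nra.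
  apply: (@continuous_comp _ _ _ (fun r => Num.sqrt r / 2) asin).
    by apply: cvgMl; exact: sqrt_continuous.
  exact: continuous_asin.
apply: cvgMl; apply: (@continuous_comp _ _ _ (fun r : R => r * (4 - r)) Num.sqrt).
  by apply: cvgM; [exact: cvg_id|apply: cvgB; [exact: cvg_cst|exact: cvg_id]].
exact: sqrt_continuous.
Qed.

(* The sign of the mixed second derivative of the area cut off by an arc, in
   terms of half the central angle of the arc (s, c) and of the angles M, N
   between its chord and the directions in which its ends move. *)
Lemma mixed_derivative_sign (s c sM cM sN cN : R) : 0 < s -> 0 < c ->
  s ^+ 2 + c ^+ 2 = 1 -> sM ^+ 2 + cM ^+ 2 = 1 -> sN ^+ 2 + cN ^+ 2 = 1 ->
  s <= sM -> s <= sN -> 0 <= sM * cN + cM * sN ->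
  s * cM * cN + s * c ^+ 2 * (cM * cN - sM * sN) <= c ^+ 3 * (sM * cN + cM * sN).
Proof.
move=> s0 c0 sc hM hN sM0 sN0 h.
have [hneg|hpos] := leP (cM * cN) 0.
  have h1 : 0 <= c ^+ 3 * (sM * cN + cM * sN) by rewrite mulr_ge0// exprn_ge0// ltW.
  have h2 : 0 <= sM * sN by rewrite mulr_ge0; lra.
  have h3 : s * (cM * cN) <= 0 by rewrite pmulr_rle0.
  have h4 : s * c ^+ 2 * (cM * cN - sM * sN) <= 0.
    by rewrite pmulr_rle0 ?mulr_gt0 ?exprn_gt0//; lra.
  lra.
have cMN : 0 < cM /\ 0 < cN.
  have [cM0|cM0] := ltP 0 cM; first by split=> //; rewrite -(pmulr_rgt0 _ cM0).
  have cM1 : cM < 0 by rewrite lt_neqAle cM0 andbT; apply/eqP => e; move: hpos; rewrite e mul0r ltxx.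
  have cN1 : cN < 0 by move: hpos; rewrite nmulr_rgt0.
  exfalso; have : sM * cN < 0 by rewrite pmulr_rlt0//; lra.
  have : cM * sN < 0 by rewrite nmulr_rlt0//; lra.
  lra.
have [cM0 cN0] := cMN.
have cMc : cM <= c by nra.
have cNc : cN <= c by nra.
have e1 : s * cM <= c * sM by rewrite (mulrC c); apply: ler_pM => //; apply: ltW.
have e2 : s * cN <= c * sN by rewrite (mulrC c); apply: ler_pM => //; apply: ltW.
(* By [e3] and [e4] the right side of the goal is at least 2 c^2 s cM cN. As 1 - c^2 = s^2, what
   remains is s^2 cM cN <= c^2 sM sN, which is [e7]. *)
have e3 : c ^+ 2 * (s * cM * cN) <= c ^+ 3 * (sM * cN).
  rewrite (_ : c ^+ 3 * _ = c ^+ 2 * (c * sM * cN)); last by ring.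
  by rewrite ler_wpM2l ?sqr_ge0// ler_wpM2r// ltW.
have e4 : c ^+ 2 * (s * cM * cN) <= c ^+ 3 * (cM * sN).
  rewrite (_ : c ^+ 3 * _ = c ^+ 2 * (c * sN * cM)); last by ring.
  by rewrite ler_wpM2l ?sqr_ge0// mulrAC ler_wpM2r// ltW.
have e5 : s ^+ 2 <= sM * sN by rewrite expr2; apply: ler_pM => //; apply: ltW.
have e6 : cM * cN <= c ^+ 2 by rewrite expr2; apply: ler_pM => //; apply: ltW.
have e7 : 0 <= s * (c ^+ 2 * (sM * sN) - s ^+ 2 * (cM * cN)).
  rewrite mulr_ge0 ?(ltW s0)// subr_ge0.
  apply: (@le_trans _ _ (s ^+ 2 * c ^+ 2)); first by rewrite ler_wpM2l// sqr_ge0.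
  by rewrite mulrC ler_wpM2l// sqr_ge0.
have e8 : s ^+ 2 = 1 - c ^+ 2 by lra.
rewrite e8 in e7.
nra.
Qed.

End chord_segment.

Section exchange.
Context {R : realType}.
Implicit Types (p q o : R * R) (s t : R).

(* The signed area between the origin, the chord from p to q and the unit arc on it. *)
Definition wt p q : R := (p.1 * q.2 - p.2 * q.1) / 2 + seg (d2 p q).

Definition dr p o t : R := 2 * (p.1 - (o.1 + cos t)) * sin t - 2 * (p.2 - (o.2 + sin t)) * cos t.

Lemma is_derive_d2 p o t : is_derive t 1 (fun t => d2 p (pt o t)) (dr p o t).
Proof. by rewrite /d2/=; apply: is_derive_eq; rewrite /dr /GRing.scale/=; ring. Qed.

Lemma is_derive_d2l p o t : is_derive t 1 (fun t => d2 (pt o t) p) (dr p o t).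
Proof. by rewrite /d2/=; apply: is_derive_eq; rewrite /dr /GRing.scale/=; ring. Qed.

Definition dwt p o t : R := (p.1 * cos t + p.2 * sin t) / 2 +
  d2 p (pt o t) / (4 * chs (d2 p (pt o t))) * dr p o t.

Lemma is_derive_wt p o t : 0 < d2 p (pt o t) < 4 ->
  is_derive t 1 (fun t => wt p (pt o t)) (dwt p o t).
Proof.
move=> h; have h1 := is_derive_seg h.
have h2 := @is_derive1_comp R seg (fun t => d2 p (pt o t)) t _ _ h1 (is_derive_d2 p o t).
have h3 : is_derive t 1 (fun t => (p.1 * (o.2 + sin t) - p.2 * (o.1 + cos t)) / 2)
   ((p.1 * cos t + p.2 * sin t) / 2).
  by apply: is_derive_eq; rewrite /GRing.scale/=; ring.
exact: (is_deriveD h3 h2).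
Qed.

Definition ddwt o o' s t : R := sin (t - s) / 2 +
  d2 (pt o s) (pt o' t) / (2 * chs (d2 (pt o s) (pt o' t)) ^+ 3) *
    dr (pt o' t) o s * dr (pt o s) o' t -
  d2 (pt o s) (pt o' t) / (2 * chs (d2 (pt o s) (pt o' t))) * cos (t - s).

Lemma is_derive_dwt o o' s t : 0 < d2 (pt o s) (pt o' t) < 4 ->
  is_derive s 1 (fun s => dwt (pt o s) o' t) (ddwt o o' s t).
Proof.
move=> h; have S0 := chs_gt0 h; set r := d2 (pt o s) (pt o' t) in h S0 *.
have h1 : is_derive r 1 (fun r => r / (4 * chs r)) (r / (2 * chs r ^+ 3)).
  have dS := is_derive_chs h.
  have dS4 : is_derive r 1 (fun r => 4 * chs r) (4 * ((2 - r) / chs r)).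
    by apply: is_derive_eq; rewrite /GRing.scale/=; ring.
  have n4 : 4 * chs r != 0 by rewrite gt_eqF// mulr_gt0.
  have dV := @is_deriveV _ (fun r : R => 4 * chs r) r _ _ n4 dS4.
  apply: (is_derive_eq (is_deriveM (is_derive_id r 1) dV)).
  have S2 : chs r ^+ 2 = r * (4 - r) by rewrite chs_sqr//; lra.
  rewrite /GRing.scale/=.
  have -> : r / (2 * chs r ^+ 3) = (chs r ^+ 2 - r * (2 - r)) / (4 * chs r ^+ 3).
    by rewrite S2; field; rewrite gt_eqF.
  by field; rewrite gt_eqF.
have h2 := @is_derive1_comp R (fun r => r / (4 * chs r)) (fun s => d2 (pt o s) (pt o' t)) s _ _
  h1 (is_derive_d2l (pt o' t) o s).
have h3 : is_derive s 1 (fun s => dr (pt o s) o' t) (- 2 * cos (t - s)).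
  by rewrite /dr/=; apply: is_derive_eq; rewrite /GRing.scale/= cosB; ring.
have h4 : is_derive s 1 (fun s => ((pt o s).1 * cos t + (pt o s).2 * sin t) / 2) (sin (t - s) / 2).
  by rewrite /=; apply: is_derive_eq; rewrite /GRing.scale/= sinB; ring.
apply: (is_derive_eq (is_deriveD h4 (is_deriveM h2 h3))).
by rewrite /ddwt /GRing.scale/= -/r; field; rewrite gt_eqF.
Qed.

(** Here f and g are the sine and cosine of half the central angle, and A, X and B, Y the normal and
    tangential components of the chord at its ends. Divided by the chord length 2 f they are the
    sines and cosines in [mixed_derivative_sign]; the two disk conditions say that both sines are at
    least f. *)
Lemma ddwt_ge0 o o' s t : 0 < d2 (pt o s) (pt o' t) < 4 ->
  d2 (pt o' t) o <= 1 -> d2 (pt o s) o' <= 1 -> 0 <= sin (t - s) ->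
  0 <= ddwt o o' s t.
Proof.
move=> h; have S0 := chs_gt0 h.
rewrite -(supp_pt o s) -(supp_pt o' t) => /suppE + /suppE; rewrite d2C.
set r := d2 (pt o s) (pt o' t) in h S0 *.
pose f := Num.sqrt r / 2; pose g := Num.sqrt (4 - r) / 2.
have r0 : 0 < r by lra.
have f2 : r = 4 * f ^+ 2 by rewrite /f expr_div_n sqr_sqrtr ?ltW//; field.
have g2 : 4 - r = 4 * g ^+ 2 by rewrite /g expr_div_n sqr_sqrtr; [field|lra].
have f0 : 0 < f by rewrite divr_gt0// sqrtr_gt0.
have g0 : 0 < g by rewrite divr_gt0// sqrtr_gt0; lra.
have SE : chs r = 4 * f * g.
  rewrite /chs g2 f2 (_ : 4 * f ^+ 2 * _ = (4 * f * g) ^+ 2); last by ring.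
  have fg0 : 0 < f * g by exact: mulr_gt0.
  rewrite sqrtr_sqr gtr0_norm//; lra.
pose A := hd s (pt o s) (pt o' t); pose B := hd t (pt o' t) (pt o s).
rewrite -/A -/B => hA hB.
pose X := dr (pt o' t) o s / 2; pose Y := dr (pt o s) o' t / 2.
have fg : f ^+ 2 + g ^+ 2 = 1 by lra.
have cs := cos2Dsin2 s; have ct := cos2Dsin2 t.
have eAX : A ^+ 2 + X ^+ 2 = r.
  transitivity (r * (cos s ^+ 2 + sin s ^+ 2)); last by rewrite cs mulr1.
  by rewrite /A /X /r /hd /dr /d2/=; field.
have eBY : B ^+ 2 + Y ^+ 2 = r.
  transitivity (r * (cos t ^+ 2 + sin t ^+ 2)); last by rewrite ct mulr1.
  by rewrite /B /Y /r /hd /dr /d2/=; field.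
have es : A * Y + - X * B = r * sin (t - s).
  by rewrite /A /B /X /Y /r /hd /dr /d2 sinB/=; field.
have ec : - X * Y - A * B = r * cos (t - s).
  by rewrite /A /B /X /Y /r /hd /dr /d2 cosB/=; field.
move=> hs.
have fn : f != 0 by rewrite gt_eqF.
have gn : g != 0 by rewrite gt_eqF.
have sE : sin (t - s) = (A / (2 * f)) * (Y / (2 * f)) + (- X / (2 * f)) * (B / (2 * f)).
  apply: (@mulfI _ r); first by rewrite gt_eqF.
  by rewrite -es f2; field.
have cE : cos (t - s) = (- X / (2 * f)) * (Y / (2 * f)) - (A / (2 * f)) * (B / (2 * f)).
  apply: (@mulfI _ r); first by rewrite gt_eqF.
  by rewrite -ec f2; field.
have := @mixed_derivative_sign _ f g (A / (2 * f)) (- X / (2 * f)) (B / (2 * f)) (Y / (2 * f)) f0 g0 fg.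
rewrite -sE -cE => key.
have {key}key : f * (- X / (2 * f)) * (Y / (2 * f)) + f * g ^+ 2 * cos (t - s) <=
       g ^+ 3 * sin (t - s).
  apply: key => //.
  - by rewrite !expr_div_n -mulrDl sqrrN eAX f2; field.
  - by rewrite (expr_div_n B) (expr_div_n Y) -mulrDl eBY f2; field.
  - by rewrite ler_pdivlMr; nra.
  - by rewrite ler_pdivlMr; nra.
have -> : ddwt o o' s t = (2 * g ^+ 3)^-1 *
    (g ^+ 3 * sin (t - s) - (f * (- X / (2 * f)) * (Y / (2 * f)) + f * g ^+ 2 * cos (t - s))).
  rewrite /ddwt -/r.
  have -> : dr (pt o' t) o s = 2 * X by rewrite /X; field.
  have -> : dr (pt o s) o' t = 2 * Y by rewrite /Y; field.
  by rewrite SE f2; field; rewrite fn gn.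
rewrite mulr_ge0 ?subr_ge0// invr_ge0 mulr_ge0// exprn_ge0// ltW//.
Qed.

Lemma is_derive_continuous (f : R -> R) (x df : R) :
  is_derive x 1 f df -> {for x, continuous f}.
Proof. by case=> /derivable1_diffP h _; exact: differentiable_continuous. Qed.

Lemma continuous_wt p o t : d2 p (pt o t) < 4 ->
  {for t, continuous (fun t => wt p (pt o t))}.
Proof.
move=> h.
apply: cvgD.
  have h3 : is_derive t 1 (fun t => (p.1 * (o.2 + sin t) - p.2 * (o.1 + cos t)) / 2)
     ((p.1 * cos t + p.2 * sin t) / 2).
    by apply: is_derive_eq; rewrite /GRing.scale/=; ring.
  exact: (is_derive_continuous h3).
apply: (@continuous_comp _ _ _ (fun t => d2 p (pt o t)) seg).
  exact: (is_derive_continuous (is_derive_d2 p o t)).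
exact: continuous_seg.
Qed.

(** If the points coincided, the point of normal t1 would be o + u(s) + u(t1) - u(t). Its squared
    distance to o is 1 + |u(t1) - u(t)|^2 + 2 (cos (t1 - s) - cos (t - s)) > 1. *)
Lemma arcs_apart o o' s t1 t : s <= t1 -> t1 < t -> t <= s + pi ->
  d2 (pt o' t1) o <= 1 -> 0 < d2 (pt o s) (pt o' t).
Proof.
move=> st1 t1t ts h; rewrite d2_gt0; apply/eqP => e.
have : cos (t - s) < cos (t1 - s) by rewrite ltr_cos ?in_itv/=; lra.
move: h e; rewrite /d2 /pt/= !cosB => h [e1 e2].
have E1 : o'.1 + cos t1 - o.1 = cos s + cos t1 - cos t by lra.
have E2 : o'.2 + sin t1 - o.2 = sin s + sin t1 - sin t by lra.
move: h; rewrite E1 E2.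
have := sqr_ge0 (cos t1 - cos t); have := sqr_ge0 (sin t1 - sin t).
have := cos2Dsin2 s.
nra.
Qed.

Lemma wt_exchange o o' s1 s2 t1 t2 :
  s1 <= s2 -> s2 <= t1 -> t1 <= t2 -> t2 <= s1 + pi ->
  s2 < s1 + pi -> t2 < t1 + pi ->
  d2 (pt o s1) o' <= 1 -> d2 (pt o s2) o' <= 1 ->
  d2 (pt o' t1) o <= 1 -> d2 (pt o' t2) o <= 1 ->
  (forall s t, s1 <= s <= s2 -> t1 <= t <= t2 -> d2 (pt o s) (pt o' t) < 4) ->
  wt (pt o s1) (pt o' t2) + wt (pt o s2) (pt o' t1) <=
  wt (pt o s1) (pt o' t1) + wt (pt o s2) (pt o' t2).
Proof.
move=> s12 s2t1 t12 t2s1 s21 t21 ha hb hc hd h4.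
have [->|tne] := eqVneq t1 t2; first by rewrite lexx.
have lt12 : t1 < t2 by rewrite lt_neqAle tne.
have pos s t : s1 <= s <= s2 -> t1 < t <= t2 -> 0 < d2 (pt o s) (pt o' t) < 4.
  move=> /andP[h1 h2] /andP[h3 h5]; rewrite h4 ?andbT; try lra.
  by apply: (@arcs_apart _ _ _ t1) => //; lra.
have hs s : s1 <= s <= s2 -> d2 (pt o s) o' <= 1.
  by move=> /andP[h1 h2]; exact: (arc_in h1 h2 s21 ha hb).
have ht t : t1 <= t <= t2 -> d2 (pt o' t) o <= 1.
  by move=> /andP[h1 h2]; exact: (arc_in h1 h2 t21 hc hd).
have mono t : t1 < t < t2 -> dwt (pt o s1) o' t <= dwt (pt o s2) o' t.
  move=> htt; have [->//|sne] := eqVneq s1 s2.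
  have lts : s1 < s2 by rewrite lt_neqAle sne.
  have der s : s1 <= s <= s2 -> is_derive s 1 (fun s => dwt (pt o s) o' t) (ddwt o o' s t).
    by move=> hss; apply: is_derive_dwt; apply: pos => //; lra.
  have [||s hss] := @MVT R (fun s => dwt (pt o s) o' t) (fun s => ddwt o o' s t) s1 s2 lts.
  - by move=> s; rewrite in_itv/= => hss; apply: der; lra.
  - apply: continuous_in_subspaceT => s /set_mem; rewrite /= in_itv/= => hss.
    exact: (is_derive_continuous (der _ hss)).
  rewrite in_itv/= in hss => e; rewrite -subr_ge0 e mulr_ge0//; last by lra.
  have hss' : s1 <= s <= s2 by lra.
  have htt' : t1 <= t <= t2 by lra.
  apply: ddwt_ge0; [by apply: pos => //; lra|exact: ht|exact: hs|].
  by apply: sin_ge0_pi; lra.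
have ps1 : s1 <= s1 <= s2 by lra.
have ps2 : s1 <= s2 <= s2 by lra.
have [||t htt] := @MVT R (fun t => wt (pt o s2) (pt o' t) - wt (pt o s1) (pt o' t))
  (fun t => dwt (pt o s2) o' t - dwt (pt o s1) o' t) t1 t2 lt12.
- move=> t; rewrite in_itv/= => htt; have htt' : t1 < t <= t2 by lra.
  exact: (is_deriveB (is_derive_wt (pos _ _ ps2 htt')) (is_derive_wt (pos _ _ ps1 htt'))).
- apply: continuous_in_subspaceT => t /set_mem; rewrite /= in_itv/= => htt.
  by apply: cvgB; apply: continuous_wt; apply: h4.
rewrite in_itv/= in htt => e.
have : 0 <= (dwt (pt o s2) o' t - dwt (pt o s1) o' t) * (t2 - t1).
  by rewrite mulr_ge0// subr_ge0; [exact: mono|lra].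
by rewrite -e; lra.
Qed.

End exchange.

(** * Planar area *)

Section planar_measure.
Context {R : realType}.
Notation mu := (@lebesgue_measure R).

Lemma lebesgue_measure_translation (c : R) (A : set R) : measurable A ->
  mu ((fun x => x + c) @^-1` A) = mu A.
Proof.
move=> mA; have mf : measurable_fun setT ((fun x : R => x + c) : measurableTypeR R -> measurableTypeR R).
  exact: measurable_funD.
pose m := measure_function_pushforward__canonical__measure_function_Measure mu mf.
apply/esym; apply: (@lebesgue_measure_unique R m) => // _ [[a b]] _ <-.
rewrite /m/= /pushforward.
have -> : (fun x : R => x + c) @^-1` `]a, b]%classic = `]a - c, b - c]%classic.
  by apply/seteqP; split=> x /=; rewrite !in_itv/= ltrBlDr lerBrDr.
by rewrite !lebesgue_measure_itv/= !lte_fin ltrD2r -!EFinB opprD opprK addrACA addNr addr0.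
Qed.

(** An open set is a countable union of rational boxes, which are measurable in the product
    sigma-algebra. *)
Lemma open_measurable2 (A : set (R * R)) : open A -> measurable A.
Proof.
move=> oA.
pose B (q : (rat * rat) * (rat * rat)) : set (R * R) :=
  `]ratr q.1.1, ratr q.1.2[%classic `*` `]ratr q.2.1, ratr q.2.2[%classic.
have -> : A = \bigcup_q (if `[< B q `<=` A >] then B q else set0).
  apply/seteqP; split; last by move=> x [q _]; case: asboolP => // h /h.
  move=> [x y] Axy.
  have /nbhs_ballP[e /= e0 he] : nbhs (x, y) A by exact: open_nbhs_nbhs.
  have rat_between (z : R) : exists q1 q2 : rat, [/\ z - e < ratr q1, ratr q1 < z, z < ratr q2 & ratr q2 < z + e].
    have h1 : z - e < z by lra.
    have h2 : z < z + e by lra.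
    have [q1 /[!in_itv]/= /andP[h3 h4]] := rat_in_itvoo h1.
    have [q2 /[!in_itv]/= /andP[h5 h6]] := rat_in_itvoo h2.
    by exists q1, q2.
  have [a [b [a1 a2 b1 b2]]] := rat_between x.
  have [c [d [c1 c2 d1 d2]]] := rat_between y.
  exists ((a, b), (c, d)) => //; case: asboolP => [_|[]].
    by split; rewrite /= in_itv/= ?a2 ?b1 ?c2 ?d1.
  move=> [u v] [/=]; rewrite !in_itv/= => /andP[u1 u2] /andP[v1 v2]; apply: he; split; rewrite /ball/= ltr_norml; lra.
apply: countable_bigcupT_measurable => [|q]; first exact: countableP.
case: ifP => _; last exact: measurable0.
by apply: measurableX; exact: measurable_itv.
Qed.

Lemma closed_measurable2 (A : set (R * R)) : closed A -> measurable A.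
Proof. by move=> cA; rewrite -[A]setCK; apply: measurableC; apply: open_measurable2; exact: closed_openC. Qed.

Notation T2 := (measurableTypeR R * measurableTypeR R)%type.

Definition pmeas (A : set (R * R)) : Prop := measurable (A : set T2).

Let pm : {measure set T2 -> \bar R} := (mu \x mu)%E.
Let areaE A : area A = pm A. Proof. by []. Qed.

Lemma closed_pmeas (A : set (R * R)) : closed A -> pmeas A.
Proof. exact: closed_measurable2. Qed.

Lemma pmeasD (A B : set (R * R)) : pmeas A -> pmeas B -> pmeas (A `\` B).
Proof. exact: measurableD. Qed.

Lemma pmeasI (A B : set (R * R)) : pmeas A -> pmeas B -> pmeas (A `&` B).
Proof. exact: measurableI. Qed.

Lemma pmeasU (A B : set (R * R)) : pmeas A -> pmeas B -> pmeas (A `|` B).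
Proof. exact: measurableU. Qed.

Lemma area_ge0 (A : set (R * R)) : (0 <= area A)%E.
Proof. by rewrite areaE measure_ge0. Qed.

Lemma area0 : area (set0 : set (R * R)) = 0%E.
Proof. by rewrite areaE measure0. Qed.

Lemma le_area (A B : set (R * R)) : pmeas A -> pmeas B -> A `<=` B -> (area A <= area B)%E.
Proof. by move=> mA mB AB; rewrite !areaE; apply: le_measure => //; rewrite inE. Qed.

Lemma areaU (A B : set (R * R)) : pmeas A -> pmeas B -> A `&` B = set0 ->
  area (A `|` B) = (area A + area B)%E.
Proof. by move=> mA mB AB; rewrite !areaE measureU. Qed.

Lemma areaU_le (A B : set (R * R)) : pmeas A -> pmeas B ->
  (area (A `|` B) <= area A + area B)%E.
Proof. by move=> mA mB; rewrite !areaE; exact: measureU2. Qed.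

Lemma area_bounded (A : set (R * R)) (M : R) : pmeas A ->
  (forall p, A p -> -M <= p.1 <= M /\ -M <= p.2 <= M) -> (area A < +oo)%E.
Proof.
move=> mA h; pose I : set R := `[- M, M]%classic.
have mI : measurable I by exact: measurable_itv.
apply: (@le_lt_trans _ _ (area (I `*` I))).
  by apply: le_area => //; exact: measurableX.
have -> : area (I `*` I) = (mu I * mu I)%E by exact: product_measure1E.
rewrite /I lebesgue_measure_itv/=; case: ifP => _; last by rewrite mule0 ltry.
by rewrite -EFinD -EFinM ltry.
Qed.

Lemma measurable_affine (a b c : R) :
  measurable_fun setT (fun p : T2 => a * p.1 + b * p.2 + c : measurableTypeR R).
Proof.
apply: measurable_funD; last exact: measurable_cst.
by apply: measurable_funD; apply: measurable_funM; try exact: measurable_cst;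
  [exact: measurable_fst|exact: measurable_snd].
Qed.

Lemma pmeas_affine (a b c a' b' c' : R) (A : set (R * R)) : pmeas A ->
  pmeas ((fun p => (a * p.1 + b * p.2 + c, a' * p.1 + b' * p.2 + c')) @^-1` A).
Proof.
move=> mA; have := @measurable_fun_pair _ _ _ T2 (measurableTypeR R) (measurableTypeR R)
  _ _ (measurable_affine a b c) (measurable_affine a' b' c').
by move=> /(_ measurableT A mA); rewrite setTI.
Qed.

(** A shear translates every vertical slice. *)
Lemma area_vshear (k c : R) (A : set (R * R)) : pmeas A ->
  area ((fun p => (p.1, k * p.1 + p.2 + c)) @^-1` A) = area A.
Proof.
move=> mA; rewrite /area /product_measure1; apply: eq_integral => x _ /=.
rewrite -[RHS](lebesgue_measure_translation (k * x + c)); last exact: measurable_xsection.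
congr (mu _); apply/seteqP; split=> y; rewrite /xsection /= !inE /=.
  by rewrite addrCA addrA.
by rewrite addrCA addrA.
Qed.

Lemma area_fubini (A : set (R * R)) : pmeas A ->
  area A = (\int[mu]_y mu (ysection A y))%E.
Proof.
move=> mA; apply: (@product_measure_unique _ _ _ _ _ mu mu (mu \x^ mu)%E) => // B C mB mC.
exact: product_measure2E.
Qed.

Lemma area_hshear (k c : R) (A : set (R * R)) : pmeas A ->
  area ((fun p => (p.1 + k * p.2 + c, p.2)) @^-1` A) = area A.
Proof.
move=> mA; rewrite [RHS](area_fubini mA) area_fubini; last first.
  have := pmeas_affine 1 k c 0 1 0 mA; congr pmeas; apply/seteqP; split=> p /=;
  by rewrite !mul1r mul0r add0r addr0.
apply: eq_integral => y _ /=.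
rewrite -[RHS](lebesgue_measure_translation (k * y + c)); last exact: measurable_ysection.
by congr (mu _); apply/seteqP; split=> x; rewrite /ysection /= !inE /= addrA.
Qed.

Lemma area_slices (A : set (R * R)) : area A = (\int[mu]_x mu (xsection A x))%E.
Proof. by []. Qed.

Lemma area_singleton (p : R * R) : area [set p] = 0%E.
Proof.
have -> : [set p] = [set p.1] `*` [set p.2].
  apply/seteqP; split=> [w ->//|w [/= h1 h2]].
  by rewrite (surjective_pairing w) h1 h2 -surjective_pairing.
by rewrite /area product_measure1E//= lebesgue_measure_set1 mul0e.
Qed.

End planar_measure.

#[local] Opaque area.

(** * Invariance of area under rigid motions *)

Section rigid_motions.
Context {R : realType}.

Definition rot (t : R) (p : R * R) : R * R :=
  (cos t * p.1 - sin t * p.2, sin t * p.1 + cos t * p.2).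

Lemma pmeas_rot t (A : set (R * R)) : pmeas A -> pmeas (rot t @^-1` A).
Proof.
move=> mA; have := pmeas_affine (cos t) (- sin t) 0 (sin t) (cos t) 0 mA.
by congr pmeas; apply/seteqP; split=> p /=; rewrite !addr0 mulNr.
Qed.

(** A rotation with nonzero sine is a product of three shears with factors k, sin s and k, where k =
    - tan (s / 2). The identity is trivial, and the half turn is two quarter turns. *)
Lemma area_rot t (A : set (R * R)) : pmeas A -> area (rot t @^-1` A) = area A.
Proof.
have main s B : sin s != 0 -> pmeas B -> area (rot s @^-1` B) = area B.
  move=> sn mB; pose k := (cos s - 1) / sin s.
  have mB1 : pmeas ((fun p => (p.1 + k * p.2 + 0, p.2)) @^-1` B).
    have := pmeas_affine 1 k 0 0 1 0 mB; congr pmeas; apply/seteqP; split=> p /=;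
    by rewrite !mul1r mul0r add0r !addr0.
  have mB2 : pmeas ((fun p => (p.1, sin s * p.1 + p.2 + 0)) @^-1`
      ((fun p => (p.1 + k * p.2 + 0, p.2)) @^-1` B)).
    have := pmeas_affine 1 0 0 (sin s) 1 0 mB1; congr pmeas; apply/seteqP; split=> p /=;
    by rewrite !mul1r mul0r !addr0.
  have kE : k * sin s = cos s - 1 by rewrite /k divfK.
  have kE2 : k * (1 + cos s) = - sin s.
    apply: (@mulIf _ (sin s)) => //; rewrite mulrAC kE.
    by have := cos2Dsin2 s; lra.
  rewrite -[RHS](area_hshear k 0 mB) -[RHS](area_vshear (sin s) 0 mB1) -[RHS](area_hshear k 0 mB2).
  congr area; apply/seteqP.
  have E p : rot s p = (p.1 + k * p.2 + 0 + k * (sin s * (p.1 + k * p.2 + 0) + p.2 + 0) + 0,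
      sin s * (p.1 + k * p.2 + 0) + p.2 + 0).
    rewrite /rot; congr (_, _); last first.
      have := congr1 (fun r : R => r * p.2) kE; lra.
    have := congr1 (fun r : R => r * p.2) kE2.
    have := congr1 (fun r : R => r * p.1) kE.
    have := congr1 (fun r : R => r * (k * p.2)) kE.
    lra.
  by split=> p /=; rewrite -E.
move=> mA; have [s0|sn] := eqVneq (sin t) 0; last exact: main.
have c1 : cos t ^+ 2 == 1 by have := cos2Dsin2 t; rewrite s0 expr0n/= addr0 => ->.
move: c1; rewrite sqrf_eq1 => /orP[]/eqP ct.
  congr area; apply/seteqP; split=> p /=; rewrite /rot s0 ct !mul0r !mul1r subr0 add0r;
  by rewrite -surjective_pairing.
have sp : sin (pi / 2) != 0 :> R by rewrite sin_pihalf oner_neq0.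
rewrite -[RHS](main (pi / 2) _ sp mA) -[RHS](main (pi / 2) _ sp (pmeas_rot _ mA)).
by congr area; apply/seteqP; split=> p /=; rewrite /rot/= s0 ct sin_pihalf cos_pihalf
  !mul0r !mul1r !subr0 ?sub0r ?addr0 ?add0r !mulN1r.
Qed.

Lemma pmeas_translation (a b : R) (A : set (R * R)) : pmeas A ->
  pmeas ((fun p => (p.1 + a, p.2 + b)) @^-1` A).
Proof.
move=> mA; have := pmeas_affine 1 0 a 0 1 b mA; congr pmeas; apply/seteqP; split=> p /=;
by rewrite !mul1r !mul0r add0r addr0.
Qed.

Lemma area_translation (a b : R) (A : set (R * R)) : pmeas A ->
  area ((fun p => (p.1 + a, p.2 + b)) @^-1` A) = area A.
Proof.
move=> mA.
rewrite -[RHS](area_hshear 0 a mA) -[RHS](area_vshear 0 b).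
  by congr area; apply/seteqP; split=> p /=; rewrite !mul0r add0r addr0.
have := pmeas_translation a 0 mA; congr pmeas; apply/seteqP; split=> p /=;
by rewrite !mul0r !addr0.
Qed.

End rigid_motions.

(** * Caps cut off by disks *)

#[local] Opaque area.

Section caps.
Context {R : realType}.

Definition ar (A : set (R * R)) : R := fine (area A).

(* If x s = x t, the arc of directions from s to t belongs to one point of K when
   it is at most pi; otherwise no disk polygon in K corresponds to it. *)
Definition cap_area (K : set (R * R)) (x : R -> R * R) (s t : R) : R :=
  if x s == x t then if t - s <= pi then 0 else ar K
  else ar (K `\` disk_at (ectr (x s) (x t))).

Lemma pmeas_disk (c : R * R) : pmeas (disk_at c).
Proof. by apply: closed_pmeas; exact: disk_at_closed. Qed.

Lemma pmeas_compact (K : set (R * R)) : compact K -> pmeas K.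
Proof. by move=> Kc; apply: closed_pmeas; apply: compact_closed => //; exact: norm_hausdorff. Qed.

Lemma disk_polygon_set0 m : (1 < m)%N -> disk_polygon m (set0 : set (R * R)).
Proof.
move=> m1; exists (fun i : 'I_m => if (i : nat) == 0%N then (0, 0) else (3, 0)).
apply/esym/seteqP; split=> // y hy.
have /disk_atE/= h1 := hy (Ordinal (ltnW m1)) I; have /disk_atE/= h2 := hy (Ordinal m1) I.
move: h1 h2; rewrite /d2/=; have := sqr_ge0 y.2 => h0 h1 h2.
by have : 2 * (y.1 ^+ 2) - 6 * y.1 + 9 <= 2 by [lra]; nra.
Qed.

Variables (K : set (R * R)) (x : R -> R * R).
Hypothesis hK : body K x.

Lemma pmeas_body : pmeas K.
Proof. by apply: pmeas_compact; exact: bodycompact hK. Qed.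

Lemma area_body_fin : (area K < +oo)%E.
Proof.
pose p := x 0; apply: (@area_bounded _ _ (`|p.1| + `|p.2| + 2)); first exact: pmeas_body.
move=> y Ky; have := body4 hK Ky (bodyP hK 0); rewrite -/p /d2 => h.
have h1 : (y.1 - p.1) ^+ 2 < 2 ^+ 2 by have := sqr_ge0 (y.2 - p.2); lra.
have h2 : (y.2 - p.2) ^+ 2 < 2 ^+ 2 by have := sqr_ge0 (y.1 - p.1); lra.
have n1 : `|y.1 - p.1| < 2 by rewrite -(@ltr_pXn2r _ 2)// ?nnegrE// -normrX ger0_norm ?sqr_ge0.
have n2 : `|y.2 - p.2| < 2 by rewrite -(@ltr_pXn2r _ 2)// ?nnegrE// -normrX ger0_norm ?sqr_ge0.
have := ler_norm p.1; have := ler_norm (- p.1); have := ler_norm p.2; have := ler_norm (- p.2).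
move: n1 n2; rewrite !normrN !ltr_norml; lra.
Qed.

Lemma arE (A : set (R * R)) : pmeas A -> A `<=` K -> (ar A)%:E = area A.
Proof.
move=> mA AK; rewrite fineK// ge0_fin_numE ?area_ge0//.
exact: le_lt_trans (le_area mA pmeas_body AK) area_body_fin.
Qed.

Lemma ar_ge0 (A : set (R * R)) : 0 <= ar A.
Proof. by apply: fine_ge0; exact: area_ge0. Qed.

Lemma ar_le (A B : set (R * R)) : pmeas A -> pmeas B -> A `<=` B -> B `<=` K -> ar A <= ar B.
Proof.
move=> mA mB AB BK; rewrite -lee_fin !arE//; last exact: subset_trans BK.
exact: le_area.
Qed.

Lemma arU_le (A B : set (R * R)) : pmeas A -> pmeas B -> A `<=` K -> B `<=` K ->
  ar (A `|` B) <= ar A + ar B.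
Proof.
move=> mA mB AK BK; rewrite -lee_fin EFinD !arE//; first exact: areaU_le.
  exact: pmeasU.
by move=> y [/AK|/BK].
Qed.

Lemma arU (A B : set (R * R)) : pmeas A -> pmeas B -> A `<=` K -> B `<=` K ->
  A `&` B = set0 -> ar (A `|` B) = ar A + ar B.
Proof.
move=> mA mB AK BK AB; apply: EFin_inj; rewrite EFinD !arE//; first exact: areaU.
  exact: pmeasU.
by move=> y [/AK|/BK].
Qed.

Lemma ar_set0 : ar set0 = 0.
Proof. by rewrite /ar area0. Qed.

Definition cutU (e : nat -> R * R) n : set (R * R) :=
  [set y | K y /\ exists2 i, (i < n)%N & ~ disk_at (e i) y].

Lemma cutUS e n : cutU e n.+1 = cutU e n `|` (K `\` disk_at (e n)).
Proof.
apply/seteqP; split=> y.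
  move=> [Ky [i]]; rewrite ltnS leq_eqVlt => /orP[/eqP ->|ni] h; first by right.
  by left; split=> //; exists i.
move=> [[Ky [i ni h]]|[Ky h]]; split=> //; first by exists i => //; exact: ltnW.
by exists n.
Qed.

Lemma pmeas_cut (e : R * R) : pmeas (K `\` disk_at e).
Proof. by apply: pmeasD; [exact: pmeas_body|exact: pmeas_disk]. Qed.

Lemma cutU0 e : cutU e 0 = set0.
Proof. by apply/seteqP; split=> // y [_ []]. Qed.

Lemma pmeas_cutU e n : pmeas (cutU e n).
Proof.
elim: n => [|n IH]; first by rewrite cutU0; exact: closed_pmeas closed0.
by rewrite cutUS; apply: pmeasU => //; exact: pmeas_cut.
Qed.

Lemma cutU_sub e n : cutU e n `<=` K. Proof. by move=> y []. Qed.

Lemma ar_cutU_le e n : ar (cutU e n) <= \sum_(0 <= i < n) ar (K `\` disk_at (e i)).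
Proof.
elim: n => [|n IH]; first by rewrite cutU0 ar_set0 big_nil.
rewrite cutUS big_nat_recr//=; apply: le_trans (lerD IH (lexx _)).
apply: arU_le; [exact: pmeas_cutU|exact: pmeas_cut|exact: cutU_sub|by move=> y []].
Qed.

Lemma ar_cutU e n : (forall i j y, (i < j < n)%N -> K y ->
    ~ disk_at (e i) y -> ~ disk_at (e j) y -> False) ->
  ar (cutU e n) = \sum_(0 <= i < n) ar (K `\` disk_at (e i)).
Proof.
elim: n => [|n IH] disj; first by rewrite cutU0 ar_set0 big_nil.
rewrite cutUS big_nat_recr//= -IH; last first.
  by move=> i j y /andP[ij jn]; apply: disj; rewrite ij ltnW.
apply: arU; [exact: pmeas_cutU|exact: pmeas_cut|exact: cutU_sub|by move=> y []|].
apply/seteqP; split=> // y [[Ky [i ni h]] [_ h']].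
by apply: (disj i n y _ Ky h h'); rewrite ni ltnSn.
Qed.

Lemma ar_cutUC e n (Q : set (R * R)) : pmeas Q -> Q `<=` K ->
  (forall y, Q y -> forall i, (i < n)%N -> disk_at (e i) y) ->
  ar Q + ar (cutU e n) <= ar K.
Proof.
move=> mQ QK h; rewrite -arU //; [|exact: pmeas_cutU|exact: cutU_sub|]; last first.
  by apply/seteqP; split=> // y [/h hy [_ [i ni]]]; apply; exact: hy.
apply: ar_le => //; [by apply: pmeasU => //; exact: pmeas_cutU|exact: pmeas_body|].
by move=> y [/QK|/cutU_sub].
Qed.

Lemma ar_cutUC_ge e n (Q : set (R * R)) : pmeas Q -> Q `<=` K ->
  (forall y, K y -> (forall i, (i < n)%N -> disk_at (e i) y) -> Q y) ->
  ar K <= ar Q + ar (cutU e n).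
Proof.
move=> mQ QK h; apply: (@le_trans _ _ (ar (Q `|` cutU e n))); last first.
  by apply: arU_le => //; [exact: pmeas_cutU|exact: cutU_sub].
apply: ar_le; [exact: pmeas_body|by apply: pmeasU => //; exact: pmeas_cutU| |].
  move=> y Ky; have [hc|hc] := pselect (cutU e n y); [by right|left].
  apply: h => // i ni; apply: contrapT => hd; apply: hc; split=> //; by exists i.
by move=> y [/QK|/cutU_sub].
Qed.

Section sequence.
Variables (m : nat) (s : nat -> R).
Hypothesis hc : cyc m s.
Let m0 : (0 < m)%N. Proof. by case: hc. Qed.
Notation e := (ecenter s (x \o s)).

Lemma ecenter_period i : e (i + m)%N = e i.
Proof.
rewrite /ecenter /= -addSn !(body_cfgk hK hc); case: ifP => // _.
by have [_ _ ->] := hc; rewrite /ctr cosD2pi sinD2pi.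
Qed.

Lemma ecenter_mod i : e (i %% m)%N = e i.
Proof.
rewrite [in RHS](divn_eq i m) addnC; elim: (i %/ m)%N => [|n IH]; first by rewrite mul0n addn0.
by rewrite mulSn addnCA addnC ecenter_period.
Qed.

Lemma cap_area_ecenter i : (x (s i) = x (s i.+1) -> s i.+1 <= s i + pi) ->
  cap_area K x (s i) (s i.+1) = ar (K `\` disk_at (e i)).
Proof.
move=> nf; rewrite /cap_area /ecenter /=; have [E|//] := eqVneq (x (s i)) (x (s i.+1)).
rewrite ifT; last by have := nf E; lra.
rewrite (_ : K `\` _ = set0) ?ar_set0//.
apply/seteqP; split=> // y [Ky]; apply; apply/disk_atE; exact: bodyS hK _ _ Ky.
Qed.

Lemma polygon_sub y : (exists i j, x (s i) != x (s j)) ->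
  (forall i, (i < m)%N -> d2 y (e i) <= 1) -> K y.
Proof.
move=> nc hy; apply: (body_mem_disks hK) => c hKc.
apply: (cfg_hull hc (body_cfgk hK hc) (body_cfgS hK s) (body_cfg4 hK s) nc).
  by move=> i; rewrite -ecenter_mod; apply: hy; rewrite ltn_mod.
by move=> i; apply: hKc; exact: bodyP hK _.
Qed.

(** If a gap above pi returns to the same point, its cost is already the area of K and the empty
    polygon will do. Otherwise the intersection of the edge disks lies in K and the caps cover the
    rest of K. *)
Lemma cap_cost_inscribed : (1 < m)%N ->
  exists Q, [/\ disk_polygon m Q, Q `<=` K & ar K <= ar Q + cost (cap_area K x) m s].
Proof.
move=> m1.
have F0 u v : 0 <= cap_area K x u v by rewrite /cap_area; do 2 ?case: ifP => _; rewrite ?ar_ge0.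
have [nf|/existsNP[i0 /not_implyP[i0m hi0]]] :=
  pselect (forall i, (i < m)%N -> x (s i) = x (s i.+1) -> s i.+1 <= s i + pi); last first.
  exists set0; split=> //; first exact: disk_polygon_set0.
  have [E h] := (not_implyP _ _).1 hi0.
  apply: (@le_trans _ _ (cost (cap_area K x) m s)); last by rewrite lerDr ar_ge0.
  rewrite /cost big_mkord (bigD1 (Ordinal i0m))//= {1}/cap_area E eqxx ifF; last first.
    by apply/negP => h'; apply: h; lra.
  by rewrite lerDl; apply: sumr_ge0.
have nfall i : x (s i) = x (s i.+1) -> s i.+1 <= s i + pi.
  have h j : x (s (j + m)%N) = x (s j) := body_cfgk hK hc j.
  have [_ _ sm] := hc.
  rewrite (divn_eq i m) addnC -addSn.
  have E : forall n j, x (s (j + n * m)%N) = x (s j) /\ s (j + n * m)%N = s j + n%:R * (pi *+ 2).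
    elim=> [|n IH] j; first by rewrite mul0n addn0 mul0r addr0.
    have [IH1 IH2] := IH j.
    by rewrite mulSn addnCA addnC h sm IH1 IH2 -natr1; split=> //; ring.
  have [-> ->] := E (i %/ m)%N (i %% m)%N; have [-> ->] := E (i %/ m)%N (i %% m).+1.
  by move=> /nf; rewrite ltn_mod m0 => /(_ isT); lra.
have nc : exists i j, x (s i) != x (s j).
  have [y [z [Ky Kz yz]]] := body2 hK.
  have [yx|yx] := eqVneq y (x (s 0%N)); last first.
    have [i hi] := cfg_nonconst hc nfall (fun i => bodyS hK (s i) Ky) yx.
    by exists i, 0%N.
  have zx : z != x (s 0%N) by rewrite -yx eq_sym.
  have [i hi] := cfg_nonconst hc nfall (fun i => bodyS hK (s i) Kz) zx.
  by exists i, 0%N.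
pose Q := \bigcap_(i : 'I_m) disk_at (e i).
have QK : Q `<=` K.
  move=> y hy; apply: polygon_sub => // i i_m; apply/disk_atE.
  exact: (hy (Ordinal i_m) I).
exists Q; split=> //; first by exists (fun i : 'I_m => e i).
have mQ : pmeas Q by apply: closed_pmeas; apply: closed_bigI => i _; exact: disk_at_closed.
apply: le_trans (@ar_cutUC_ge e m Q mQ QK _) _.
  by move=> y _ hy i _; exact: hy.
rewrite lerD2l (le_trans (ar_cutU_le _ _))// le_eqVlt; apply/orP; left; apply/eqP.
by apply: eq_bigr => i _; rewrite cap_area_ecenter//; exact: nfall.
Qed.

(** The caps are disjoint from each other by [cfg_caps_disjoint], and from Q, so their areas add
    up. *)
Lemma cap_cost_outer (Q : set (R * R)) : (exists i j, x (s i) != x (s j)) ->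
  pmeas Q -> Q `<=` K -> (forall i y, Q y -> d2 y (e i) <= 1) ->
  ar Q + cost (cap_area K x) m s <= ar K.
Proof.
move=> [i0 [j0 nc]] mQ QK hQ.
have nc' i : exists n, x (s n) != x (s i).
  have [E|] := eqVneq (x (s i0)) (x (s i)); last by exists i0.
  by exists j0; rewrite -E eq_sym.
have nf i := cfg_nonfull hc (body_cfgk hK hc) (body_cfgS hK s) (nc' i).
have -> : cost (cap_area K x) m s = ar (cutU e m).
  rewrite ar_cutU; first by apply: eq_bigr => i _; rewrite cap_area_ecenter//; exact: nf.
  move=> i j y /andP[ij jm] Ky h1 h2.
  apply: (cfg_caps_disjoint hc (body_cfgk hK hc) (body_cfgS hK s) (body_cfg4 hK s)
    (fun n => bodyS hK (s n) Ky) (i := i) (j := j)).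
  - by rewrite ij (leq_trans jm)// leq_addl.
  - by rewrite ltNge; apply/negP => /disk_atE.
  - by rewrite ltNge; apply/negP => /disk_atE.
apply: ar_cutUC => // y Qy i _; apply/disk_atE; exact: hQ.
Qed.

End sequence.

Lemma cap_cost_polygon m (Q : set (R * R)) : (1 < m)%N -> disk_polygon m Q -> Q `<=` K ->
  exists2 s, cyc m s & ar Q + cost (cap_area K x) m s <= ar K.
Proof.
move=> m1 [c QE] QK; have m0 : (0 < m)%N by exact: ltnW.
have mQ : pmeas Q.
  by rewrite QE; apply: closed_pmeas; apply: closed_bigI => i _; exact: disk_at_closed.
have [[y [z [Qy Qz yz]]]|one] := pselect (exists y z, [/\ Q y, Q z & y != z]).
  pose C := [seq c i | i <- enum 'I_m].
  have sC : size C = m by rewrite size_map size_enum_ord.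
  have CE w : in_disks C w <-> Q w.
    rewrite QE; split=> [h i _|h _ /mapP[i _ ->]]; apply/disk_atE; last exact: h.
    by apply: h; apply: map_f; rewrite mem_enum.
  have sC0 : (0 < size C)%N by rewrite sC.
  have CK w : in_disks C w -> K w by move=> /CE/QK.
  have C2 : exists y z, [/\ in_disks C y, in_disks C z & y != z].
    by exists y, z; split=> //; apply/CE.
  have [s [hc nc hs]] := polygon_outer hK sC0 CK C2.
  rewrite sC in hc; exists s => //; apply: cap_cost_outer => // i w /CE; exact: hs.
have Q0 : ar Q = 0.
  have [[p Qp]|np] := pselect (exists p, Q p); last first.
    by rewrite (_ : Q = set0) ?ar_set0//; apply/seteqP; split=> // w Qw; apply: np; exists w.
  have -> : Q = [set p].
    apply/seteqP; split=> [w Qw|w ->//]; apply/eqP/negPn/negP => h; apply: one.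
    by exists w, p.
  by rewrite /ar area_singleton.
(* A polygon with at most one point has area 0; equally spaced directions have gaps of at most pi
   since m >= 2. *)
pose f i : R := i%:R * (pi *+ 2) / m%:R.
have mn : m%:R != 0 :> R by rewrite pnatr_eq0 -lt0n.
have m0' : 0 < m%:R :> R by rewrite ltr0n.
have hc : cyc m f.
  split=> // i; rewrite /f.
    rewrite ler_pM2r ?invr_gt0//; apply: ler_wpM2r; last by rewrite ler_nat.
    by rewrite mulrn_wge0// pi_ge0.
  by rewrite natrD; field.
have hf i : f i.+1 <= f i + pi.
  have : pi *+ 2 / m%:R <= pi :> R.
    rewrite ler_pdivrMr//; have : 2 <= m%:R :> R by rewrite ler_nat.
    by have := pi_ge0 R; nra.
  have -> : f i.+1 = f i + pi *+ 2 / m%:R by rewrite /f -(natr1 i); field.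
  lra.
exists f => //; rewrite Q0 -ar_set0; apply: cap_cost_outer => //; last first.
  exact: closed_pmeas closed0.
have [y [z [Ky Kz yz]]] := body2 hK.
have [yx|yx] := eqVneq y (x (f 0%N)); last first.
  have [i hi] := cfg_nonconst hc (fun i _ => hf i) (fun i => bodyS hK (f i) Ky) yx.
  by exists i, 0%N.
have zx : z != x (f 0%N) by rewrite -yx eq_sym.
have [i hi] := cfg_nonconst hc (fun i _ => hf i) (fun i => bodyS hK (f i) Kz) zx.
by exists i, 0%N.
Qed.

End caps.

#[local] Opaque area.

(** * Intersections of two unit disks *)

Section lens.
Context {R : realType}.
Implicit Types (p q c : R * R).

Definition lens p q : set (R * R) := disk_at (ectr p q) `&` disk_at (ectr q p).

Definition canonical_lens (w : R) : set (R * R) :=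
  [set y | (y.1 + w) ^+ 2 + y.2 ^+ 2 <= 1 /\ (y.1 - w) ^+ 2 + y.2 ^+ 2 <= 1].

Lemma canonical_lens_sub (w w' : R) : 0 <= w' -> w' <= w ->
  canonical_lens w `<=` canonical_lens w'.
Proof.
move=> h0 h1 y [h2 h3]; have h4 : w' ^+ 2 <= w ^+ 2 by nra.
by split; have [h|h] := leP 0 y.1; nra.
Qed.

Lemma area_two_disks c1 c2 : exists w, [/\ 0 <= w, 4 * w ^+ 2 = d2 c1 c2,
  pmeas (canonical_lens w) & area (disk_at c1 `&` disk_at c2) = area (canonical_lens w)].
Proof.
have [w [t [w0 wE e1 e2]]] : exists w t, [/\ 0 <= w, 4 * w ^+ 2 = d2 c1 c2,
    c1.1 - c2.1 = 2 * w * cos t & c1.2 - c2.2 = 2 * w * sin t].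
  have [->|ne] := eqVneq c1 c2.
    by exists 0, 0; rewrite d2pp !subrr expr0n/= !mulr0 !mul0r.
  have [l [t [l0 l2 _ h1 h2]]] := polar 0 ne.
  by exists (l / 2), t; split; [lra|rewrite -l2; field|rewrite h1; field|rewrite h2; field].
have mD : pmeas (disk_at c1 `&` disk_at c2) by apply: pmeasI; exact: pmeas_disk.
pose m1 := (c1.1 + c2.1) / 2; pose m2 := (c1.2 + c2.2) / 2.
have E : rot t @^-1` ((fun p => (p.1 + m1, p.2 + m2)) @^-1` (disk_at c1 `&` disk_at c2)) =
    canonical_lens w.
  have ct := cos2Dsin2 t.
  have c11 : c1.1 = m1 + w * cos t by rewrite /m1; lra.
  have c12 : c1.2 = m2 + w * sin t by rewrite /m2; lra.
  have c21 : c2.1 = m1 - w * cos t by rewrite /m1; lra.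
  have c22 : c2.2 = m2 - w * sin t by rewrite /m2; lra.
  have D1 y : d2 ((rot t y).1 + m1, (rot t y).2 + m2) c1 = (y.1 - w) ^+ 2 + y.2 ^+ 2.
    rewrite -[RHS]mulr1 -ct /d2/= c11 c12; ring.
  have D2 y : d2 ((rot t y).1 + m1, (rot t y).2 + m2) c2 = (y.1 + w) ^+ 2 + y.2 ^+ 2.
    rewrite -[RHS]mulr1 -ct /d2/= c21 c22; ring.
  apply/seteqP; split=> y /=; rewrite /canonical_lens/=.
    by move=> [/disk_atE + /disk_atE]; rewrite D1 D2.
  by rewrite -D1 -D2 => -[h1 h2]; split; apply/disk_atE.
have mT := pmeas_translation m1 m2 mD.
exists w; split; [by []|by []|by rewrite -E; exact: pmeas_rot|].
by rewrite -E (area_rot _ mT) (area_translation _ _ mD).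
Qed.

Lemma d2_ectr p q : 0 < d2 p q < 4 -> d2 (ectr p q) (ectr q p) = 4 - d2 p q.
Proof.
move=> /andP[h0 h4]; rewrite /ectr (d2C q p).
have : Num.sqrt ((d2 p q)^-1 - 4^-1) ^+ 2 = (d2 p q)^-1 - 4^-1.
  by rewrite sqr_sqrtr// subr_ge0 lef_pV2 ?posrE// ltW.
set k := Num.sqrt _ => kE.
have -> : d2 ((p.1 + q.1) / 2 - k * (q.2 - p.2), (p.2 + q.2) / 2 + k * (q.1 - p.1))
   ((q.1 + p.1) / 2 - k * (p.2 - q.2), (q.2 + p.2) / 2 + k * (p.1 - q.1)) =
   4 * k ^+ 2 * d2 p q by rewrite /d2/=; field.
by rewrite kE; field; rewrite gt_eqF.
Qed.

(** By [d2_ectr] a longer chord means closer centers, and in standard position lenses grow as their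
    centers approach each other. *)
Lemma le_area_lens p q p' q' : 0 < d2 p q < 4 -> 0 < d2 p' q' < 4 ->
  d2 p q <= d2 p' q' -> (area (lens p q) <= area (lens p' q'))%E.
Proof.
move=> h h' le.
have [w [w0 wE mw ->]] := area_two_disks (ectr p q) (ectr q p).
have [w' [w0' wE' mw' ->]] := area_two_disks (ectr p' q') (ectr q' p').
rewrite !d2_ectr// in wE wE'.
apply: le_area => //; apply: canonical_lens_sub => //.
by rewrite -(@ler_pXn2r _ 2)// ?nnegrE//; lra.
Qed.

End lens.

(** * Gaps larger than a half turn *)

Section gap.
Context {R : realType}.
Variables (K : set (R * R)) (x : R -> R * R).
Hypothesis hK : body K x.
Notation F := (cap_area K x).

Lemma cap_area_2pi s t : F (s + pi *+ 2) (t + pi *+ 2) = F s t.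
Proof.
have E : t + pi *+ 2 - (s + pi *+ 2) = t - s by ring.
by rewrite /cap_area (body2pi hK s) (body2pi hK t) E.
Qed.

(** The lens is the polygon cut out by the two directions s and t; its two caps are disjoint and
    cover the rest of K. *)
Lemma two_caps s t : s <= t -> t <= s + pi *+ 2 -> x s != x t ->
  F s t + F t (s + pi *+ 2) = ar K - ar (lens (x s) (x t)) /\ lens (x s) (x t) `<=` K.
Proof.
move=> st ts ne.
pose f i : R := if i == 0%N then s else if i == 1%N then t else s + pi *+ 2.
have f2 : f 2 = f 0%N + pi *+ 2 by [].
have hc : cyc 2 (pext 2 f).
  by apply: pext_cyc => // -[|[|i]]//= _.
have fE i : (i <= 2)%N -> pext 2 f i = f i by exact: pext_le.
have e0 : ecenter (pext 2 f) (x \o pext 2 f) 0 = ectr (x s) (x t).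
  by rewrite /ecenter/= !fE//= /f/= (negbTE ne).
have e1 : ecenter (pext 2 f) (x \o pext 2 f) 1 = ectr (x t) (x s).
  by rewrite /ecenter/= !fE//= /f/= (body2pi hK) eq_sym (negbTE ne).
have nc : exists i j, x (pext 2 f i) != x (pext 2 f j).
  by exists 0%N, 1%N; rewrite !fE.
have LK : lens (x s) (x t) `<=` K.
  move=> y [/disk_atE h1 /disk_atE h2]; apply: (polygon_sub hK hc nc) => -[|[|i]]// _.
    by rewrite e0.
  by rewrite e1.
have mL : pmeas (lens (x s) (x t)) by apply: pmeasI; exact: pmeas_disk.
split=> //.
have cE : cost F 2 (pext 2 f) = F s t + F t (s + pi *+ 2).
  by rewrite cost_pext// /cost big_nat_recr//= big_nat1.
have F1 : F s t = ar (K `\` disk_at (ectr (x s) (x t))) by rewrite /cap_area (negbTE ne).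
have F2 : F t (s + pi *+ 2) = ar (K `\` disk_at (ectr (x t) (x s))).
  by rewrite /cap_area (body2pi hK) eq_sym (negbTE ne).
apply/eqP; rewrite eq_le; apply/andP; split.
  rewrite -cE lerBrDl; apply: (cap_cost_outer hK hc nc mL LK).
  move=> i y [/disk_atE h1 /disk_atE h2]; rewrite -(ecenter_mod hK hc).
  have i2 : (i %% 2 < 2)%N by rewrite ltn_mod.
  by case: (i %% 2)%N i2 => [|[|]]//= _; rewrite ?e0 ?e1.
pose e i := if i == 0%N then ectr (x s) (x t) else ectr (x t) (x s).
rewrite lerBlDl F1 F2.
have := ar_cutU_le hK e 2; rewrite big_nat_recr//= big_nat1 /e/= => h.
apply: le_trans (_ : _ <= ar (lens (x s) (x t)) + ar (cutU K e 2)) _; last by rewrite lerD2l.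
apply: (ar_cutUC_ge hK mL LK) => y _ hy; split; [exact: (hy 0%N)|exact: (hy 1%N)].
Qed.

Lemma d2_hd (p q : R * R) s : (hd s p q) ^+ 2 <= d2 p q.
Proof.
have h : d2 p q = (hd s p q) ^+ 2 + (- (p.1 - q.1) * sin s + (p.2 - q.2) * cos s) ^+ 2.
  by rewrite -[LHS]mulr1 -(cos2Dsin2 s) /d2 /hd; ring.
by rewrite h lerDl sqr_ge0.
Qed.

Lemma d2_hd2 (p q : R * R) s : d2 p q = (hd s p q) ^+ 2 + (hd (s + pi / 2) p q) ^+ 2.
Proof.
by rewrite /hd cosDpihalf sinDpihalf -[LHS]mulr1 -(cos2Dsin2 s) /d2; ring.
Qed.

Lemma body_hd s y : K y -> 0 <= hd s (x s) y.
Proof. by move=> Ky; exact: (supp_ge0 (bodyS hK s Ky)). Qed.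

(** The chord from p to q has direction m + pi / 2. If both m - pi / 2 and m + pi / 2 lie in [a, d],
    these two directions will do. Otherwise one end of the gap is kept and combined with its
    opposite direction. *)
Lemma wide_pair a d : a + pi < d -> d <= a + pi *+ 2 ->
  exists u, [/\ a <= u, u + pi <= d & d2 (x a) (x d) <= d2 (x u) (x (u + pi))].
Proof.
move=> ad da; set p := x a; set q := x d.
have pi0 := pi_gt0 R.
have Kp : K p by exact: bodyP hK _.
have Kq : K q by exact: bodyP hK _.
have [pq|pq] := eqVneq p q.
  by exists a; split; [lra|lra|rewrite pq d2pp d2_ge0].
have had : a <= d <= a + pi *+ 2 by apply/andP; split; lra.
have sp : supp p a q := bodyS hK a Kq.
have sq : supp q d p := bodyS hK d Kp.
have [s1 [s2 [ o [e1 s12 e2 s21 [pE qE]]]]] := edge_exists pq (body4 hK Kp Kq) sp sq had.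
pose h := (s2 - s1) / 2; pose m := (s1 + s2) / 2.
have sh : 0 < sin h by apply: sin_gt0_pi; rewrite /h; lra.
have [am md] : a <= m /\ m <= d by rewrite /m; split; lra.
have hE t : hd t q p = 2 * sin h * sin (t - m).
  rewrite /hd pE qE /pt/=.
  have -> : s1 = m - h by rewrite /m /h; field.
  have -> : s2 = m + h by rewrite /m /h; field.
  by rewrite (cosB m) (cosD m) (sinB m) (sinD m) (sinB t); ring.
have qp : q != p by rewrite eq_sym.
have hq : 0 < sin (d - m).
  by have := supp_gt0 sq pq; rewrite hE pmulr_rgt0// mulr_gt0.
have hp : sin (a - m) < 0.
  have := supp_gt0 sp qp; rewrite hdC hE oppr_gt0 pmulr_rlt0// mulr_gt0//.
have [c1|c1] := leP (m - pi / 2) a; last first.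
  have [c2|c2] := leP d (m + pi / 2); last first.
    (* The width of K in the direction of the chord is at least the length of the chord. *)
    exists (m - pi / 2); have -> : m - pi / 2 + pi = m + pi / 2 by field.
    split; [lra|lra|].
    have h1 : 0 <= hd (m + pi / 2) (x (m + pi / 2)) q by exact: body_hd.
    have h2 : 0 <= hd (m - pi / 2) (x (m - pi / 2)) p by exact: body_hd.
    have h3 : hd (m + pi / 2) (x (m - pi / 2)) p <= 0.
      have := hdDpi (m - pi / 2) (x (m - pi / 2)) p.
      have -> : m - pi / 2 + pi = m + pi / 2 by field.
      by move=> ->; lra.
    have h4 : hd (m + pi / 2) q p = 2 * sin h.
      by rewrite hE (_ : m + pi / 2 - m = pi / 2) ?sin_pihalf; [ring|ring].
    have h5 : d2 p q = (2 * sin h) ^+ 2.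
      rewrite d2C (d2_hd2 _ _ m) -h4 (hE m) subrr sin0 mulr0 expr0n/= add0r.
      by [].
    rewrite h5 d2C; apply: le_trans (d2_hd _ _ (m + pi / 2)).
    rewrite -h4; have : 0 < hd (m + pi / 2) q p by rewrite h4; lra.
    have : hd (m + pi / 2) (x (m + pi / 2)) (x (m - pi / 2)) =
      hd (m + pi / 2) (x (m + pi / 2)) q + hd (m + pi / 2) q p - hd (m + pi / 2) (x (m - pi / 2)) p.
      by rewrite /hd; ring.
    by nra.
  (* With this bound d - pi / 2 lies between d - pi and a + pi. So replacing p by the point X of
     normal d - pi decreases neither of the nonnegative coordinates of q - p in the frame of d. *)
  have d3 : d <= a + 3 * pi / 2.
    rewrite leNgt; apply/negP => d3.
    have : 0 <= sin (a - m + pi *+ 2).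
      by apply: sin_ge0_pi; apply/andP; split; lra.
    by rewrite sinD2pi; lra.
  exists (d - pi); rewrite subrK; split; [lra|lra|].
  set X := x (d - pi); have KX : K X by exact: bodyP hK _.
  rewrite -/q (d2C X) d2C !(d2_hd2 _ _ d).
  have a1 : 0 <= hd d q p by exact: supp_ge0.
  have b1 : 0 <= hd (d + pi / 2) q p.
    rewrite hE mulr_ge0 ?mulr_ge0 ?(ltW sh)//.
    have -> : d + pi / 2 - m = (d - m) + pi / 2 by ring.
    by rewrite sinDpihalf; apply: cos_ge0_pihalf; apply/andP; split; lra.
  have x1 : 0 <= hd (d - pi) X p by exact: body_hd.
  have x2 : 0 <= hd (a + pi) X p.
    by rewrite hdDpi -hdC; exact: (supp_ge0 (bodyS hK _ _)).
  have x3 : 0 <= hd (d - pi / 2) X p.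
    apply: (@between_ge0 _ (d - pi) (d - pi / 2) (a + pi)) => //; lra.
  have y1 : hd d X p = - hd (d - pi) X p by rewrite -hdDpi subrK.
  have y2 : hd (d + pi / 2) X p = - hd (d - pi / 2) X p.
    by rewrite -hdDpi; congr (hd _ X p); field.
  have z1 : hd d q X = hd d q p - hd d X p by rewrite /hd; ring.
  have z2 : hd (d + pi / 2) q X = hd (d + pi / 2) q p - hd (d + pi / 2) X p by rewrite /hd; ring.
  rewrite z1 z2 y1 y2; nra.
have d3 : d <= a + 3 * pi / 2.
  rewrite leNgt; apply/negP => d3.
  have : sin (d - m) <= 0 by apply: sin_pi_le0; lra.
  lra.
exists a; split; [lra|lra|].
set Y := x (a + pi); have KY : K Y by exact: bodyP hK _.
rewrite -/p d2C (d2C p) !(d2_hd2 _ _ (a + pi / 2)).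
have -> : a + pi / 2 + pi / 2 = a + pi by field.
have a1 : 0 <= hd (a + pi) q p by rewrite hdDpi -hdC; exact: supp_ge0.
have a2 : 0 <= hd (a + pi / 2) q p.
  rewrite hE mulr_ge0 ?mulr_ge0 ?(ltW sh)//.
  have -> : a + pi / 2 - m = - (m - a) + pi / 2 by ring.
  by rewrite sinDpihalf; apply: cos_ge0_pihalf; apply/andP; split; lra.
have x1 : 0 <= hd (a + pi) Y q by exact: body_hd.
have x2 : 0 <= hd (d - pi) Y q.
  have := hdDpi (d - pi) Y q; rewrite subrK => h1.
  by have := body_hd d KY; rewrite -/q hdC; lra.
have x3 : 0 <= hd (a + pi / 2) Y q.
  apply: (@between_ge0 _ (d - pi) (a + pi / 2) (a + pi)) => //; lra.
have z1 : hd (a + pi) Y p = hd (a + pi) q p + hd (a + pi) Y q by rewrite /hd; ring.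
have z2 : hd (a + pi / 2) Y p = hd (a + pi / 2) q p + hd (a + pi / 2) Y q by rewrite /hd; ring.
rewrite z1 z2; nra.
Qed.

(** By [two_caps] each side is the area of K minus that of a lens, and [wide_pair] makes the lens of
    u the larger one. If x a = x d, the convention in [cap_area] charges the whole area of K. *)
Lemma cap_area_fix a d : a + pi < d -> d <= a + pi *+ 2 ->
  exists u, [/\ a <= u, u + pi <= d &
    F u (u + pi) + F (u + pi) (u + pi *+ 2) <= F a d + F d (a + pi *+ 2)].
Proof.
move=> ad da; have [u [h1 h2 h3]] := wide_pair ad da.
have pi0 := pi_gt0 R.
exists u; split; [exact: h1|exact: h2|].
have F0 v w : 0 <= F v w by rewrite /cap_area; do 2 ?case: ifP => _; rewrite ?ar_ge0.
have [E|ne] := eqVneq (x u) (x (u + pi)).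
  have -> : F u (u + pi) = 0 by rewrite /cap_area E eqxx ifT//; lra.
  have -> : F (u + pi) (u + pi *+ 2) = 0.
    by rewrite /cap_area (body2pi hK) E eqxx ifT//; lra.
  by rewrite addr0 addr_ge0.
have hu1 : u <= u + pi by lra.
have hu2 : u + pi <= u + pi *+ 2 by lra.
have had : a <= d by lra.
have wide : (d - a <= pi) = false by apply/negP => h; lra.
have [E1 LK] := two_caps hu1 hu2 ne.
have [E|ne'] := eqVneq (x a) (x d).
  have -> : F a d = ar K by rewrite /cap_area E eqxx wide.
  rewrite [leLHS]E1; have := F0 d (a + pi *+ 2); have := ar_ge0 (lens (x u) (x (u + pi))).
  by move: (F _ _) (ar _) (ar _); clear => *; lra.
have [E2 LK'] := two_caps had da ne'.
have mL (p q : R * R) : pmeas (lens p q) by apply: pmeasI; exact: pmeas_disk.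
suff le : ar (lens (x a) (x d)) <= ar (lens (x u) (x (u + pi))).
  by rewrite [leLHS]E1 [leRHS]E2 lerD2l lerN2.
rewrite -lee_fin (arE hK (mL _ _) LK') (arE hK (mL _ _) LK).
by apply: le_area_lens; rewrite // d2_gt0 ?ne ?ne'/=; apply: (body4 hK); exact: bodyP hK _.
Qed.

End gap.

(** * Area under an arc *)

#[local] Opaque area.

Section arc_area.
Context {R : realType}.
Notation mu := (@lebesgue_measure R).

Lemma seg_chord (d : R) : 0 <= d < pi -> seg (2 - 2 * cos d) = (d - sin d) / 2.
Proof.
move=> /andP[d0 dp]; have pi0 := pi_gt0 R.
have E : d = (d / 2) + (d / 2) by field.
have c2 := cos2Dsin2 (d / 2).
have -> : 2 - 2 * cos d = (2 * sin (d / 2)) ^+ 2 by rewrite [in LHS]E cosD; lra.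
have s0 : 0 <= sin (d / 2) by apply: sin_ge0_pi; apply/andP; split; lra.
have c0 : 0 <= cos (d / 2) by apply: cos_ge0_pihalf; apply/andP; split; lra.
rewrite /seg /chs sqrtr_sqr ger0_norm ?mulr_ge0// mulrAC divff ?mul1r//.
rewrite sinK; last by rewrite in_itv/=; apply/andP; split; lra.
have -> : (2 * sin (d / 2)) ^+ 2 * (4 - (2 * sin (d / 2)) ^+ 2) =
    (4 * sin (d / 2) * cos (d / 2)) ^+ 2.
  have -> : 4 - (2 * sin (d / 2)) ^+ 2 = 4 * cos (d / 2) ^+ 2 by lra.
  by ring.
rewrite sqrtr_sqr ger0_norm; last by rewrite !mulr_ge0.
have -> : sin d = 2 * sin (d / 2) * cos (d / 2) by rewrite [in LHS]E sinD; ring.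
by field.
Qed.

(** Continuity up to the ends, where [asin] has no derivative, comes from inverting the sine. *)
Lemma within_continuous_asin : {within `[-1, 1], continuous (@asin R)}.
Proof.
have pi0 := pi_gt0 R.
have h : - (pi / 2) <= pi / 2 :> R by lra.
have := @segment_can_le_continuous R (- (pi / 2)) (pi / 2) sin asin h.
rewrite sinN sin_pihalf; apply; last exact: sinK.
by apply: continuous_subspaceT; exact: continuous_sin.
Qed.

Definition circ (x : R) : R := Num.sqrt (1 - x ^+ 2).
(** An antiderivative of [circ] on ]-1, 1[. *)
Definition circ_int (x : R) : R := (x * circ x + asin x) / 2.

Lemma continuous_circ : continuous circ.
Proof.
move=> x; apply: (@continuous_comp _ _ _ (fun x : R => 1 - x ^+ 2) Num.sqrt).
  by apply: cvgB; [exact: cvg_cst|exact: exprn_continuous].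
exact: sqrt_continuous.
Qed.

Lemma within_continuous_circ_int : {within `[-1, 1], continuous circ_int}.
Proof.
move=> x; apply: cvgMl; apply: cvgD; last exact: within_continuous_asin.
have h : {within `[-1, 1], continuous (fun x : R => x * circ x)}.
  apply: continuous_subspaceT => y; apply: cvgM; [exact: cvg_id|exact: continuous_circ].
exact: h.
Qed.

Lemma is_derive_circ_int (x : R) : -1 < x < 1 -> is_derive x 1 circ_int (circ x).
Proof.
move=> h; have h1 : 0 < 1 - x ^+ 2 by nra.
have dA := is_derive1_asin h.
have d1 : is_derive x 1 (fun x : R => 1 - x ^+ 2) (- 2 * x).
  by apply: is_derive_eq; rewrite /GRing.scale/=; ring.
have dS := @is_derive1_comp R Num.sqrt (fun x : R => 1 - x ^+ 2) x _ _ (is_derive1_sqrt h1) d1.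
have dP := is_deriveM (is_derive_id x 1) dS.
have dH : is_derive x 1 (fun x => x * circ x + asin x) (2 * circ x).
  apply: (is_derive_eq (is_deriveD dP dA)); rewrite /GRing.scale/= -/(circ x).
  have c0 : 0 < circ x by rewrite sqrtr_gt0.
  have c2 : circ x ^+ 2 = 1 - x ^+ 2 by rewrite sqr_sqrtr// ltW.
  have E : 2 * circ x = (1 - x ^+ 2 + circ x ^+ 2) / circ x.
    by rewrite -c2; field; rewrite gt_eqF.
  by rewrite [RHS]E; field; rewrite gt_eqF.
by apply: is_derive_eq; rewrite /GRing.scale/=; field.
Qed.

Lemma integral_circ (M u v : R) : -1 <= u -> u < v -> v <= 1 ->
  (\int[mu]_(x in `[u, v]) (circ x - M)%:E = (circ_int v - circ_int u - M * (v - u))%:E)%E.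
Proof.
move=> u1 uv v1.
have wF : {within `[u, v], continuous (fun x => circ_int x - M * x)}.
  apply: (@continuous_subspaceW R^o R^o _ `[-1, 1]).
    by move=> x /=; rewrite !in_itv/= => /andP[h1 h2]; apply/andP; split; lra.
  move=> x; apply: cvgB; first exact: within_continuous_circ_int.
  have h : {within `[-1, 1], continuous (fun x : R => M * x)}.
    by apply: continuous_subspaceT => y; apply: cvgMr; exact: cvg_id.
  exact: h.
have dF x : x \in `]u, v[ -> is_derive x 1 (fun x => circ_int x - M * x) (circ x - M).
  rewrite in_itv/= => /andP[h1 h2].
  have d1 : is_derive x 1 circ_int (circ x) by apply: is_derive_circ_int; apply/andP; split; lra.
  have d2 : is_derive x 1 (fun x : R => M * x) M.
    by apply: is_derive_eq; rewrite /GRing.scale/=; ring.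
  exact: (is_deriveB d1 d2).
rewrite (@continuous_FTC2 _ _ (fun x => circ_int x - M * x))//.
- by rewrite -EFinB; congr EFin; ring.
- apply: continuous_subspaceT => x; apply: cvgB; [exact: continuous_circ|exact: cvg_cst].
- have [_ h1 h2] := (continuous_within_itvP _ uv).1 wF; split=> // x /dF h.
  exact: ex_derive.
- by move=> x /dF h; rewrite derive1E; exact: derive_val.
Qed.

Definition undercap (M u v : R) : set (R * R) :=
  [set y | [/\ u < y.1, y.1 <= v, M <= y.2 & y.2 <= circ y.1]].

Lemma area_undercap (M u v : R) : M <= 0 -> -1 <= u -> u < v -> v <= 1 ->
  area (undercap M u v) = (circ_int v - circ_int u - M * (v - u))%:E.
Proof.
move=> M0 u1 uv v1; rewrite -integral_circ//.
rewrite -integral_itv_obnd_cbnd; last first.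
  apply/measurable_EFinP; apply: measurable_funTS; apply: continuous_measurable_fun => x.
  by apply: cvgB; [exact: continuous_circ|exact: cvg_cst].
rewrite area_slices [RHS]integral_mkcond; apply: eq_integral => x _; rewrite patchE.
have c0 : 0 <= circ x by rewrite sqrtr_ge0.
case: ifPn => [|hx].
  rewrite inE/= in_itv/= => /andP[h1 h2].
  have -> : xsection (undercap M u v) x = `[M, circ x]%classic.
    apply/seteqP; split=> y; rewrite /xsection /undercap/= in_itv/= inE/=.
      by move=> [_ _ -> ->].
    by move=> /andP[h3 h4]; split.
  rewrite lebesgue_measure_itv/= lte_fin; case: ltP => h; first by rewrite EFinB.
  by congr EFin; lra.
rewrite /=; have -> : xsection (undercap M u v) x = set0.
  apply/seteqP; split=> // y; rewrite /xsection/undercap/= inE/= => -[h1 h2 _ _].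
  by move: hx; rewrite notin_setE/= in_itv/= h1 h2.
by rewrite measure0.
Qed.

Lemma circ_cos (s : R) : 0 <= s <= pi -> circ (cos s) = sin s.
Proof.
move=> h; rewrite /circ.
have -> : 1 - cos s ^+ 2 = sin s ^+ 2 by have := cos2Dsin2 s; lra.
by rewrite sqrtr_sqr ger0_norm// sin_ge0_pi.
Qed.

Lemma circ_int_cos (s : R) : 0 <= s <= pi -> circ_int (cos s) = (cos s * sin s + pi / 2 - s) / 2.
Proof.
move=> h; rewrite /circ_int circ_cos//.
have -> : cos s = sin (pi / 2 - s) by rewrite sinB sin_pihalf cos_pihalf; ring.
rewrite sinK; first by rewrite addrA.
by move: h => /andP[h1 h2]; rewrite in_itv/=; apply/andP; split; lra.
Qed.

End arc_area.

#[local] Opaque area.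


(** * Additivity of caps, seen in the region below the boundary *)

Section slabs.
Context {R : realType}.

Lemma pmeas_undercap (M u v : R) : pmeas (undercap M u v).
Proof.
have cl (f : R * R -> R) : continuous f -> closed [set y | f y <= 0].
  move=> cf; exact: (continuous_closedP _).1 cf _ (@closed_le R 0).
have -> : undercap M u v = ([set y | y.1 * 1 + y.2 * 0 + - v <= 0] `&`
    [set y | y.1 * 0 + y.2 * - 1 + M <= 0] `&` [set y | y.2 - circ y.1 <= 0]) `\`
    [set y | y.1 * 1 + y.2 * 0 + - u <= 0].
  apply/seteqP; split=> y /=.
    move=> [h1 h2 h3 h4]; split; last by apply/negP; rewrite -ltNge; lra.
    by split; [split; lra|lra].
  move=> [[[h1 h2] h3] /negP]; rewrite -ltNge => h4.
  split; lra.
apply: pmeasD; last by apply: closed_pmeas; apply: cl; exact: continuous_affine.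
apply: pmeasI; first apply: pmeasI; apply: closed_pmeas; apply: cl.
- exact: continuous_affine.
- exact: continuous_affine.
move=> y; apply: cvgB; first exact: cvg_snd.
apply: (@continuous_comp _ _ _ (fun p : R * R => p.1) circ); first exact: cvg_fst.
exact: continuous_circ.
Qed.

Lemma circ_le (a b : R) : 0 <= b -> a ^+ 2 + b ^+ 2 <= 1 -> b <= circ a.
Proof. by move=> b0 h; rewrite -[b]ger0_norm// -sqrtr_sqr ler_wsqrtr//; lra. Qed.

Lemma le_circ (a b : R) : 0 <= b -> -1 <= a <= 1 -> b <= circ a -> a ^+ 2 + b ^+ 2 <= 1.
Proof.
move=> b0 ha h; have : circ a ^+ 2 = 1 - a ^+ 2 by rewrite sqr_sqrtr//; nra.
by nra.
Qed.

Variables (K : set (R * R)) (x : R -> R * R).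
Hypothesis hK : body K x.
Notation F := (cap_area K x).
(** K lies above the level (x 0).2 - 2, since its diameter is below 2, and an edge center lies at
    most 1 below a point of K. So this level is below K and below all edge centers. *)
Notation N := ((x 0).2 - 3).

(* The part of K and of the region below it, down to a fixed level, over ]u, v].
   It is the union of a cap and of the region under an arc, and it is additive
   in the interval. *)
Definition slab (u v : R) : set (R * R) :=
  [set y | [/\ u < y.1, y.1 <= v, N <= y.2 & exists2 e, y.2 <= e & K (y.1, e)]].

Lemma body_floor y : K y -> (x 0).2 - 2 <= y.2.
Proof.
move=> Ky; have := body4 hK Ky (bodyP hK 0); rewrite /d2 => h.
have h2 : (y.2 - (x 0).2) ^+ 2 < 2 ^+ 2 by have := sqr_ge0 (y.1 - (x 0).1); lra.
nra.
Qed.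

(** Normals in [0, pi] point upwards: the arc is a graph over the first coordinate, traversed from
    right to left as the angle grows. *)
Definition edge_at s t s1 s2 o : Prop :=
  [/\ 0 <= s, s <= s1, s1 < s2, s2 <= t & t <= pi] /\
  [/\ s2 < s1 + pi, x s = pt o s1 & x t = pt o s2].

Definition edge_cap (o : R * R) : set (R * R) := K `\` disk_at o.
Definition edge_arc (o : R * R) (s1 s2 : R) : set (R * R) :=
  (fun y => (y.1 + - o.1, y.2 + - o.2)) @^-1` undercap (N - o.2) (cos s2) (cos s1).

Lemma edge_floor s t s1 s2 o : edge_at s t s1 s2 o -> N <= o.2.
Proof.
move=> [_ [_ pE _]].
have := body_floor (bodyP hK s); rewrite pE /pt/=; have := sin_le1 s1; lra.
Qed.

(** The point y exceeds x s and x t in a direction phi strictly between s and t, hence strictly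
    upward. Were y to the left of x t, it would also be no lower than x t in direction pi, hence in
    direction t; direction 0 serves for x s. *)
Lemma edge_cap_range s t s1 s2 o y : edge_at s t s1 s2 o -> K y -> 1 < d2 y o ->
  [/\ o.2 < y.2, (x t).1 < y.1 & y.1 < (x s).1].
Proof.
move=> [[s0 ss1 s12 s2t tpi] [s21 pE qE]] Ky hy; have pi0 := pi_gt0 R.
have sp := bodyS hK s Ky; have sq := bodyS hK t Ky.
have h1 : t <= s + pi *+ 2 by lra.
have [phi [k [/andP[sphi phit] k1 y1E y2E hz]]] := outside_edge pE qE ss1 (ltW s12) s2t h1 sp sq hy.
have np : y != x s by apply/eqP => E; move: hy; rewrite E pE d2_pt ltxx.
have nq : y != x t by apply/eqP => E; move: hy; rewrite E qE d2_pt ltxx.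
have zp : 0 < hd phi y (x s) by apply: hz; rewrite pE d2_pt.
have zq : 0 < hd phi y (x t) by apply: hz; rewrite qE d2_pt.
split.
- have : 0 < sin phi by apply: sin_gt0_pi; apply/andP; split; lra.
  by nra.
- rewrite ltNge; apply/negP => h.
  have : 0 <= hd t y (x t).
    apply: (@betweenl _ phi t pi) => //; try lra.
    by rewrite /hd cospi sinpi; lra.
  by have := supp_gt0 sq nq; rewrite hdC; lra.
rewrite ltNge; apply/negP => h.
have : 0 <= hd s y (x s).
  apply: (@betweenr _ 0 s phi) => //; try lra.
  by rewrite /hd cos0 sin0; lra.
by have := supp_gt0 sp np; rewrite hdC; lra.
Qed.

Lemma slab_edge s t s1 s2 o : edge_at s t s1 s2 o ->
  slab (x t).1 (x s).1 = edge_cap o `|` edge_arc o s1 s2.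
Proof.
move=> he; have [[s0 ss1 s12 s2t tpi] [s21 pE qE]] := he; have No := edge_floor he.
have e1 : 0 <= s1 <= pi by apply/andP; split; lra.
have e2 : 0 <= s2 <= pi by apply/andP; split; lra.
have arc a : cos s2 < a <= cos s1 -> exists th, [/\ a = cos th, circ a = sin th, 0 <= sin th & K (pt o th)].
  move=> /andP[a1 a2].
  have aI : a \in `[-1, 1] by rewrite in_itv/=; have := cos_geN1 s2; have := cos_le1 s1; lra.
  have aE := acosK aI; move: (aI); rewrite in_itv/= => aI'.
  have ac : 0 <= acos a <= pi by rewrite acos_ge0// acos_lepi.
  have h1 : s1 <= acos a.
    rewrite leNgt; apply/negP => h; suff : cos s1 < cos (acos a) by rewrite aE; lra.
    by rewrite ltr_cos// in_itv/=.
  have h2 : acos a <= s2.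
    rewrite leNgt; apply/negP => h; suff : cos (acos a) < cos s2 by rewrite aE; lra.
    by rewrite ltr_cos// in_itv/=.
  exists (acos a); rewrite aE; split=> //; first by rewrite -{1}aE circ_cos.
    by apply: sin_ge0_pi.
  apply: (bodyarc hK h1 h2 s21); [rewrite -pE|rewrite -qE]; exact: bodyP hK _.
have p1E : (x s).1 = o.1 + cos s1 by rewrite pE.
have q1E : (x t).1 = o.1 + cos s2 by rewrite qE.
apply/seteqP; split=> y; rewrite /slab /edge_cap /edge_arc /undercap/=.
  move=> [h1 h2 h3 [e ye Ke]].
  have ha : cos s2 < y.1 - o.1 <= cos s1 by apply/andP; split; lra.
  have [th [thE cE sth Kth]] := arc _ ha.
  have a1 : -1 <= y.1 - o.1 <= 1 by rewrite thE cos_geN1 cos_le1.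
  have [c|c] := leP (y.2 - o.2) (circ (y.1 - o.1)); first by right; split=> //; lra.
  left; have yD : ~ disk_at o y.
    move=> /disk_atE; rewrite /d2 => h; have c0 : 0 <= circ (y.1 - o.1) by rewrite sqrtr_ge0.
    have y0 : 0 <= y.2 - o.2 by lra.
    by have := circ_le y0 h; lra.
  split=> //; have [E|ne] := eqVneq e y.2; first by rewrite (surjective_pairing y) -E.
  have [ne'] : y.2 < e by rewrite lt_neqAle eq_sym ne.
  (* The arc point over [y.1] lies in K below y, and K has a point above y, so convexity puts y in
     K. *)
  pose w := o.2 + sin th.
  have wy : w < y.2 by rewrite /w -cE; lra.
  have := @bodyconv _ _ _ hK (y.1, e) (pt o th) ((y.2 - w) / (e - w)).
  have -> : ((y.2 - w) / (e - w) * (y.1, e).1 + (1 - (y.2 - w) / (e - w)) * (pt o th).1,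
       (y.2 - w) / (e - w) * (y.1, e).2 + (1 - (y.2 - w) / (e - w)) * (pt o th).2) = y.
    rewrite [RHS]surjective_pairing /= -thE -/w; congr (_, _); field; rewrite gt_eqF//; lra.
  apply=> //; apply/andP; split; first by rewrite divr_ge0//; lra.
  by rewrite ler_pdivrMr; lra.
move=> [[Ky /disk_atE/negP]|[h1 h2 h3 h4]].
  rewrite -ltNge => hy; have [f1 f2 f3] := edge_cap_range he Ky hy.
  split=> //; [exact: ltW|lra|exists y.2 => //; by rewrite -surjective_pairing].
have ha : cos s2 < y.1 - o.1 <= cos s1 by apply/andP; split; lra.
have [th [thE cE sth Kth]] := arc _ ha.
split; [lra|lra|lra|exists (o.2 + sin th); first by rewrite -cE; lra].
by have -> : y.1 = o.1 + cos th by [rewrite -thE; ring].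
Qed.

Lemma slab_edge_disjoint s t s1 s2 o : edge_at s t s1 s2 o ->
  edge_cap o `&` edge_arc o s1 s2 = set0.
Proof.
move=> he.
apply/seteqP; split=> // y [[Ky hy] [/= h1 h2 h3 h4]].
apply: hy; apply/disk_atE; rewrite leNgt; apply/negP => hy.
have [f1 f2 f3] := edge_cap_range he Ky hy.
have : (y.1 - o.1) ^+ 2 + (y.2 - o.2) ^+ 2 <= 1.
  apply: le_circ => //; first lra.
  by have := cos_geN1 s2; have := cos_le1 s1; lra.
by move: hy; rewrite /d2; lra.
Qed.

Lemma area_slab_edge s t s1 s2 o : edge_at s t s1 s2 o -> pmeas (slab (x t).1 (x s).1) /\
  area (slab (x t).1 (x s).1) = (ar (edge_cap o) + ((s2 - s1 + cos s1 * sin s1 - cos s2 * sin s2) / 2 -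
    (N - o.2) * (cos s1 - cos s2)))%:E.
Proof.
move=> he; have [[s0 ss1 s12 s2t tpi] [s21 pE qE]] := he; have No := edge_floor he.
have e1 : 0 <= s1 <= pi by apply/andP; split; lra.
have e2 : 0 <= s2 <= pi by apply/andP; split; lra.
have mA : pmeas (edge_cap o) := pmeas_cut hK o.
have mU := pmeas_undercap (N - o.2) (cos s2) (cos s1).
have mZ : pmeas (edge_arc o s1 s2) by exact: pmeas_translation.
rewrite (slab_edge he); split; first exact: pmeasU.
have AK : edge_cap o `<=` K by move=> y [].
have cc : cos s2 < cos s1 by rewrite ltr_cos// in_itv/=.
rewrite (areaU mA mZ (slab_edge_disjoint he)) -(arE hK mA AK).
rewrite area_translation// area_undercap ?cos_geN1 ?cos_le1//; last by rewrite subr_le0.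
by rewrite -EFinD !circ_int_cos//; congr EFin; field.
Qed.

(** The trapezoid between a chord and the level N differs from the signed triangle of the chord with
    the origin by the difference of these values at the two ends. *)
Definition slab_pot (p : R * R) : R := p.1 * p.2 / 2 - N * p.1.

Lemma area_slab s t : 0 <= s -> s <= t -> t <= pi ->
  [/\ pmeas (slab (x t).1 (x s).1), (x t).1 <= (x s).1 &
  area (slab (x t).1 (x s).1) = (F s t + wt (x s) (x t) + (slab_pot (x s) - slab_pot (x t)))%:E].
Proof.
move=> s0 st tpi; have pi0 := pi_gt0 R.
have [E|ne] := eqVneq (x s) (x t).
  have -> : slab (x t).1 (x s).1 = set0.
    by apply/seteqP; split=> // y [/= h1 h2 _ _]; move: h1 h2; rewrite E; lra.
  split; [exact: closed_pmeas closed0|by rewrite E|].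
  have -> : F s t = 0 by rewrite /cap_area E eqxx ifT//; lra.
  rewrite area0 E /wt d2pp subrr addr0.
  have := @seg_chord R 0; rewrite cos0 sin0 mulr1 subrr => ->; last by rewrite lexx.
  by congr EFin; field.
have had : s <= t <= s + pi *+ 2 by apply/andP; split; lra.
have Kp := bodyP hK s; have Kq := bodyP hK t.
have [s1 [s2 [ o [e1 s12 e2 s21 [pE qE]]]]] :=
  edge_exists ne (body4 hK Kp Kq) (bodyS hK s Kq) (bodyS hK t Kp) had.
have [m1 m2] := area_slab_edge (conj (And5 s0 e1 s12 e2 tpi) (And3 s21 pE qE)).
split=> //.
  have : cos s2 < cos s1 by rewrite ltr_cos// in_itv/=; apply/andP; split; lra.
  by rewrite pE qE /pt/=; lra.
rewrite m2 /cap_area (negbTE ne) pE qE ectrE//; congr EFin; rewrite -[RHS]addrA; congr (_ + _).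
rewrite /slab_pot /wt.
have -> : d2 (pt o s1) (pt o s2) = 2 - 2 * cos (s2 - s1).
  by rewrite cosB /d2/=; have := cos2Dsin2 s1; have := cos2Dsin2 s2; lra.
rewrite seg_chord ?sinB /pt/=; last by apply/andP; split; lra.
by field.
Qed.

(** Slabs over adjacent intervals are disjoint, and their [slab_pot] terms telescope. *)
Lemma cap_area_slab_add s t r : 0 <= s -> s <= t -> t <= r -> r <= pi ->
  F s r + wt (x s) (x r) = F s t + wt (x s) (x t) + (F t r + wt (x t) (x r)).
Proof.
move=> s0 st tr rpi.
have [m1 h1 a1] := area_slab s0 st (le_trans tr rpi).
have [m2 h2 a2] := area_slab (le_trans s0 st) tr rpi.
have [m3 h3 a3] := area_slab s0 (le_trans st tr) rpi.
have E : slab (x r).1 (x s).1 = slab (x r).1 (x t).1 `|` slab (x t).1 (x s).1.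
  apply/seteqP; split=> y; rewrite /slab/=.
    by move=> [f1 f2 f3 f4]; have [h|h] := leP y.1 (x t).1; [left|right].
  by move=> [[f1 f2 f3 f4]|[f1 f2 f3 f4]]; split=> //; lra.
have : slab (x r).1 (x t).1 `&` slab (x t).1 (x s).1 = set0.
  by apply/seteqP; split=> // y [[/= _ f1 _ _] [f2 _ _ _]]; lra.
move=> /(areaU m2 m1); rewrite -E a1 a2 a3 -EFinD => -[].
move: (slab_pot _) (slab_pot _) (slab_pot _) (F s r) (F s t) (F t r)
  (wt (x s) (x r)) (wt (x s) (x t)) (wt (x t) (x r)); clear => *; lra.
Qed.

Lemma cap_area_exchange0 a b c d : 0 <= a -> a <= b -> b <= c -> c <= d -> d <= pi ->
  F a c + F b d <= F a d + F b c.
Proof.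
move=> a0 ab bc cd dpi; have pi0 := pi_gt0 R.
have A1 := cap_area_slab_add a0 ab bc (le_trans cd dpi).
have A2 := cap_area_slab_add a0 ab (le_trans bc cd) dpi.
(* Subtracting [A1] from [A2] cancels F a b and wt (x a) (x b) and turns the inequality for F into
   the reversed one for [wt]. *)
suff : wt (x a) (x d) + wt (x b) (x c) <= wt (x a) (x c) + wt (x b) (x d).
  move: A1 A2; move: (F _ _) (F _ _) (F _ _) (F _ _) (F _ _) (wt _ _) (wt _ _) (wt _ _) (wt _ _)
    (wt _ _); clear => *; lra.
clear A1 A2; have [->|nab] := eqVneq (x a) (x b); first by rewrite addrC.
have [->|ncd] := eqVneq (x c) (x d); first by [].
have edge s t : s <= t -> t <= s + pi -> x s != x t -> exists s1 s2 o, 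
    [/\ s <= s1, s1 < s2, s2 <= t, s2 < s1 + pi & x s = pt o s1 /\ x t = pt o s2].
  move=> st ts ne; have had : s <= t <= s + pi *+ 2 by apply/andP; split; lra.
  exact: (edge_exists ne (body4 hK (bodyP hK s) (bodyP hK t)) (bodyS hK s (bodyP hK t))
    (bodyS hK t (bodyP hK s)) had).
have hab : b <= a + pi by lra.
have hcd : d <= c + pi by lra.
have [s1 [s2 [ o [f1 f2 f3 f4 [aE bE]]]]] := edge a b ab hab nab.
have [t1 [t2 [ o' [g1 g2 g3 g4 [cE dE]]]]] := edge c d cd hcd ncd.
have S u v : supp (x u) u (x v) := bodyS hK u (bodyP hK v).
(* Seen from the edge from c to d, the next directions are a and b one full turn later. *)
have S2 u v : supp (x u) (u + pi *+ 2) (x v) by rewrite suppD2pi.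
have o_c : d2 (x c) o <= 1.
  by apply: (@edge_disk_in _ _ _ _ o a b c s1 s2 aE bE) => //; lra.
have o_d : d2 (x d) o <= 1.
  by apply: (@edge_disk_in _ _ _ _ o a b d s1 s2 aE bE) => //; lra.
have o_a : d2 (x a) o' <= 1.
  by apply: (@edge_disk_in _ _ _ _ o' c d (a + pi *+ 2) t1 t2 cE dE) => //; lra.
have o_b : d2 (x b) o' <= 1.
  by apply: (@edge_disk_in _ _ _ _ o' c d (b + pi *+ 2) t1 t2 cE dE) => //; lra.
rewrite aE bE cE dE; apply: wt_exchange; rewrite -?aE -?bE -?cE -?dE//; try lra.
move=> s t /andP[h1 h2] /andP[h3 h4]; apply: (body4 hK).
  by apply: (bodyarc hK h1 h2 f4); rewrite -?aE -?bE; exact: bodyP hK _.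
by apply: (bodyarc hK h3 h4 g4); rewrite -?cE -?dE; exact: bodyP hK _.
Qed.

End slabs.

(** * Rotation and conclusion *)

#[local] Opaque area.


Section rotation.
Context {R : realType}.
Implicit Types (p q : R * R).

Lemma rotK t p : rot t (rot (- t) p) = p.
Proof.
have e := cos2Dsin2 t; rewrite [RHS]surjective_pairing /rot/= cosN sinN; congr (_, _).
  by rewrite -[RHS]mul1r -e; ring.
by rewrite -[RHS]mul1r -e; ring.
Qed.

Lemma rotNK t p : rot (- t) (rot t p) = p.
Proof. by have := rotK (- t) p; rewrite opprK. Qed.

Lemma d2_rot t p q : d2 (rot t p) (rot t q) = d2 p q.
Proof. by rewrite -[RHS]mul1r -(cos2Dsin2 t) /d2 /rot/=; ring. Qed.

Lemma rot_pt t p s : rot t (pt p s) = pt (rot t p) (s + t).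
Proof. by rewrite /rot /pt/= cosD sinD; congr (_, _); ring. Qed.

Lemma rot_ectr t p q : rot t (ectr p q) = ectr (rot t p) (rot t q).
Proof. by rewrite /ectr !d2_rot /rot/=; congr (_, _); field. Qed.

Lemma continuous_rot (t : R) : continuous (rot t).
Proof.
move=> p; rewrite /continuous_at {1}/rot.
apply: (@cvg_pair _ _ _ (nbhs p) (nbhs (rot t p).1) (nbhs (rot t p).2) _ _ _
  (fun q => (rot t q).1) (fun q => (rot t q).2)).
  by apply: cvgB; apply: cvgMr; [exact: cvg_fst|exact: cvg_snd].
by apply: cvgD; apply: cvgMr; [exact: cvg_fst|exact: cvg_snd].
Qed.

Lemma disk_at_rot t p q : disk_at (rot (- t) p) q <-> disk_at p (rot t q).
Proof. by rewrite !disk_atE -(d2_rot t q) rotK. Qed.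

Variables (K : set (R * R)) (x : R -> R * R).
Hypothesis hK : body K x.

Lemma body_rot t : body (rot t @^-1` K) (fun s => rot (- t) (x (s + t))).
Proof.
split=> /=.
- by move=> s; rewrite /= rotK; exact: bodyP hK _.
- move=> s y Ky; have := bodyS hK (s + t) Ky; rewrite /supp -(d2_rot (- t)) rotNK.
  suff -> : ctr (rot (- t) (x (s + t))) s = rot (- t) (ctr (x (s + t)) (s + t)) by [].
  rewrite -{1}(pt_ctr (x (s + t)) (s + t)) rot_pt (_ : s + t - t = s) ?ctr_pt//.
  by ring.
- by move=> s; rewrite addrAC (body2pi hK).
- move=> o a b c ab bc ca; rewrite !rot_pt; apply: (bodyarc hK); lra.
- move=> y z k hk Ky Kz; have := bodyconv hK hk Ky Kz; congr K.
  by rewrite /rot/=; congr (_, _); ring.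
- by move=> y z Ky Kz; rewrite -(d2_rot t); exact: (body4 hK Ky Kz).
- have -> : rot t @^-1` K = rot (- t) @` K.
    apply/seteqP; split=> y /=; first by move=> Ky; exists (rot t y) => //; rewrite rotNK.
    by move=> [z Kz <-]; rewrite rotK.
  apply: continuous_compact; last exact: bodycompact hK.
  by apply: continuous_subspaceT; exact: continuous_rot.
have [y [z [Ky Kz yz]]] := body2 hK.
exists (rot (- t) y), (rot (- t) z); rewrite !rotK; split=> //.
by apply: contraNN yz => /eqP E; rewrite -(rotK t y) E rotK.
Qed.

Lemma cap_area_rot t u v : cap_area (rot t @^-1` K) (fun s => rot (- t) (x (s + t))) u v =
  cap_area K x (u + t) (v + t).
Proof.
have E p q : (rot (- t) p == rot (- t) q) = (p == q).
  by apply/eqP/eqP => [h|->//]; rewrite -(rotK t p) h rotK.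
rewrite /cap_area E (_ : v + t - (u + t) = v - u); last by ring.
have E' : ar (rot t @^-1` K) = ar K by rewrite /ar (area_rot t (pmeas_body hK)).
case: (_ == _); first exact: (congr1 (fun r : R => if v - u <= pi then 0 else r) E').
rewrite -rot_ectr; set e := ectr _ _; transitivity (ar (rot t @^-1` (K `\` disk_at e))); last first.
  by rewrite /ar (area_rot t (pmeas_cut hK e)).
congr ar; apply/seteqP; split=> y /= [h1 h2]; split=> // h; apply: h2.
  exact/disk_at_rot.
exact: (disk_at_rot _ _ _).1 h.
Qed.

(** Rotating by a places the four directions in [0, pi]. *)
Lemma cap_area_exchange a b c d : a <= b -> b <= c -> c <= d -> d <= a + pi ->
  cap_area K x a c + cap_area K x b d <= cap_area K x a d + cap_area K x b c.
Proof.
move=> ab bc cd da.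
have := @cap_area_exchange0 _ _ _ (body_rot a) 0 (b - a) (c - a) (d - a).
by rewrite !cap_area_rot add0r !subrK; apply; lra.
Qed.

End rotation.

Section inscribed.
Context {R : realType}.

Lemma pmeas_polygon m (Q : set (R * R)) : disk_polygon m Q -> pmeas Q.
Proof.
by move=> [c ->]; apply: closed_pmeas; apply: closed_bigI => i _; exact: disk_at_closed.
Qed.

Lemma max_inscribed_area_fin m (K : set (R * R)) : (1 < m)%N -> pmeas K -> (area K < +oo)%E ->
  exists2 a, max_inscribed_area m K = a%:E & (a%:E <= area K)%E.
Proof.
move=> m1 mK fK.
have h1 : (max_inscribed_area m K <= area K)%E.
  apply: ub_ereal_sup => _ [Q [hQ QK] <-]; apply: le_area => //; exact: pmeas_polygon hQ.
have h0 : (0 <= max_inscribed_area m K)%E.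
  apply: ereal_sup_ubound; exists set0; last exact: area0.
  by split=> //; exact: disk_polygon_set0.
exists (fine (max_inscribed_area m K)); rewrite fineK// ge0_fin_numE//.
all: exact: le_lt_trans h1 fK.
Qed.

End inscribed.

Theorem theorem1 (R : realType) (n : nat) (hn : (4 <= n)%N)
    (K : set (R * R)) (hK : spindle_convex_disk K) :
  (max_inscribed_area n.-1 K + max_inscribed_area n.+1 K
     <= 2%:E * max_inscribed_area n K)%E.
Proof.
have n1 : (1 < n.-1)%N by case: n hn => [|[|[|]]].
have n2 : (1 < n)%N by exact: leq_trans hn.
have mK : pmeas K by apply: pmeas_compact; case: hK => -[].
have disk_case c : disk_at c = K -> (area K < +oo)%E ->
    (max_inscribed_area n.-1 K + max_inscribed_area n.+1 K <= 2%:E * max_inscribed_area n K)%E.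
  move=> cK fK; have [a -> ha] := max_inscribed_area_fin n1 mK fK.
  have [b -> hb] := max_inscribed_area_fin (leqW n2) mK fK.
  have : (area K <= max_inscribed_area n K)%E.
    apply: ereal_sup_ubound; exists K => //; split=> //.
    exists (fun=> c); rewrite -cK; apply/seteqP; split=> y; first by move=> h i _.
    by move=> /(_ (Ordinal (ltnW n2)) I).
  have [e -> he] := max_inscribed_area_fin n2 mK fK => hk.
  have := le_trans ha hk; have := le_trans hb hk; rewrite !lee_fin => h1 h2.
  lra.
have [big|small] := pselect (exists y z, [/\ K y, K z & 4 <= d2 y z]).
  have [c cK] := large_diameter hK big.
  apply: (disk_case c cK); apply: (@area_bounded _ _ (`|c.1| + `|c.2| + 1)) => // p.
  rewrite -cK => /disk_atE; rewrite /d2 => h.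
  have h1 : `|p.1 - c.1| <= 1.
    rewrite -(@ler_pXn2r _ 2)// ?nnegrE// -normrX ger0_norm ?sqr_ge0//.
    by have := sqr_ge0 (p.2 - c.2); lra.
  have h2 : `|p.2 - c.2| <= 1.
    rewrite -(@ler_pXn2r _ 2)// ?nnegrE// -normrX ger0_norm ?sqr_ge0//.
    by have := sqr_ge0 (p.1 - c.1); lra.
  have := ler_norm c.1; have := ler_norm (- c.1); have := ler_norm c.2; have := ler_norm (- c.2).
  move: h1 h2; rewrite !normrN !ler_norml; lra.
have [x hx] : exists x, body K x.
  apply: body_exists => // y z Ky Kz; rewrite ltNge; apply/negP => h; apply: small.
  by exists y, z.
have fK := area_body_fin hx.
have [a aE ha] := max_inscribed_area_fin n1 mK fK.
have [b bE hb] := max_inscribed_area_fin (leqW n2) mK fK.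
have [e eE he] := max_inscribed_area_fin n2 mK fK.
have pair P Q : disk_polygon n.-1 P -> P `<=` K -> disk_polygon n.+1 Q -> Q `<=` K ->
    ar P + ar Q <= 2 * e.
  move=> hP PK hQ QK.
  have [s cs hs] := cap_cost_polygon hx n1 hP PK.
  have [t ct ht] := cap_cost_polygon hx (leqW n2) hQ QK.
  (* The bound on n is used here: repairing a large gap takes at least three directions. *)
  have k2 : (2 < n.-1)%N by lia.
  have nE : n.-1.+1 = n by rewrite prednK// ltnW.
  rewrite -{1}nE in ct ht.
  have [u [v [cu cv huv]]] := dowker_cost (cap_area_2pi hx) (@cap_area_exchange _ _ _ hx)
    (cap_area_fix hx) k2 cs ct.
  rewrite nE in cu cv huv.
  have bound w : cyc n w -> ar K <= e + cost (cap_area K x) n w.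
    move=> cw; have [W [hW WK hw]] := cap_cost_inscribed hx cw n2.
    apply: (le_trans hw); rewrite lerD2r -lee_fin -eE (arE hx (pmeas_polygon hW) WK).
    by apply: ereal_sup_ubound; exists W.
  have := bound u cu; have := bound v cv.
  move: huv hs ht; move: (cost _ _ _) (cost _ _ _) (cost _ _ _) (cost _ _ _) (ar _) (ar _) (ar _).
  clear => *; lra.
(* All three suprema are real, so the bound on pairs passes to the suprema one polygon at a time. *)
rewrite aE bE eE -EFinD -EFinM lee_fin -lerBrDl.
rewrite -lee_fin -bE; apply: ub_ereal_sup => _ [Q [hQ QK] <-].
rewrite -(arE hx (pmeas_polygon hQ) QK) lee_fin lerBrDl -lerBrDr.
rewrite -lee_fin -aE; apply: ub_ereal_sup => _ [P [hP PK] <-].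
rewrite -(arE hx (pmeas_polygon hP) PK) lee_fin lerBrDr.
exact: pair.
Qed.
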